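(* Let $\mathbf T:=(T_\Phi,T_\Psi)$ be a pseudo-hyponormal Toeplitz pair with bounded type symbols $\Phi,\Psi\in L^\infty_{M_n}$. Suppose the inner parts of the right coprime factorizations of $\Phi_+$ and $\Psi_+$ commute. If $\Phi$ and $\Psi$ have a common tensored-scalar pole at a point $\alpha\in\mathbb D$, then this pole has the same order for $\Phi$ and for $\Psi$.
   Context: $L^\infty_{M_n}$: bounded measurable $n\times n$ matrix functions on the unit circle $\mathbb T$; $H^\infty_{M_n},H^2_{M_n}$: those with entries in the Hardy spaces $H^\infty,H^2$. For $\Phi\in L^\infty_{M_n}$: $\Phi_+:=P(\Phi)\in H^2_{M_n}$ and $\Phi_-:=[P^\perp(\Phi)]^*\in zH^2_{M_n}$, where $P$ is the orthogonal projection of $L^2_{M_n}$ onto $H^2_{M_n}$. A matrix function is of bounded type if each entry equals a.e. a quotient of two $H^\infty$ functions; ''bounded type symbol'' means that both $\Phi$ and $\Phi^*$ are of bounded type. $T_\Phi f=P_n(\Phi f)$ and $H_\Phi f=J_nP_n^\perp(\Phi f)$ on the $\mathbb C^n$-valued Hardy space $H^2_{\mathbb C^n}$, with $(J_nf)(z)=\overline zf(\overline z)$. $(T_\Phi,T_\Psi)$ is pseudo-hyponormal if $$\begin{pmatrix}H_{\Phi_+^*}^*H_{\Phi_+^*}-H_{\Phi_-^*}^*H_{\Phi_-^*}&H_{\Phi_+^*}^*H_{\Psi_+^*}-H_{\Psi_-^*}^*H_{\Phi_-^*}\\H_{\Psi_+^*}^*H_{\Phi_+^*}-H_{\Phi_-^*}^*H_{\Psi_-^*}&H_{\Psi_+^*}^*H_{\Psi_+^*}-H_{\Psi_-^*}^*H_{\Psi_-^*}\end{pmatrix}\ge0.$$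 Right coprime factorization: $\Phi_+=\Theta A^*$ with $\Theta\in H^\infty_{M_n}$ inner ($\Theta^*\Theta=I_n$ a.e.), $A\in H^2_{M_n}$, and $\Theta,A$ right coprime, i.e. $\widetilde\Theta,\widetilde A$ have no common left inner divisor other than unitary constants, where $\widetilde F(z)=F(\overline z)^*$ and an inner $\Delta$ is a left inner divisor of $F$ if $F=\Delta F'$ with $F'$ a matrix $H^2$-function; $\Theta$ is the inner part. A bounded type $\Phi\in L^\infty_{M_n}$ has a tensored-scalar singularity with respect to a nonconstant scalar inner function $\theta$ if $\ker H_\Phi\subseteq\theta H^2_{\mathbb C^n}$. With $b_\alpha(z)=\frac{z-\alpha}{1-\overline\alpha z}$, $\Phi$ has a tensored-scalar pole at $\alpha$ if $\ker H_\Phi\subseteq b_\alpha H^2_{\mathbb C^n}$, and its order there is the largest $p$ with $\ker H_\Phi\subseteq b_\alpha^pH^2_{\mathbb C^n}$. *)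

(* Defs.v *)
From HB Require Import structures.
From mathcomp Require Import all_boot all_order all_algebra.
From mathcomp Require Import all_classical all_reals all_analysis.
From mathcomp Require Import complex.
Set Implicit Arguments.
Unset Strict Implicit.
Unset Printing Implicit Defensive.
Import Order.TTheory GRing.Theory Num.Theory.
Local Open Scope classical_set_scope.
Local Open Scope ring_scope.

(* A function on the unit circle is a function on R[i] of which only the values
   at the points e^{it}, -pi <= t <= pi, matter; equality in L^2 is equality
   almost everywhere on the circle.  All spaces of matrix functions are taken
   entrywise, and C^n-valued functions are the n x 1 matrix functions. *)

Section Circle.
Variable R : realType.

Definition expi (t : R) : R[i] := Complex (cos t) (sin t).

Definition ae_circle (Q : R[i] -> Prop) : Prop :=
  {ae @lebesgue_measure R, forall t : R, t \in `[- pi, pi] -> Q (expi t)}.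

(* Integral against the normalized arc length measure dt / (2 pi). *)
Definition circle_int (f : R[i] -> R[i]) : R[i] :=
  Complex
    ((2 * pi)^-1 *
      \int[@lebesgue_measure R]_(t in `[- pi, pi]) complex.Re (f (expi t)))%R
    ((2 * pi)^-1 *
      \int[@lebesgue_measure R]_(t in `[- pi, pi]) complex.Im (f (expi t)))%R.

Definition circle_measurable (f : R[i] -> R[i]) : Prop :=
  measurable_fun (`[- pi, pi] : set R) (fun t => complex.Re (f (expi t))) /\
  measurable_fun (`[- pi, pi] : set R) (fun t => complex.Im (f (expi t))).

Definition L2 (f : R[i] -> R[i]) : Prop :=
  circle_measurable f /\
  (@lebesgue_measure R).-integrable `[- pi, pi]
    (fun t => (complex.Re `|f (expi t)| ^+ 2)%:E).

Definition Linfty (f : R[i] -> R[i]) : Prop :=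
  circle_measurable f /\
  exists M : R, ae_circle (fun z => complex.Re `|f z| <= M).

Definition fourier (f : R[i] -> R[i]) (k : int) : R[i] :=
  circle_int (fun z => f z * z ^ (- k)).

Definition H2 (f : R[i] -> R[i]) : Prop :=
  L2 f /\ forall k : int, k < 0 -> fourier f k = 0.

Definition Hinfty (f : R[i] -> R[i]) : Prop := Linfty f /\ H2 f.

Definition bounded_type (f : R[i] -> R[i]) : Prop :=
  exists g h : R[i] -> R[i], [/\ Hinfty g, Hinfty h &
    ae_circle (fun z => h z != 0 /\ f z = g z / h z)].

Definition blaschke (alpha z : R[i]) : R[i] :=
  (z - alpha) / (1 - alpha^* * z).

End Circle.

Section MatrixFunctions.
Variable R : realType.

Definition entrywise (S : (R[i] -> R[i]) -> Prop) m n
  (F : R[i] -> 'M[R[i]]_(m, n)) : Prop := forall i j, S (fun z => F z i j).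

Definition ctmx m n (A : 'M[R[i]]_(m, n)) : 'M[R[i]]_(n, m) :=
  (map_mx Num.conj A)^T.

Definition adjf m n (F : R[i] -> 'M[R[i]]_(m, n)) : R[i] -> 'M[R[i]]_(n, m) :=
  fun z => ctmx (F z).

Definition tilde m n (F : R[i] -> 'M[R[i]]_(m, n)) : R[i] -> 'M[R[i]]_(n, m) :=
  fun z => ctmx (F z^*).

Definition inner_L2 m n (F G : R[i] -> 'M[R[i]]_(m, n)) : R[i] :=
  circle_int (fun z => \tr (F z *m ctmx (G z))).

(* The orthogonal projection of L^2 onto H^2: G is the projection of F when G
   is in H^2 and F - G is orthogonal to H^2.  It is determined only almost
   everywhere, so a representative is chosen. *)
Definition projH2 m n (F : R[i] -> 'M[R[i]]_(m, n)) :
    R[i] -> 'M[R[i]]_(m, n) :=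
  xget (fun=> 0) [set G : R[i] -> 'M[R[i]]_(m, n) |
    entrywise (@H2 R) G /\
    forall K, entrywise (@H2 R) K -> inner_L2 (fun z => F z - G z) K = 0].

Definition projH2perp m n (F : R[i] -> 'M[R[i]]_(m, n)) :
    R[i] -> 'M[R[i]]_(m, n) := fun z => F z - projH2 F z.

Definition plus_part n (Phi : R[i] -> 'M[R[i]]_n) : R[i] -> 'M[R[i]]_n :=
  projH2 Phi.

Definition minus_part n (Phi : R[i] -> 'M[R[i]]_n) : R[i] -> 'M[R[i]]_n :=
  adjf (projH2perp Phi).

Definition flipJ n (f : R[i] -> 'cV[R[i]]_n) : R[i] -> 'cV[R[i]]_n :=
  fun z => z^* *: f z^*.

Definition hankel n (Phi : R[i] -> 'M[R[i]]_n) (f : R[i] -> 'cV[R[i]]_n) :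
    R[i] -> 'cV[R[i]]_n :=
  flipJ (projH2perp (fun z => Phi z *m f z)).

Definition ker_hankel n (Phi : R[i] -> 'M[R[i]]_n) (f : R[i] -> 'cV[R[i]]_n) :
    Prop :=
  entrywise (@H2 R) f /\ ae_circle (fun z => hankel Phi f z = 0).

(* For a symbol that is only in L^2, the formula J P^perp (Phi f) makes sense
   for these f; they include the bounded f in H^2, hence are dense. *)
Definition hankel_dom n (Phi : R[i] -> 'M[R[i]]_n) (f : R[i] -> 'cV[R[i]]_n) :
    Prop :=
  entrywise (@H2 R) f /\ entrywise (@L2 R) (fun z => Phi z *m f z).

(* Positivity of the 2 x 2 operator matrix: its quadratic form at (f, g), with
   <S^* T u, v> written <T u, S v>.  With A, B, C, D the Hankel operators of
   Phi_+^*, Phi_-^*, Psi_+^*, Psi_-^*, the matrix is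
     ( A^* A - B^* B   A^* C - D^* B )
     ( C^* A - B^* D   C^* C - D^* D ).
   Phi_+ and the like need not be bounded, although for bounded Phi, Psi the
   four operators are (A is the Hankel operator of Phi^*, B that of Phi), so
   the form is tested on their common domain, which is dense. *)
Definition pseudo_hyponormal n (Phi Psi : R[i] -> 'M[R[i]]_n) : Prop :=
  let SA := adjf (plus_part Phi) in
  let SB := adjf (minus_part Phi) in
  let SC := adjf (plus_part Psi) in
  let SD := adjf (minus_part Psi) in
  let A := hankel SA in let B := hankel SB in
  let C := hankel SC in let D := hankel SD in
  let dom h :=
    [/\ hankel_dom SA h, hankel_dom SB h, hankel_dom SC h & hankel_dom SD h] in
  forall f g : R[i] -> 'cV[R[i]]_n, dom f -> dom g ->
  0 <= (inner_L2 (A f) (A f) - inner_L2 (B f) (B f))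
     + (inner_L2 (C g) (A f) - inner_L2 (B g) (D f))
     + (inner_L2 (A f) (C g) - inner_L2 (D f) (B g))
     + (inner_L2 (C g) (C g) - inner_L2 (D g) (D g)).

Definition bounded_type_symbol n (Phi : R[i] -> 'M[R[i]]_n) : Prop :=
  entrywise (@bounded_type R) Phi /\ entrywise (@bounded_type R) (adjf Phi).

Definition inner_mx n (Theta : R[i] -> 'M[R[i]]_n) : Prop :=
  entrywise (@Hinfty R) Theta /\
  ae_circle (fun z => ctmx (Theta z) *m Theta z = 1%:M).

Definition left_inner_divisor n (Delta F : R[i] -> 'M[R[i]]_n) : Prop :=
  inner_mx Delta /\
  exists2 F' : R[i] -> 'M[R[i]]_n, entrywise (@H2 R) F' &
    ae_circle (fun z => F z = Delta z *m F' z).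

Definition unitary_constant n (Delta : R[i] -> 'M[R[i]]_n) : Prop :=
  exists2 U : 'M[R[i]]_n, ctmx U *m U = 1%:M & ae_circle (fun z => Delta z = U).

Definition left_coprime n (F G : R[i] -> 'M[R[i]]_n) : Prop :=
  forall Delta, left_inner_divisor Delta F -> left_inner_divisor Delta G ->
    unitary_constant Delta.

Definition right_coprime n (F G : R[i] -> 'M[R[i]]_n) : Prop :=
  left_coprime (tilde F) (tilde G).

Definition right_coprime_factorization n (F Theta A : R[i] -> 'M[R[i]]_n) :
    Prop :=
  [/\ inner_mx Theta, entrywise (@H2 R) A, right_coprime Theta A &
      ae_circle (fun z => F z = Theta z *m ctmx (A z))].

(* f lies in theta H^2, for a scalar function theta. *)
Definition scalar_mulH2 n (theta : R[i] -> R[i]) (f : R[i] -> 'cV[R[i]]_n) :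
    Prop :=
  exists2 g : R[i] -> 'cV[R[i]]_n, entrywise (@H2 R) g &
    ae_circle (fun z => f z = theta z *: g z).

Definition tensored_scalar_singularity n (Phi : R[i] -> 'M[R[i]]_n)
    (theta : R[i] -> R[i]) : Prop :=
  forall f, ker_hankel Phi f -> scalar_mulH2 theta f.

Definition tensored_scalar_pole n (Phi : R[i] -> 'M[R[i]]_n) (alpha : R[i]) :
    Prop :=
  tensored_scalar_singularity Phi (blaschke alpha).

Definition tensored_scalar_pole_order n (Phi : R[i] -> 'M[R[i]]_n)
    (alpha : R[i]) (p : nat) : Prop :=
  tensored_scalar_singularity Phi (fun z => blaschke alpha z ^+ p) /\
  forall q : nat,
    tensored_scalar_singularity Phi (fun z => blaschke alpha z ^+ q) ->
    (q <= p)%N.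

End MatrixFunctions.

(* Main.v *)
Require Import Defs.
From mathcomp Require Import all_boot all_order all_algebra.
From mathcomp Require Import all_classical all_reals all_analysis.
From mathcomp Require Import measurable_realfun.
From mathcomp Require Import complex ring lra.
Set Implicit Arguments.
Unset Strict Implicit.
Unset Printing Implicit Defensive.
Import Order.TTheory GRing.Theory Num.Theory.
Import numFieldNormedType.Exports.
Local Open Scope classical_set_scope.
Local Open Scope ring_scope.

(* Let A, B, C, D be the Hankel operators of Phi^*, Phi, Psi^*, Psi, and let b be
   the Blaschke factor at alpha.  If A f + C g = 0 and B g = 0, the quadratic form at
   (f, g) is - |B f|^2 - |D g|^2, so B f = 0 and D g = 0.  With g = 0 this gives
   ker A <= ker B <= b H^2, and a dimension count then shows that every y with b y in
   H^2 equals Phi^* f modulo H^2 for some f in H^2.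
   Let ker D <= b^q H^2 and g in ker B.  Bounded type provides a scalar h = b^j u with
   u(alpha) <> 0 such that h Psi^* is analytic, so A f + C (b^j u g) = 0 for f = 0.
   The powers of b can be removed one at a time: if A f + C (b^(i+1) u g) = 0, then
   f is in ker B, say f = b f', and Phi^* f' + Psi^* (b^i u g) becomes analytic after
   multiplication by b, hence is Phi^* f'' modulo H^2.  For i = 0 one gets
   D (u g) = 0, so u g and therefore g lie in b^q H^2.  Thus ker B and ker D lie in
   b^q H^2 for the same q. *)

(** * Integration over the circle *)

(** The dimension count: let V consist of the f in H^2 with b Phi^* f in H^2, and send f in V to the
    value of b Phi^* f at alpha, a vector of C^n. Its kernel is the set of f with Phi^* f in H^2; by
    ker A <= b H^2 such an f is b w, and w is again in V, so the kernel lies in b V. Since V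
    contains h C^n it has full rank, V / b V has dimension n, and the map is onto. No structure
    theorem for V is used: the order at alpha of the determinant of n elements of V plays the role
    of the dimension. It equals j n for the vectors h e_i and drops whenever the n values are
    dependent. The obstacle in the first step is that positivity is known only on a domain
    guaranteed to contain the bounded functions. A general pair with A f + C g = 0 must be
    approximated, and then neither A f + C g nor the cross term of B g with D f vanishes; both are
    only small. The factor u cannot be divided out of h, as it need not be invertible in H^infinity,
    but u(alpha) <> 0 makes it harmless for divisibility by b. Finally h e_i lies in ker B, which
    bounds the admissible q by j, so a largest one exists. *)

Section RealIntegral.
Variable R : realType.
Local Notation mu := (@lebesgue_measure R).
Local Notation D := (`[- pi, pi]%classic : set (measurableTypeR R)).
Implicit Types u v : measurableTypeR R -> R.

Definition rmeas u := measurable_fun D u.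
Definition rint u := mu.-integrable D (EFin \o u).
Definition RI u : R := \int[mu]_(t in D) u t.

Lemma measD : measurable D. Proof. exact: measurable_itv. Qed.
#[local] Hint Resolve measD : core.

Lemma pi_pos : (0 : R) < pi. Proof. exact: pi_gt0. Qed.

Lemma rint_meas u : rint u -> rmeas u.
Proof. by move=> /measurable_int /measurable_EFinP. Qed.

Lemma rintD u v : rint u -> rint v -> rint (fun t => u t + v t).
Proof. by move=> hu hv; have := integrableD measD hu hv. Qed.

Lemma rintZ (k : R) u : rint u -> rint (fun t => k * u t).
Proof. by move=> hu; have := integrableZl measD k hu. Qed.

Lemma rint_le u v : rmeas u -> (forall t, D t -> `|u t| <= v t) -> rint v ->
  rint u.
Proof.
move=> mu_ uv hv; apply: (le_integrable measD _ _ hv).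
  exact/measurable_EFinP.
by move=> t Dt /=; rewrite lee_fin (le_trans (uv t Dt))// ler_norm.
Qed.

Lemma rint_cst (k : R) : rint (fun=> k).
Proof.
apply: measurable_bounded_integrable => //.
- by rewrite /= lebesgue_measure_itv/=; case: ifP => _; rewrite ?ltry// -EFinD ltry.
- by exists `|k|; split => // x kx t _; exact: ltW.
Qed.

Lemma rint_abs u : rint u -> rint (fun t => `|u t|).
Proof. by move=> hu; have := integrable_norm hu. Qed.

Lemma RID u v : rint u -> rint v -> RI (fun t => u t + v t) = RI u + RI v.
Proof. by move=> hu hv; exact: RintegralD. Qed.

Lemma RIZ (k : R) u : rint u -> RI (fun t => k * u t) = k * RI u.
Proof. by move=> hu; exact: RintegralZl. Qed.

Lemma RI_cst (k : R) : RI (fun=> k) = k * (2 * pi).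
Proof.
rewrite /RI Rintegral_cst//= lebesgue_measure_itv/= lte_fin.
have p : (0 : R) < pi := pi_pos; rewrite ifT ?gtrN//=.
by rewrite opprK mulr2n mulrDl mul1r.
Qed.

Lemma le_RI u v : rint u -> rint v -> (forall t, D t -> u t <= v t) ->
  RI u <= RI v.
Proof. by move=> hu hv; exact: le_Rintegral. Qed.

Lemma RI_ae u v : rmeas u -> rmeas v ->
  {ae mu, forall t, D t -> u t = v t} -> RI u = RI v.
Proof.
move=> hu hv huv; rewrite /RI /Rintegral; congr fine.
apply: ae_eq_integral => //; try exact/measurable_EFinP.
by apply: filterS huv => t h Dt; rewrite h.
Qed.

Lemma rint_ae u v : rint u -> rmeas v ->
  {ae mu, forall t, D t -> u t = v t} -> rint v.
Proof.
move=> hu hv huv; apply/integrableP; split; first exact/measurable_EFinP.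
move/integrableP: (hu) => [_]; congr (_ < _)%E.
apply: ae_eq_integral => //; try by
  apply: measurableT_comp => //; apply/measurable_EFinP => //; exact: rint_meas.
by apply: filterS huv => t h Dt /=; rewrite h.
Qed.

Lemma RI0_ae u : rint u -> (forall t, D t -> 0 <= u t) -> RI u = 0 ->
  {ae mu, forall t, D t -> u t = 0}.
Proof.
move=> hu u0 hI.
have : (\int[mu]_(x in D) `|(EFin \o u) x| = 0)%E.
  rewrite -[RHS](_ : (RI u)%:E = _); last by rewrite hI.
  rewrite /RI /Rintegral fineK; last exact: integrable_fin_num.
  by apply: eq_integral => t; rewrite inE => Dt; rewrite /= ger0_norm ?u0.
have mE : measurable_fun D (EFin \o u).
  by apply/measurable_EFinP; exact: rint_meas.
move/(ae_eq_integral_abs mu measD mE).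
by apply: filterS => t h Dt; have := h Dt => /= -[].
Qed.

End RealIntegral.
Arguments measD {R}.
Arguments pi_pos {R}.

(** * Fatou's lemma and almost everywhere convergence of fast Cauchy sequences *)

Section RealLimits.
Variable R : realType.
Local Notation mu := (@lebesgue_measure R).
Local Notation D := (`[- pi, pi]%classic : set (measurableTypeR R)).
Implicit Types u v : measurableTypeR R -> R.

#[local] Hint Resolve measD : core.

(** Fatou's lemma for the tail starting at [m0], because the bound is available only from there on.
    Integrability of [v] belongs to the conclusion: it is what puts the limit function of a Cauchy
    sequence in L^2. *)
Lemma fatou_bound (w : nat -> measurableTypeR R -> R) v (B : R) m0 :
  (forall m, rint (w m)) -> (forall m t, 0 <= w m t) -> rmeas v ->
  (forall t, 0 <= v t) ->
  {ae mu, forall t, D t -> w ^~ t @ \oo --> v t} ->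
  (forall m, (m0 <= m)%N -> RI (w m) <= B) -> rint v /\ RI v <= B.
Proof.
move=> hw w0 mv v0 wv hB.
have mEv : measurable_fun D (EFin \o v) by exact/measurable_EFinP.
have fat := @fatou _ _ _ mu D measD (fun m => EFin \o w (m + m0)%N) _ _.
have {fat}/fat H : forall n : nat, measurable_fun D (EFin \o w (n + m0)%N).
  by move=> n; apply/measurable_EFinP; exact: rint_meas.
have {}/H H : forall (n : nat) (x : measurableTypeR R), D x ->
    (0 <= (EFin \o w (n + m0)%N) x)%E by move=> n x _; rewrite /= lee_fin.
have E : (\int[mu]_(x in D) (v x)%:E =
    \int[mu]_(x in D) limn_einf (fun m => (EFin \o w (m + m0)%N) x))%E.
  apply: ae_eq_integral => //.
    rewrite (_ : (fun _ => _) = (fun x : measurableTypeR R =>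
      - limn_esup ((fun m => \- (EFin \o w (m + m0)%N))^~ x))%E); last first.
      by apply/funext => x; rewrite limn_esupN oppeK.
    apply: measurableT_comp => //; apply: measurable_fun_limn_esup => n.
    by apply: measurableT_comp => //; apply/measurable_EFinP; exact: rint_meas.
  apply: filterS wv => t h Dt; symmetry.
  have /cvg_limn_einf_sup[] // :
      (fun m => (EFin \o w (m + m0)%N) t) @ \oo --> (v t)%:E.
  apply/cvg_EFin; first by apply: nearW.
  have := h; rewrite -(cvg_shiftn m0); exact.
have Hb : (limn_einf (fun n : nat =>
    \int[mu]_(x in D) (EFin \o w (n + m0)%N) x) <= B%:E)%E.
  rewrite limn_einf_lim; apply: lime_le; first exact: is_cvg_einfs.
  apply: nearW => n.
  apply: (@le_trans _ _ (\int[mu]_(x in D) (EFin \o w (n + m0)%N) x)%E).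
    by apply: ereal_inf_lbound; exists n => /=.
  rewrite -[X in (X <= _)%E]fineK; last exact: integrable_fin_num (hw _).
  by rewrite lee_fin; apply: hB; exact: leq_addl.
have Hv : (\int[mu]_(x in D) (v x)%:E <= B%:E)%E.
  by rewrite E; exact: le_trans H Hb.
have iv : rint v.
  apply/integrableP; split => //.
  under eq_integral do rewrite /= ger0_norm//.
  by apply: le_lt_trans Hv _; exact: ltry.
split => //; rewrite -lee_fin /RI /Rintegral fineK //.
exact: integrable_fin_num.
Qed.

(** The inequality |x| <= 2^-k + 2^k x^2 turns the bound 4^-k on the squares into a bound of order
    2^-k on the integrals of |v_(k+1) - v_k|. The sum of these increments is therefore integrable,
    hence finite almost everywhere, and the telescoping series converges absolutely there. *)
Lemma ae_cvg_fast (v : nat -> measurableTypeR R -> R) :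
  (forall k, rmeas (v k)) ->
  (forall k, rint (fun t => (v k.+1 t - v k t) ^+ 2)) ->
  (forall k, RI (fun t => (v k.+1 t - v k t) ^+ 2) <= (1 / 4) ^+ k) ->
  {ae mu, forall t, D t -> cvgn (v ^~ t)}.
Proof.
move=> mv hv hb.
have md k : rmeas (fun t => v k.+1 t - v k t) by have := measurable_funB (mv k.+1) (mv k).
have mad k : rmeas (fun t => `|v k.+1 t - v k t|).
  by apply: (measurableT_comp _ (md k)).

have amgm k t : `|v k.+1 t - v k t| <=
    (1 / 2) ^+ k + 2 ^+ k * (v k.+1 t - v k t) ^+ 2.
  rewrite -(real_normK (num_real (v k.+1 t - v k t))).
  set x := `| _ |; have x0 : 0 <= x by exact: normr_ge0.
  have p2 : (0 : R) < 2 ^+ k by apply: exprn_gt0.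
  have -> : (1 / 2 : R) ^+ k = (2 ^+ k)^-1 by rewrite div1r exprVn.
  set p := 2 ^+ k in p2 *.
  have : 0 <= (p * x - 1) ^+ 2 by exact: sqr_ge0.
  move=> h; rewrite -(ler_pM2l p2) mulrDr divff ?gt_eqF //.
  rewrite (_ : p * (p * x ^+ 2) = (p * x) ^+ 2); last by rewrite exprMn; ring.
  have : 0 <= (p * x) ^+ 2 by exact: sqr_ge0.
  by rewrite !expr2 in h *; lra.
have iad k : rint (fun t => `|v k.+1 t - v k t|).
  apply: (@rint_le _ _ (fun t => (1/2)^+k + 2 ^+ k * (v k.+1 t - v k t) ^+ 2)).
  - exact: mad.
  - by move=> t _; rewrite normr_id; exact: amgm.
  - by apply: rintD; [exact: rint_cst|apply: rintZ].
(* [2 * pi] is the integral of the constant 1 in the bound [amgm]; the other 1 comes from 2^k 4^-k =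
   2^-k. *)
pose C : R := 2 * pi + 1.
have bad k : RI (fun t => `|v k.+1 t - v k t|) <= C * (1 / 2) ^+ k.
  apply: (le_trans (le_RI (iad k) _ (fun t _ => amgm k t))).
    by apply: rintD; [exact: rint_cst|apply: rintZ].
  rewrite RID; [|exact: rint_cst|exact: rintZ].
  rewrite RI_cst RIZ // /C.
  have p2 : (0 : R) <= 2 ^+ k by apply: exprn_ge0.
  have := ler_wpM2l p2 (hb k).
  by rewrite -exprMn (_ : 2 * (1 / 4) = 1 / 2 :> R) ?mulrDl; [lra|field].
have mE k : measurable_fun D (fun t => `|v k.+1 t - v k t|%:E).
  by apply/measurable_EFinP; exact: mad.
pose S t := (\sum_(k <oo) `|v k.+1 t - v k t|%:E)%E.
have mS : measurable_fun D S.
  apply: ge0_emeasurable_sum => // k t _ _; exact: normr_ge0.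
have iS : mu.-integrable D S.
  apply/integrableP; split => //.
  under eq_integral => t _ do rewrite gee0_abs ?nneseries_ge0 //.
  rewrite /S integral_nneseries //.
  apply: (@le_lt_trans _ _ (\sum_(k <oo) ((2 * C) / (2 ^ (k + 1))%N%:R)%:E)%E).
    apply: lee_nneseries.
      by move=> k _ _; apply: integral_ge0 => t _; rewrite lee_fin.
    move=> k _; rewrite -[X in (X <= _)%E]fineK; last first.
      exact: integrable_fin_num (iad k).
    rewrite lee_fin; apply: le_trans (bad k) _.
    by rewrite div1r exprVn expnD natrM natrX expn1 invfM mulrA; lra.
  rewrite (cvg_lim _ (@cvg_geometric_eseries_half R (2 * C) 0)) //.
  exact: ltry.
have := integrable_ae measD iS.
apply: filterS => t h Dt; have {h} hfin := h Dt.
have cv : cvgn (series (fun k => v k.+1 t - v k t)).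
  apply: normed_cvg; apply: nnseries_is_cvg; first by move=> i; exact: normr_ge0.
  by move: hfin; rewrite ge0_fin_numE //; apply: nneseries_ge0.
have E : (fun n => v 0%N t + series (fun k => v k.+1 t - v k t) n) = v ^~ t.
  by apply/funext => n; rewrite (eq_sum_telescope (v ^~ t) n).
have : cvgn (fun n => v 0%N t + series (fun k => v k.+1 t - v k t) n).
  by apply: is_cvgD => //; exact: is_cvg_cst.
by rewrite E.
Qed.

End RealLimits.

(** * Invariance of the integral under t -> -t *)

Section Reflection.
Variable R : realType.
Local Notation mu := (@lebesgue_measure R).
Local Notation D := (`[- pi, pi]%classic : set (measurableTypeR R)).
Implicit Types u v : measurableTypeR R -> R.

#[local] Hint Resolve measD : core.

Let opp : measurableTypeR R -> measurableTypeR R := fun t => - t.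

Let mopp : measurable_fun setT opp.
Proof. exact: oppr_measurable. Qed.

Lemma lebesgue_measure_opp (A : set (measurableTypeR R)) : measurable A ->
  pushforward mu opp A = mu A.
Proof.
move=> mA; symmetry; apply: (lebesgue_measure_unique (mu := pushforward mu opp)) => //.
move=> X [[a b] _ <-] /=; rewrite /pushforward.
have -> : opp @^-1` `]a, b]%classic = `[- b, - a[%classic.
  have e (t : R) : (a < - t <= b) = (- b <= t < - a).
    by rewrite ltrNr lerNl andbC.
  apply/seteqP; split => t /=; rewrite /opp /= !in_itv /= => h.
    exact: etrans (esym (e t)) h.
  exact: etrans (e t) h.
rewrite !lebesgue_measure_itv /= !lte_fin ltrN2.
by case: ifP => // _; rewrite -!EFinB opprK addrC.
Qed.

Lemma oppD : opp @^-1` D = D.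
Proof.
have e (t : R) : (- pi <= - t <= pi) = (- pi <= t <= pi).
  by rewrite lerN2 lerNl andbC.
apply/seteqP; split => t /=; rewrite /opp /= !in_itv /= => h.
  exact: etrans (esym (e t)) h.
exact: etrans (e t) h.
Qed.

Lemma rmeas_opp u : rmeas u -> rmeas (fun t => u (- t)).
Proof.
move=> hu; apply: (measurable_comp measD _ hu).
  by rewrite -[X in _ `<=` X]oppD => _ [t Dt <-]; rewrite /opp /= opprK.
exact: (measurable_funS measurableT).
Qed.

Lemma RI_opp u : rint u -> rint (fun t => u (- t)) /\ RI (fun t => u (- t)) = RI u.
Proof.
move=> hu; have mu_ := rint_meas hu.
have mE : measurable_fun D (EFin \o u) by exact/measurable_EFinP.
have mEo : measurable_fun D (EFin \o (fun t => u (- t))).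
  by apply/measurable_EFinP; exact: rmeas_opp.
(* Extension by 0 outside [D] gives a function measurable on the whole line, as the formula for
   integrals against a push-forward requires. *)
pose f := (EFin \o u) \_ D.
have mf : measurable_fun setT f by apply/(measurable_restrictT _ measD).
have fE (t : measurableTypeR R) : D t -> f (- t) = (u (- t))%:E.
  move=> Dt; rewrite /f patchE ifT //; apply/mem_set.
  by move: Dt; rewrite -[in X in X -> _]oppD.
have meq (A : set (measurableTypeR R)) : measurable A -> A `<=` D ->
   mu A = pushforward mu opp A by move=> mA _; rewrite lebesgue_measure_opp.
have io : rint (fun t => u (- t)).
  apply/integrableP; split => //.
  move/integrableP: (hu) => [_].
  rewrite (eq_measure_integral (pushforward mu opp)) //.
  rewrite ge0_integral_pushforward //; last first.
    exact: measurableT_comp.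
  by rewrite oppD.
split => //.
rewrite /RI /Rintegral; congr fine.
transitivity (\int[mu]_(t in opp @^-1` D) (f \o opp) t)%E.
  by rewrite oppD; apply: eq_integral => t; rewrite inE => Dt /=; rewrite fE.
rewrite -(integral_pushforward mopp mf) //.
  rewrite -(@eq_measure_integral _ _ _ D (pushforward mu opp) mu) //.
  by apply: eq_integral => t tD; rewrite /f patchE tD.
rewrite oppD; apply: eq_integrable io => // t; rewrite inE => Dt /=.
by rewrite fE.
Qed.

End Reflection.

(** * Functions whose primitive vanishes *)

Section Vanish.
Variable R : realType.
Local Notation mu := (@lebesgue_measure R).
Local Notation D := (`[- pi, pi]%classic : set (measurableTypeR R)).
Implicit Types u v : measurableTypeR R -> R.

#[local] Hint Resolve measD : core.

Lemma ae_neq (a : R) : {ae mu, forall t, t <> a}.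
Proof.
exists [set a]; split => //; first exact: lebesgue_measure_set1.
by move=> t /= /contrapT.
Qed.

(** Lebesgue differentiation: almost every value of [u] is the derivative of its primitive, which is
    0 near each interior point. The primitive is written with an indicator factor because that
    indicator is later obtained as a limit of trigonometric polynomials. *)
Lemma primitive0_ae u : rint u ->
  (forall x : R, - pi < x < pi -> RI (fun t => u t * (t <= x)%R%:R) = 0) ->
  {ae mu, forall t, D t -> u t = 0}.
Proof.
move=> hu hx; pose f : R -> R := u \_ D.
have fi : mu.-integrable setT (EFin \o f).
  by rewrite /f -restrict_EFin; apply/(integrable_mkcond _ measD).
have loc : locally_integrable setT f.
  by apply: open_integrable_locally => //; exact: openT.
have H := @FTC1 R f (BLeft (- pi)) _ loc.
have {}H := H _.
have {}/H H : forall y : R,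
  mu.-integrable [set` Interval (BLeft (- pi)) (BRight y)] (EFin \o f).
  by move=> y; apply: integrableS fi.
have F0 (y : R) : - pi < y < pi -> \int[mu]_(t in `[- pi, y]) f t = 0.
  move=> /andP[y1 y2]; rewrite -[RHS](hx y) ?y1 // /RI.
  rewrite Rintegral_mkcond [RHS]Rintegral_mkcond; apply: eq_Rintegral => t _.
  rewrite /f !patchE !mem_setE !in_itv /=.
  case: (leP (- pi) t) => //= h1; case: (leP t y) => /= h2; rewrite ?mulr0 ?mulr1.
  - by rewrite (le_trans h2 (ltW y2)).
  - by case: ifP.
apply: filterS3 H (ae_neq (- pi)) (ae_neq pi).
  exact: (ae_filter_ringOfSetsType mu).
move=> t Ht n1 norm2.
rewrite /= in_itv /= => /andP[t1 t2].
have p1 : - pi < t by rewrite lt_neqAle t1 andbT; apply/eqP => h; apply: n1.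
have p2 : t < pi by rewrite lt_neqAle t2 andbT; apply/eqP.
have {Ht}[] := Ht; first by rewrite /= lte_fin.
have fE : f t = u t by rewrite /f patchE mem_setE in_itv /= t1 t2.
move=> _ dE; rewrite -fE -dE.
rewrite derive1E; rewrite (near_eq_derive (g := cst 0)) ?derive_cst //.
near=> s; apply: F0; apply/andP; split; near: s.
- exact: lt_nbhsr.
- exact: lt_nbhsl.
Unshelve. all: by end_near. Qed.

End Vanish.

(** * Real and imaginary parts, and the points of the circle *)

Section Complex.
Variable R : realType.
Implicit Types x y : R[i].
Lemma creM x y : complex.Re (x * y) = complex.Re x * complex.Re y - complex.Im x * complex.Im y.
Proof. by case: x y => [a b] [c d]. Qed.
Lemma cimM x y : complex.Im (x * y) = complex.Re x * complex.Im y + complex.Im x * complex.Re y.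
Proof. by case: x y => [a b] [c d]. Qed.
Lemma creD x y : complex.Re (x + y) = complex.Re x + complex.Re y.
Proof. by case: x y => [a b] [c d]. Qed.
Lemma cimD x y : complex.Im (x + y) = complex.Im x + complex.Im y.
Proof. by case: x y => [a b] [c d]. Qed.
Lemma creN x : complex.Re (- x) = - complex.Re x.
Proof. by case: x => [a b]. Qed.
Lemma cimN x : complex.Im (- x) = - complex.Im x.
Proof. by case: x => [a b]. Qed.
Lemma creC x : complex.Re (x^*) = complex.Re x.
Proof. by case: x => [a b]. Qed.
Lemma cimC x : complex.Im (x^*) = - complex.Im x.
Proof. by case: x => [a b]. Qed.
Lemma conjE x : x^* = Complex (complex.Re x) (- complex.Im x).
Proof. by case: x => [a b]. Qed.
Lemma complex_ext x y : complex.Re x = complex.Re y -> complex.Im x = complex.Im y -> x = y.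
Proof. by case: x y => [a b] [c d] /= -> ->. Qed.
Lemma norm2E x : complex.Re `|x| ^+ 2 = complex.Re x ^+ 2 + complex.Im x ^+ 2.
Proof.
rewrite normc_def /= sqr_sqrtr //; apply: addr_ge0; exact: sqr_ge0.
Qed.
Lemma mul_conj x : x * x^* = (complex.Re `|x| ^+ 2)%:C%C.
Proof. by rewrite norm2E; apply: complex_ext; rewrite ?creM ?cimM creC cimC /=; ring. Qed.
Lemma expiN (t : R) : expi (- t) = (expi t)^*.
Proof. by rewrite conjE /expi /= cosN sinN. Qed.
Lemma expiD (s t : R) : expi (s + t) = expi s * expi t.
Proof. by apply: complex_ext; rewrite ?creM ?cimM /= ?cosD ?sinD; ring. Qed.
Lemma expi0 : expi (0 : R) = 1.
Proof. by rewrite /expi cos0 sin0. Qed.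
Lemma expi_neq0 (t : R) : expi t != 0.
Proof.
apply/eqP => h; have := expiD t (- t); rewrite subrr expi0 h mul0r => /eqP.
by rewrite oner_eq0.
Qed.
Lemma expi_conj (t : R) : expi t * (expi t)^* = 1.
Proof. by rewrite -expiN -expiD subrr expi0. Qed.
Lemma expiV (t : R) : (expi t)^-1 = (expi t)^*.
Proof. by rewrite -[RHS](mulKf (expi_neq0 t)) expi_conj mulr1. Qed.
Lemma expi_norm (t : R) : `|expi t| = 1.
Proof.
by rewrite normc_def /= cos2Dsin2 sqrtr1.
Qed.
Lemma expiXz (t : R) (k : int) : expi t ^ k = expi (k%:~R * t).
Proof.
have P (n : nat) : expi t ^+ n = expi (n%:R * t).
  elim: n => [|n IH]; first by rewrite mul0r expi0 expr0.
  by rewrite exprS IH -expiD mulrSr; congr expi; ring.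
case: k => n; first by rewrite -exprnP P.
by rewrite -[LHS]/((expi t ^+ n.+1)^-1) P expiV -expiN NegzE rmorphN /= mulNr.
Qed.
Lemma Re_normM x y : complex.Re `|x * y| = complex.Re `|x| * complex.Re `|y|.
Proof. by rewrite normrM creM [X in _ - X](_ : _ = 0) ?subr0 // !normc_def /= mulr0. Qed.
Lemma Re_norm_ge0 x : 0 <= complex.Re `|x|.
Proof. by rewrite normc_def /=; exact: sqrtr_ge0. Qed.
Lemma Re_norm_le x : `|complex.Re x| <= complex.Re `|x|.
Proof. by have := normc_ge_Re x; rewrite [X in _ <= X]normc_def lecR normc_def. Qed.
Lemma Im_norm_le x : `|complex.Im x| <= complex.Re `|x|.
Proof. 
rewrite normc_def /= -(sqrtr_sqr (complex.Im x)); apply: ler_wsqrtr.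
by rewrite lerDr sqr_ge0.
Qed.
End Complex.

(** * Complex-valued integrals over the circle *)

Section CircleIntegral.
Variable R : realType.
Local Notation C := R[i].
Local Notation mu := (@lebesgue_measure R).
Local Notation D := (`[- pi, pi]%classic : set (measurableTypeR R)).
Local Notation reof f := (fun t : measurableTypeR R => complex.Re (f (expi t))).
Local Notation imof f := (fun t : measurableTypeR R => complex.Im (f (expi t))).
Implicit Types f g h : C -> C.

#[local] Hint Resolve measD : core.

Lemma ae_circleP (Q : C -> Prop) : ae_circle Q <->
  {ae mu, forall t : measurableTypeR R, D t -> Q (expi t)}.
Proof.
rewrite /ae_circle; split; apply: (@filterS _ _ (ae_filter_ringOfSetsType mu)) => t h; move: h; rewrite /= in_itv; exact.
Qed.

Lemma ae_all (Q : C -> Prop) : (forall z, `|z| = 1 -> Q z) -> ae_circle Q.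
Proof.
move=> h; apply: (@filterS _ _ (ae_filter_ringOfSetsType mu) setT); last first.
  exact: filterT.
by move=> t _ _; apply: h; exact: expi_norm.
Qed.

Lemma ae_imp (P Q : C -> Prop) : (forall z, `|z| = 1 -> P z -> Q z) ->
  ae_circle P -> ae_circle Q.
Proof.
rewrite /ae_circle => h; apply: (@filterS _ _ (ae_filter_ringOfSetsType mu)).
by move=> t ht tD; apply: h; [exact: expi_norm|exact: ht].
Qed.

Lemma ae_and (P Q : C -> Prop) :
  ae_circle P -> ae_circle Q -> ae_circle (fun z => P z /\ Q z).
Proof.
rewrite /ae_circle => hP hQ; have := hP; have := hQ.
apply: (@filterS2 _ _ (ae_filter_ringOfSetsType mu)).
by move=> t h1 h2 tD; split; [exact: h2|exact: h1].
Qed.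

Lemma ae_imp2 (P Q S : C -> Prop) :
  (forall z, `|z| = 1 -> P z -> Q z -> S z) ->
  ae_circle P -> ae_circle Q -> ae_circle S.
Proof. by move=> h hP hQ; apply: ae_imp (ae_and hP hQ) => z z1 []; apply: h. Qed.

Lemma ae_fin (I : finType) (P : I -> C -> Prop) :
  (forall i, ae_circle (P i)) -> ae_circle (fun z => forall i, P i z).
Proof.
move=> h.
have : ae_circle (fun z => forall i, i \in enum I -> P i z).
  elim: (enum I) => [|a s IH]; first by apply: ae_all.
  apply: ae_imp2 (h a) IH => z _ h1 h2 i; rewrite inE => /orP[/eqP->//|].
  exact: h2.
by apply: ae_imp => z _ H i; apply: H; rewrite mem_enum.
Qed.

Lemma cm_re f : circle_measurable f -> rmeas (reof f).
Proof. by case. Qed.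
Lemma cm_im f : circle_measurable f -> rmeas (imof f).
Proof. by case. Qed.

Lemma rmeasD (u v : measurableTypeR R -> R) : rmeas u -> rmeas v -> rmeas (fun t => u t + v t).
Proof. by move=> hu hv; have := measurable_funD hu hv. Qed.
Lemma rmeasM (u v : measurableTypeR R -> R) : rmeas u -> rmeas v -> rmeas (fun t => u t * v t).
Proof. by move=> hu hv; have := measurable_funM hu hv. Qed.
Lemma rmeasN (u : measurableTypeR R -> R) : rmeas u -> rmeas (fun t => - u t).
Proof. by move=> hu; have := measurable_funN hu. Qed.
Lemma rmeas_cst (a : R) : rmeas (fun _ : measurableTypeR R => a).
Proof. exact: measurable_cst. Qed.
Lemma eq_rmeas (u v : measurableTypeR R -> R) : u =1 v -> rmeas u -> rmeas v.
Proof. by move=> /funext ->. Qed.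

Lemma cmI f : rmeas (reof f) -> rmeas (imof f) -> circle_measurable f.
Proof. by []. Qed.

Lemma cmD f g : circle_measurable f -> circle_measurable g ->
  circle_measurable (fun z => f z + g z).
Proof.
move=> [a b] [c d]; apply: cmI.
- by apply: eq_rmeas (rmeasD a c) => t; rewrite creD.
- by apply: eq_rmeas (rmeasD b d) => t; rewrite cimD.
Qed.

Lemma cmM f g : circle_measurable f -> circle_measurable g ->
  circle_measurable (fun z => f z * g z).
Proof.
move=> [a b] [c d]; apply: cmI.
- by apply: eq_rmeas (rmeasD (rmeasM a c) (rmeasN (rmeasM b d))) => t; rewrite creM.
- by apply: eq_rmeas (rmeasD (rmeasM a d) (rmeasM b c)) => t; rewrite cimM.
Qed.

Lemma cmC f : circle_measurable f -> circle_measurable (fun z => (f z)^*).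
Proof.
move=> [a b]; apply: cmI.
- by apply: eq_rmeas a => t; rewrite creC.
- by apply: eq_rmeas (rmeasN b) => t; rewrite cimC.
Qed.

Lemma cm_cst (a : C) : circle_measurable (fun=> a).
Proof. by apply: cmI; exact: rmeas_cst. Qed.

Lemma cm_id : circle_measurable (fun z : C => z).
Proof.
apply: cmI.
- by apply: measurable_funTS; apply: continuous_measurable_fun; exact: continuous_cos.
- by apply: measurable_funTS; apply: continuous_measurable_fun; exact: continuous_sin.
Qed.

Definition cint f := [/\ circle_measurable f, rint (reof f) & rint (imof f)].

Lemma circle_intE f : circle_int f =
  ((2 * pi)^-1)%:C%C * Complex (RI (reof f)) (RI (imof f)).
Proof. by apply: complex_ext; rewrite ?creM ?cimM /= mul0r ?subr0 ?addr0. Qed.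

Lemma cint_re f : cint f -> rint (reof f). Proof. by case. Qed.
Lemma cint_im f : cint f -> rint (imof f). Proof. by case. Qed.
Lemma cint_cm f : cint f -> circle_measurable f. Proof. by case. Qed.

Lemma rint_eq (u v : measurableTypeR R -> R) : u =1 v -> rint u -> rint v.
Proof. by move=> /funext ->. Qed.
Lemma RI_eq (u v : measurableTypeR R -> R) : u =1 v -> RI u = RI v.
Proof. by move=> /funext ->. Qed.

Lemma cintD f g : cint f -> cint g -> cint (fun z => f z + g z).
Proof.
move=> [a b c] [a' b' c']; split; first exact: cmD.
- by apply: rint_eq (rintD b b') => t; rewrite creD.
- by apply: rint_eq (rintD c c') => t; rewrite cimD.
Qed.

Lemma ciD f g : cint f -> cint g ->
  circle_int (fun z => f z + g z) = circle_int f + circle_int g.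
Proof.
move=> [_ b c] [_ b' c']; rewrite !circle_intE -mulrDr; congr (_ * _).
apply: complex_ext => /=.
- by rewrite -RID //; apply: RI_eq => t; rewrite creD.
- by rewrite -RID //; apply: RI_eq => t; rewrite cimD.
Qed.

Lemma ciZ (k : C) f : cint f -> circle_int (fun z => k * f z) = k * circle_int f.
Proof.
move=> [_ b c]; rewrite !circle_intE mulrCA; congr (_ * _).
apply: complex_ext; rewrite ?creM ?cimM /=.
- rewrite -mulNr -!RIZ // -RID; [|exact: rintZ|exact: rintZ].
  by apply: RI_eq => t; rewrite creM mulNr.
- rewrite -!RIZ // -RID; [|exact: rintZ|exact: rintZ].
  by apply: RI_eq => t; rewrite cimM.
Qed.

Lemma ciC f : cint f -> circle_int (fun z => (f z)^*) = (circle_int f)^*.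
Proof.
move=> [_ b c]; rewrite !circle_intE rmorphM /=; congr (_ * _).
  by rewrite conjE /= oppr0.
rewrite conjE; apply: complex_ext => /=.
- by apply: RI_eq => t; rewrite creC.
- by rewrite -mulN1r -RIZ //; apply: RI_eq => t; rewrite cimC mulN1r.
Qed.

Lemma cint0 : cint (fun=> 0).
Proof. by split; [exact: cm_cst|exact: rint_cst|exact: rint_cst]. Qed.

Lemma ci_cst (k : C) : circle_int (fun=> k) = k.
Proof.
rewrite circle_intE !RI_cst.
have p0 : (2 * pi : R) != 0 by rewrite mulf_neq0 ?pnatr_eq0 // gt_eqF // pi_pos.
by apply: complex_ext; rewrite ?creM ?cimM /= mul0r ?subr0 ?addr0 mulrC mulfK.
Qed.

Lemma cint_sum (I : Type) (s : seq I) (F : I -> C -> C) :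
  (forall i, cint (F i)) -> cint (fun z => \sum_(i <- s) F i z).
Proof.
move=> h; elim: s => [|a s IH].
  by rewrite (_ : (fun _ => _) = fun=> 0); [exact: cint0|apply/funext => z; rewrite big_nil].
rewrite (_ : (fun _ => _) = fun z => F a z + \sum_(i <- s) F i z).
  exact: cintD.
by apply/funext => z; rewrite big_cons.
Qed.

Lemma ci_sum (I : Type) (s : seq I) (F : I -> C -> C) :
  (forall i, cint (F i)) ->
  circle_int (fun z => \sum_(i <- s) F i z) = \sum_(i <- s) circle_int (F i).
Proof.
move=> h; elim: s => [|a s IH].
  rewrite big_nil -[RHS](ci_cst 0); congr circle_int.
  by apply/funext => z; rewrite big_nil.
rewrite big_cons -IH -ciD //; last exact: cint_sum.
by congr circle_int; apply/funext => z; rewrite big_cons.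
Qed.

Lemma ci_ae f g : circle_measurable f -> circle_measurable g ->
  ae_circle (fun z => f z = g z) -> circle_int f = circle_int g.
Proof.
move=> cf cg /ae_circleP h; rewrite !circle_intE; congr (_ * Complex _ _).
- apply: RI_ae; [exact: cm_re|exact: cm_re|].
  by apply: (@filterS _ _ (ae_filter_ringOfSetsType mu)) h;
   move=> t ht Dt; rewrite ht.
- apply: RI_ae; [exact: cm_im|exact: cm_im|].
  by apply: (@filterS _ _ (ae_filter_ringOfSetsType mu)) h;
   move=> t ht Dt; rewrite ht.
Qed.

Lemma cm_flip f : circle_measurable f -> circle_measurable (fun z => f (z^*)).
Proof.
move=> [a b]; apply: cmI.
- by apply: eq_rmeas (rmeas_opp a) => t; rewrite expiN.
- by apply: eq_rmeas (rmeas_opp b) => t; rewrite expiN.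
Qed.

Lemma cint_flip f : cint f -> cint (fun z => f (z^*)).
Proof.
move=> [a b c]; split; first exact: cm_flip.
- by apply: rint_eq (RI_opp b).1 => t; rewrite expiN.
- by apply: rint_eq (RI_opp c).1 => t; rewrite expiN.
Qed.

Lemma ci_flip f : cint f -> circle_int (fun z => f (z^*)) = circle_int f.
Proof.
move=> [a b c]; rewrite !circle_intE; congr (_ * Complex _ _).
- by rewrite -(RI_opp b).2; apply: RI_eq => t; rewrite expiN.
- by rewrite -(RI_opp c).2; apply: RI_eq => t; rewrite expiN.
Qed.

End CircleIntegral.

(** * Square integrable functions *)

Section L2Theory.
Variable R : realType.
Local Notation C := R[i].
Local Notation mu := (@lebesgue_measure R).
Local Notation D := (`[- pi, pi]%classic : set (measurableTypeR R)).
Local Notation reof f := (fun t : measurableTypeR R => complex.Re (f (expi t))).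
Local Notation imof f := (fun t : measurableTypeR R => complex.Im (f (expi t))).
Implicit Types f g h : C -> C.

#[local] Hint Resolve measD : core.

Definition sqf f (t : measurableTypeR R) : R :=
  complex.Re (f (expi t)) ^+ 2 + complex.Im (f (expi t)) ^+ 2.

Lemma sqf_ge0 f t : 0 <= sqf f t.
Proof. by apply: addr_ge0; exact: sqr_ge0. Qed.

Lemma sqf_meas f : circle_measurable f -> rmeas (sqf f).
Proof.
move=> [a b]; apply: eq_rmeas (rmeasD (rmeasM a a) (rmeasM b b)) => t.
by rewrite /sqf !expr2.
Qed.

Lemma sqfE f t : sqf f t = complex.Re `|f (expi t)| ^+ 2.
Proof. by rewrite norm2E. Qed.

Lemma L2P f : L2 f <-> circle_measurable f /\ rint (sqf f).
Proof.
rewrite /L2 /rint; have -> : sqf f = (fun t => complex.Re `|f (expi t)| ^+ 2).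
  by apply/funext => t; exact: sqfE.
by [].
Qed.

Lemma L2_cm f : L2 f -> circle_measurable f. Proof. by case. Qed.
Lemma L2_sq f : L2 f -> rint (sqf f). Proof. by move/L2P => []. Qed.

Lemma L2_prod f g : L2 f -> L2 g -> cint (fun z => f z * g z).
Proof.
move=> hf hg; have cf := L2_cm hf; have cg := L2_cm hg.
have cfg := cmM cf cg.
have i := rintD (L2_sq hf) (L2_sq hg).
have B (a b : C) : complex.Re `|a * b| <=
    (complex.Re a ^+ 2 + complex.Im a ^+ 2) + (complex.Re b ^+ 2 + complex.Im b ^+ 2).
  rewrite -!norm2E Re_normM.
  set x := complex.Re `|a|; set y := complex.Re `|b|.
  have := sqr_ge0 (x - y); have := sqr_ge0 x; have := sqr_ge0 y.
  by rewrite !expr2; lra.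
split => //.
- apply: (rint_le (cm_re cfg) _ i) => t _.
  exact: le_trans (Re_norm_le _) (B _ _).
- apply: (rint_le (cm_im cfg) _ i) => t _.
  exact: le_trans (Im_norm_le _) (B _ _).
Qed.

Lemma L2Ple f (v : measurableTypeR R -> R) : circle_measurable f ->
  (forall t, D t -> sqf f t <= v t) -> rint v -> L2 f.
Proof.
move=> cf h hv; apply/L2P; split => //.
apply: (rint_le (sqf_meas cf) _ hv) => t Dt.
by rewrite ger0_norm ?sqf_ge0 //; exact: h.
Qed.

Lemma L2D f g : L2 f -> L2 g -> L2 (fun z => f z + g z).
Proof.
move=> hf hg; apply: (L2Ple (cmD (L2_cm hf) (L2_cm hg)) _
  (rintZ 2 (rintD (L2_sq hf) (L2_sq hg)))) => t _.
rewrite /sqf creD cimD.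
set a := complex.Re (f _); set b := complex.Im (f _).
set a' := complex.Re (g _); set b' := complex.Im (g _).
have := sqr_ge0 (a - a'); have := sqr_ge0 (b - b').
by rewrite !expr2; lra.
Qed.

Lemma L2Z (k : C) f : L2 f -> L2 (fun z => k * f z).
Proof.
move=> hf; apply: (L2Ple (cmM (cm_cst k) (L2_cm hf)) _
  (rintZ (complex.Re `|k| ^+ 2) (L2_sq hf))) => t _.
by rewrite /sqf -!norm2E Re_normM exprMn.
Qed.

Lemma L2C f : L2 f -> L2 (fun z => (f z)^*).
Proof.
move=> hf; apply: (L2Ple (cmC (L2_cm hf)) _ (L2_sq hf)) => t _.
by rewrite /sqf creC cimC sqrrN.
Qed.

Lemma L2N f : L2 f -> L2 (fun z => - f z).
Proof.
by move=> hf; have := L2Z (-1) hf; congr L2; apply/funext => z; rewrite mulN1r.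
Qed.

Lemma L2B f g : L2 f -> L2 g -> L2 (fun z => f z - g z).
Proof. by move=> hf hg; apply: L2D => //; apply: L2N. Qed.

Lemma L2_cst (k : C) : L2 (fun=> k).
Proof. by apply/L2P; split; [exact: cm_cst|exact: rint_cst]. Qed.

Lemma L2_sum (I : Type) (s : seq I) (F : I -> C -> C) :
  (forall i, L2 (F i)) -> L2 (fun z => \sum_(i <- s) F i z).
Proof.
move=> h; elim: s => [|a s IH].
  have := L2_cst 0; congr L2; by apply/funext => z; rewrite big_nil.
have := L2D (h a) IH; congr L2; by apply/funext => z; rewrite big_cons.
Qed.

Lemma sqf_ae f g : ae_circle (fun z => f z = g z) ->
  {ae mu, forall t, D t -> sqf f t = sqf g t}.
Proof.
move/ae_circleP; apply: (@filterS _ _ (ae_filter_ringOfSetsType mu)) => t h Dt.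
by rewrite /sqf h.
Qed.

Lemma L2_ae f g : L2 f -> circle_measurable g ->
  ae_circle (fun z => f z = g z) -> L2 g.
Proof.
move=> hf cg h; apply/L2P; split => //.
exact: rint_ae (L2_sq hf) (sqf_meas cg) (sqf_ae h).
Qed.

Lemma L2_flip f : L2 f -> L2 (fun z => f (z^*)).
Proof.
move=> hf; apply/L2P; split; first exact: cm_flip (L2_cm hf).
by apply: rint_eq (RI_opp (L2_sq hf)).1 => t; rewrite /sqf expiN.
Qed.

Lemma Linfty_cm f : Linfty f -> circle_measurable f. Proof. by case. Qed.

Lemma rint_le_ae (u v : measurableTypeR R -> R) : rmeas u ->
  {ae mu, forall t, D t -> `|u t| <= v t} -> rint v -> rint u.
Proof.
move=> mu_ h hv; apply/integrableP; split; first exact/measurable_EFinP.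
move/integrableP: (hv) => [_]; apply: le_lt_trans.
apply: ae_ge0_le_integral => //.
- by apply: measurableT_comp => //; exact/measurable_EFinP.
- by apply: measurableT_comp => //; apply/measurable_EFinP; exact: rint_meas.
apply: (@filterS _ _ (ae_filter_ringOfSetsType mu)) h => t h Dt /=.
by rewrite lee_fin (le_trans (h Dt)) // ler_norm.
Qed.

Lemma Linfty_L2M f g : Linfty f -> L2 g -> L2 (fun z => f z * g z).
Proof.
move=> [cf [M hM]] hg; apply/L2P; split; first exact: cmM cf (L2_cm hg).
apply: (@rint_le_ae _ (fun t => M ^+ 2 * sqf g t)).
- exact: sqf_meas (cmM cf (L2_cm hg)).
- move/ae_circleP: hM; apply: (@filterS _ _ (ae_filter_ringOfSetsType mu)) => t h Dt.
  rewrite ger0_norm ?sqf_ge0 // sqfE Re_normM exprMn -(sqfE g).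
  apply: ler_wpM2r; first exact: sqf_ge0.
  by rewrite lerXn2r ?nnegrE ?Re_norm_ge0 ?h //; apply: le_trans (h Dt); exact: Re_norm_ge0.
- by apply: rintZ; exact: L2_sq.
Qed.

Lemma Linfty_cst (k : C) : Linfty (fun=> k).
Proof. by split; [exact: cm_cst|exists (complex.Re `|k|); exact: ae_all]. Qed.

Lemma Linfty_L2 f : Linfty f -> L2 f.
Proof.
by move=> hf; have := Linfty_L2M hf (L2_cst 1); congr L2; apply/funext => z; rewrite mulr1.
Qed.

Lemma LinftyM f g : Linfty f -> Linfty g -> Linfty (fun z => f z * g z).
Proof.
move=> [cf [M hM]] [cg [N hN]]; split; first exact: cmM.
exists (M * N); apply: ae_imp2 hM hN => z _ h1 h2.
by rewrite Re_normM; apply: ler_pM => //; exact: Re_norm_ge0.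
Qed.

Lemma Re_normD (x y : C) : complex.Re `|x + y| <= complex.Re `|x| + complex.Re `|y|.
Proof. by have := ler_normD x y; rewrite lecE creD => /andP[]. Qed.

Lemma LinftyD f g : Linfty f -> Linfty g -> Linfty (fun z => f z + g z).
Proof.
move=> [cf [M hM]] [cg [N hN]]; split; first exact: cmD.
exists (M + N); apply: ae_imp2 hM hN => z _ h1 h2.
by apply: le_trans (Re_normD _ _) _; apply: lerD.
Qed.

Lemma LinftyC f : Linfty f -> Linfty (fun z => (f z)^*).
Proof.
move=> [cf [M hM]]; split; first exact: cmC.
by exists M; apply: ae_imp hM => z _; rewrite norm_conjC.
Qed.

Lemma Linfty_sum (I : Type) (s : seq I) (F : I -> C -> C) :
  (forall i, Linfty (F i)) -> Linfty (fun z => \sum_(i <- s) F i z).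
Proof.
move=> h; elim: s => [|a s IH].
  have := Linfty_cst 0; congr Linfty; by apply/funext => z; rewrite big_nil.
have := LinftyD (h a) IH; congr Linfty; by apply/funext => z; rewrite big_cons.
Qed.

Lemma Linfty_unim f : circle_measurable f -> (forall z, `|z| = 1 -> `|f z| = 1) ->
  Linfty f.
Proof.
by move=> cf h; split => //; exists 1; apply: ae_all => z z1; rewrite h.
Qed.

Lemma Linfty_id : Linfty (fun z : C => z).
Proof. by apply: Linfty_unim => //; exact: cm_id. Qed.

Definition ip f g : C := circle_int (fun z => f z * (g z)^*).
Definition norm2 f : R := (2 * pi)^-1 * RI (sqf f).

Lemma eq_ipl f f' g : f =1 f' -> ip f g = ip f' g.
Proof. by move=> /funext ->. Qed.

Lemma eq_ipr f g g' : g =1 g' -> ip f g = ip f g'.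
Proof. by move=> /funext ->. Qed.

Lemma ipff f : ip f f = (norm2 f)%:C%C.
Proof.
rewrite /ip /norm2 circle_intE.
have E z : f z * (f z)^* = (complex.Re `|f z| ^+ 2)%:C%C by exact: mul_conj.
apply: complex_ext; rewrite ?creM ?cimM /=.
- rewrite mul0r subr0; congr (_ * _); apply: RI_eq => t.
  by rewrite E /= sqfE.
- rewrite mul0r addr0 (_ : RI _ = 0) ?mulr0 //.
  by rewrite -[RHS](mul0r (2 * pi)) -RI_cst; apply: RI_eq => t; rewrite E.
Qed.

Lemma twopi_gt0 : 0 < (2 * pi : R)^-1.
Proof. by rewrite invr_gt0 mulr_gt0 // pi_pos. Qed.

Lemma norm2_ge0 f : 0 <= norm2 f.
Proof.
by apply: mulr_ge0; [exact: ltW twopi_gt0|apply: Rintegral_ge0 => t _; exact: sqf_ge0].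
Qed.

Lemma norm2_eq0 f : L2 f -> norm2 f = 0 -> ae_circle (fun z => f z = 0).
Proof.
move=> hf h.
have : RI (sqf f) = 0.
  by move/eqP: h; rewrite mulf_eq0 gt_eqF ?twopi_gt0 //= => /eqP.
move/(RI0_ae (L2_sq hf) (fun t _ => sqf_ge0 f t)) => H.
apply/ae_circleP; apply: (@filterS _ _ (ae_filter_ringOfSetsType mu)) H => t H Dt.
have := H Dt; rewrite /sqf => /eqP.
rewrite paddr_eq0 ?sqr_ge0 // !sqrf_eq0 => /andP[/eqP a /eqP b].
exact: complex_ext.
Qed.

Lemma norm2_ae f g : circle_measurable f -> circle_measurable g ->
  ae_circle (fun z => f z = g z) -> norm2 f = norm2 g.
Proof.
move=> cf cg h; rewrite /norm2; congr (_ * _).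
by apply: RI_ae; [exact: sqf_meas|exact: sqf_meas|exact: sqf_ae].
Qed.

Lemma ip_ae f f' g g' : L2 f -> L2 f' -> L2 g -> L2 g' ->
  ae_circle (fun z => f z = f' z) -> ae_circle (fun z => g z = g' z) ->
  ip f g = ip f' g'.
Proof.
move=> hf hf' hg hg' h h'; apply: ci_ae.
- exact: cint_cm (L2_prod hf (L2C hg)).
- exact: cint_cm (L2_prod hf' (L2C hg')).
- by apply: ae_imp2 h h' => z _ -> ->.
Qed.

Lemma ipDl f g h : L2 f -> L2 g -> L2 h ->
  ip (fun z => f z + g z) h = ip f h + ip g h.
Proof.
move=> hf hg hh; rewrite /ip -ciD; last first.
- exact: L2_prod (L2C hh).
- exact: L2_prod (L2C hh).
by congr circle_int; apply/funext => z; rewrite mulrDl.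
Qed.

Lemma ipZl (k : C) f h : L2 f -> L2 h -> ip (fun z => k * f z) h = k * ip f h.
Proof.
move=> hf hh; rewrite /ip -ciZ; last exact: L2_prod (L2C hh).
by congr circle_int; apply/funext => z; rewrite mulrA.
Qed.

Lemma ipC f g : L2 f -> L2 g -> ip g f = (ip f g)^*.
Proof.
move=> hf hg; rewrite /ip -ciC; last exact: L2_prod (L2C hg).
by congr circle_int; apply/funext => z; rewrite rmorphM /= conjCK mulrC.
Qed.

Lemma ipDr f g h : L2 f -> L2 g -> L2 h ->
  ip h (fun z => f z + g z) = ip h f + ip h g.
Proof.
by move=> hf hg hh; rewrite ipC ?ipDl ?rmorphD /= -?ipC //; exact: L2D.
Qed.

Lemma ipZr (k : C) f h : L2 f -> L2 h -> ip h (fun z => k * f z) = k^* * ip h f.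
Proof.
by move=> hf hh; rewrite ipC ?ipZl ?rmorphM /= -?ipC //; exact: L2Z.
Qed.

Lemma norm2D_le f g : L2 f -> L2 g ->
  norm2 (fun z => f z + g z) <= 2 * (norm2 f + norm2 g).
Proof.
move=> hf hg; rewrite /norm2 -mulrDr mulrCA ler_pM2l ?twopi_gt0 //.
rewrite -RID; [|exact: L2_sq|exact: L2_sq].
rewrite -RIZ; last by apply: rintD; exact: L2_sq.
apply: le_RI.
- exact: L2_sq (L2D hf hg).
- by apply: rintZ; apply: rintD; exact: L2_sq.
move=> t _; rewrite /sqf creD cimD.
set a := complex.Re (f _); set b := complex.Im (f _).
set a' := complex.Re (g _); set b' := complex.Im (g _).
have := sqr_ge0 (a - a'); have := sqr_ge0 (b - b').
by rewrite !expr2; lra.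
Qed.

Lemma norm2Z (k : C) f : L2 f -> norm2 (fun z => k * f z) = complex.Re `|k| ^+ 2 * norm2 f.
Proof.
move=> hf; rewrite /norm2 mulrCA; congr (_ * _); rewrite -RIZ; last exact: L2_sq.
by apply: RI_eq => t; rewrite !sqfE Re_normM exprMn.
Qed.

Lemma norm2N f : norm2 (fun z => - f z) = norm2 f.
Proof.
by rewrite /norm2; congr (_ * _); apply: RI_eq => t; rewrite /sqf creN cimN !sqrrN.
Qed.

Lemma norm2_sym f g : norm2 (fun z => f z - g z) = norm2 (fun z => g z - f z).
Proof. by rewrite -norm2N; congr norm2; apply/funext => z; rewrite opprB. Qed.

Lemma norm2M_le f (M : R) g : circle_measurable f -> ae_circle (fun z => complex.Re `|f z| <= M) ->
  L2 g -> norm2 (fun z => f z * g z) <= M ^+ 2 * norm2 g.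
Proof.
move=> cf hM hg; rewrite /norm2 mulrCA ler_pM2l ?twopi_gt0 //.
have lf : Linfty f by split => //; exists M.
have i1 := L2_sq (Linfty_L2M lf hg); have i2 := rintZ (M ^+ 2) (L2_sq hg).
rewrite -RIZ; last exact: L2_sq.
(* The bound on [f] holds only almost everywhere, while [le_RI] asks for an inequality at every
   point; the minimum repairs the integrand on the exceptional null set. *)
have -> : RI (sqf (fun z => f z * g z)) =
   RI (fun t => Num.min (sqf (fun z => f z * g z) t) (M ^+ 2 * sqf g t)).
  apply: RI_ae; first exact: rint_meas.
    by apply: measurable_minr; exact: rint_meas.
  move/ae_circleP: hM; apply: (@filterS _ _ (ae_filter_ringOfSetsType mu)) => t h Dt.
  rewrite min_l // sqfE Re_normM exprMn -(sqfE g).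
  apply: ler_wpM2r; first exact: sqf_ge0.
  by rewrite lerXn2r ?nnegrE ?Re_norm_ge0 ?h //; apply: le_trans (h Dt); exact: Re_norm_ge0.
apply: le_RI => //.
  apply: (rint_le _ _ i1).
    by apply: measurable_minr; exact: rint_meas.
  move=> t _; rewrite ger0_norm ?ge_min ?lexx //.
  by rewrite le_min sqf_ge0 mulr_ge0 ?sqf_ge0 ?sqr_ge0.
by move=> t _; rewrite ge_min lexx orbT.
Qed.

Lemma cauchy_schwarz f g : L2 f -> L2 g ->
  complex.Re `|ip f g| ^+ 2 <= norm2 f * norm2 g.
Proof.
move=> hf hg; have [g0|gn0] := eqVneq (norm2 g) 0.
  have := norm2_eq0 hg g0 => ga.
  have -> : ip f g = ip f (fun=> 0).
    by apply: ip_ae => //; [exact: L2_cst|exact: ae_all].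
  have -> : ip f (fun=> 0) = 0.
    rewrite /ip -[RHS](ci_cst 0); congr circle_int; apply/funext => z.
    by rewrite rmorph0 mulr0.
  by rewrite normr0 /= expr0n /= g0 mulr0.
have gp : 0 < norm2 g by rewrite lt_def gn0 norm2_ge0.
(* This [k] makes f + k g orthogonal to g, so that its squared norm is |f|^2 - |<f, g>|^2 /
   |g|^2. *)
set c := ip f g; pose k : C := - (c / (norm2 g)%:C%C).
have hkg := L2Z k hg.
have : 0 <= norm2 (fun z => f z + k * g z) by exact: norm2_ge0.
have E : (norm2 (fun z => f z + k * g z))%:C%C =
   (norm2 f)%:C%C - c * c^* / (norm2 g)%:C%C.
  have rc (x : R) : (x%:C%C)^* = x%:C%C by rewrite conjE /= oppr0.
  have kc : k^* = - (c^* / (norm2 g)%:C%C).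
    by rewrite /k rmorphN rmorphM fmorphV; congr (- (_ / _)); exact: rc.
  rewrite -!ipff ipDl ?ipDr ?ipZl ?ipZr //; last exact: L2D.
  rewrite [ip g f]ipC // -/c !ipff kc /k.
  have n0 : (norm2 g)%:C%C != 0 :> C by rewrite eq_complex /= (negbTE gn0).
  by field.
move=> h0.
have : 0 <= complex.Re (norm2 (fun z => f z + k * g z))%:C%C by exact: h0.
rewrite E.
rewrite mul_conj -[_^-1](fmorphV (real_complex R)) creD creN creM /= mul0r subr0.
by rewrite subr_ge0 ler_pdivrMr.
Qed.

End L2Theory.

(** * Fourier coefficients *)

Section Step.
Variable R : realType.
Implicit Types x y : R.

Lemma bernoulli_ge y (m : nat) : 0 <= y -> y <= 1 -> 1 - m%:R * y <= (1 - y) ^+ m.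
Proof.
move=> y0 y1; elim: m => [|m IH]; first by rewrite mul0r subr0 expr0.
have h0 : 0 <= 1 - y by rewrite subr_ge0.
rewrite exprS; apply: le_trans (ler_wpM2l h0 IH).
have : 0 <= m%:R * (y * y) by rewrite mulr_ge0 // mulr_ge0.
rewrite -[m.+1%:R]natr1; set M := m%:R; lra.
Qed.

(** An upper counterpart of Bernoulli's inequality, from (1 - y)(1 + (m + 1) y) <= 1 + m y. *)
Lemma bernoulli_le y (m : nat) : 0 <= y -> y <= 1 -> (1 - y) ^+ m * (1 + m%:R * y) <= 1.
Proof.
move=> y0 y1.
have h0 : 0 <= 1 - y by rewrite subr_ge0.
elim: m => [|m IH]; first by rewrite mul0r addr0 expr0 mulr1.
apply: le_trans IH; rewrite exprSr -mulrA; apply: ler_wpM2l; first exact: exprn_ge0.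
have : 0 <= m%:R * (y * y) by rewrite mulr_ge0 // mulr_ge0.
have : 0 <= y * y by rewrite mulr_ge0.
rewrite -[m.+1%:R]natr1; set M := m%:R; lra.
Qed.

(* On [0, 1] these polynomials converge boundedly to the indicator of [0, 1/2), away
   from 1/2. *)
Definition step (n : nat) x : R := (1 - x ^+ n) ^+ (2 ^ n).

Lemma step_01 n x : 0 <= x -> x <= 1 -> 0 <= step n x <= 1.
Proof.
move=> x0 x1; have a : 0 <= 1 - x ^+ n <= 1.
  by rewrite subr_ge0 exprn_ile1 // gerBl exprn_ge0.
case/andP: a => a b.
by rewrite /step exprn_ge0 //= exprn_ile1.
Qed.

(** Bernoulli's inequality gives 1 - (2x)^n <= [step n x]: the exponent 2^n is what places the
    threshold at 1/2. *)
Lemma step_lo x : 0 <= x -> x < 1 / 2 -> step ^~ x @ \oo --> (1 : R).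
Proof.
move=> x0 x1.
have h : (fun n => 1 - (2 * x) ^+ n) @ \oo --> (1 : R).
  rewrite -[X in _ --> X]subr0; apply: cvgB; first exact: cvg_cst.
  by apply: cvg_expr; rewrite ger0_norm; lra.
apply: (squeeze_cvgr _ h (cvg_cst _)).
apply: nearW => n.
have x2 : x <= 1 by lra.
have /andP[_ ->] := step_01 n x0 x2; rewrite andbT.
have := @bernoulli_ge (x ^+ n) (2 ^ n) (exprn_ge0 _ x0) (exprn_ile1 _ x0 x2).
by rewrite natrX -exprMn.
Qed.

(** By [bernoulli_le], [step n x] times 1 + (2x)^n is at most 1, hence [step n x] <= (2x)^-n. *)
Lemma step_hi x : 1 / 2 < x -> x <= 1 -> step ^~ x @ \oo --> (0 : R).
Proof.
move=> x0 x1.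
have h : (fun n => ((2 * x)^-1) ^+ n) @ \oo --> (0 : R).
  apply: cvg_expr; rewrite ger0_norm ?invr_ge0 ?invf_lt1; lra.
apply: (squeeze_cvgr _ (cvg_cst _) h).
apply: nearW => n.
have x2 : 0 <= x by lra.
have /andP[a _] := step_01 n x2 x1; rewrite a /=.
have := @bernoulli_le (x ^+ n) (2 ^ n) (exprn_ge0 _ x2) (exprn_ile1 _ x2 x1).
rewrite natrX -exprMn -/(step n x) => H.
rewrite exprVn -div1r ler_pdivlMr; last by apply: exprn_gt0; lra.
apply: le_trans H; apply: ler_wpM2l => //; lra.
Qed.

End Step.

(** * Integrals of sines and cosines over a period *)

Section TrigIntegral.
Variable R : realType.
Local Notation mu := (@lebesgue_measure R).
Local Notation D := (`[- pi, pi]%classic : set (measurableTypeR R)).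

Lemma cos_meas (k : R) : rmeas (fun t : measurableTypeR R => cos (k * t)).
Proof.
apply: measurable_funTS; apply: continuous_measurable_fun => t.
apply: continuous_comp; first exact: mulrl_continuous.
exact: continuous_cos.
Qed.

Lemma sin_meas (k : R) : rmeas (fun t : measurableTypeR R => sin (k * t)).
Proof.
apply: measurable_funTS; apply: continuous_measurable_fun => t.
apply: continuous_comp; first exact: mulrl_continuous.
exact: continuous_sin.
Qed.

Lemma sin_rint (k : R) : rint (fun t : measurableTypeR R => sin (k * t)).
Proof.
apply: (@rint_le _ _ (fun=> 1)); [exact: sin_meas| |exact: rint_cst].
by move=> t _; rewrite ler_norml sin_geN1 sin_le1.
Qed.

Lemma RI_sin (k : R) : RI (fun t : measurableTypeR R => sin (k * t)) = 0.
Proof.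
have [_ h] := RI_opp (sin_rint k).
have : RI (fun t : measurableTypeR R => sin (k * t)) = - RI (fun t : measurableTypeR R => sin (k * t)).
  rewrite -{1}h -mulN1r -RIZ; last exact: sin_rint.
  by apply: RI_eq => t; rewrite mulrN sinN mulN1r.
by lra.
Qed.

Lemma sin_natpi (n : nat) : sin (n%:R * pi : R) = 0.
Proof.
elim: n => [|n IH]; first by rewrite mul0r sin0.
by rewrite -natr1 mulrDl mul1r sinDpi IH oppr0.
Qed.

Lemma sin_intpi (k : int) : sin (k%:~R * pi : R) = 0.
Proof.
case: k => n; first exact: sin_natpi.
by rewrite NegzE rmorphN /= mulNr sinN sin_natpi oppr0.
Qed.

Lemma RI_cos (k : int) : k != 0 -> RI (fun t : measurableTypeR R => cos (k%:~R * t)) = 0.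
Proof.
move=> k0; have kn0 : (k%:~R : R) != 0 by rewrite intr_eq0.
have p : (- pi : R) < pi by have := @pi_pos R; lra.
pose F (t : R) := (k%:~R)^-1 * sin (k%:~R * t).
have dF (t : R) : is_derive t 1 F (cos (k%:~R * t)).
  by rewrite /F; apply: is_derive_eq; rewrite /= !scaler1 /GRing.scale /= ?mulr1; field.
have := @continuous_FTC2 R (fun t => cos (k%:~R * t)) F (- pi) pi p.
rewrite /RI /Rintegral => ->.
- by rewrite /F mulrN sinN !sin_intpi oppr0 mulr0 subee.
- apply: continuous_subspaceT => t; apply: continuous_comp.
    exact: mulrl_continuous.
  exact: continuous_cos.
- have cF : continuous F.
    by move=> t; apply: differentiable_continuous; apply/derivable1_diffP; have [] := dF t.
  split.
  + by move=> t _; have [] := dF t.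
  + by apply: cvg_at_right_filter; exact: cF.
  + by apply: cvg_at_left_filter; exact: cF.
- by move=> t _; rewrite derive1E; apply: derive_val.
Qed.

End TrigIntegral.

(** * Fourier coefficients determine a function almost everywhere *)

Section Fourier.
Variable R : realType.
Local Notation C := R[i].
Local Notation mu := (@lebesgue_measure R).
Local Notation D := (`[- pi, pi]%classic : set (measurableTypeR R)).
Implicit Types f g h : C -> C.

#[local] Hint Resolve measD : core.

Lemma zX_norm (k : int) (z : C) : `|z| = 1 -> `|z ^ k| = 1.
Proof.
by move=> z1; case: k => n; rewrite ?NegzE -?exprnN ?normfV normrX z1 expr1n ?invr1.
Qed.

Lemma z_neq0 (z : C) : `|z| = 1 -> z != 0.
Proof. by move=> z1; rewrite -normr_eq0 z1 oner_eq0. Qed.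

Lemma zX_conj (k : int) (z : C) : `|z| = 1 -> (z ^ k)^* = z ^ (- k).
Proof.
move=> z1; have k1 := zX_norm k z1.
have nz := z_neq0 z1.
apply: (mulfI (z_neq0 k1)).
rewrite -normCK k1 expr1n -exprzDr ?subrr ?expr0z //.
Qed.

Lemma z_conj (z : C) : `|z| = 1 -> z^* = z^-1.
Proof. by move=> /(zX_conj 1); rewrite expr1z exprN1. Qed.

Lemma cm_zX (k : int) : circle_measurable (fun z : C => z ^ k).
Proof.
apply: cmI.
- by apply: eq_rmeas (cos_meas (k%:~R)) => t; rewrite expiXz.
- by apply: eq_rmeas (sin_meas (k%:~R)) => t; rewrite expiXz.
Qed.

Lemma Linfty_zX (k : int) : Linfty (fun z : C => z ^ k).
Proof. by apply: Linfty_unim; [exact: cm_zX|exact: zX_norm]. Qed.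

Lemma L2_zX (k : int) : L2 (fun z : C => z ^ k).
Proof. exact: Linfty_L2 (Linfty_zX k). Qed.

Lemma ci_zX (k : int) : circle_int (fun z : C => z ^ k) = (k == 0)%:R.
Proof.
have [->|k0] := eqVneq k 0.
  by rewrite -[RHS](ci_cst 1); congr circle_int; apply/funext => z; rewrite expr0z.
rewrite circle_intE (_ : Complex _ _ = 0) ?mulr0 //.
apply: complex_ext => /=.
- by rewrite -[RHS](RI_cos _ k0); apply: RI_eq => t; rewrite expiXz.
- by rewrite -[RHS](RI_sin (k%:~R)); apply: RI_eq => t; rewrite expiXz.
Qed.

Lemma eq_fourier f g k : f =1 g -> fourier f k = fourier g k.
Proof. by move=> /funext ->. Qed.

Lemma fourier_cint f k : L2 f -> cint (fun z => f z * z ^ (- k)).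
Proof. by move=> hf; exact: L2_prod (L2_zX _). Qed.

Lemma fourier_ip f k : L2 f -> fourier f k = ip f (fun z => z ^ k).
Proof.
move=> hf; apply: ci_ae.
- exact: cint_cm (fourier_cint _ hf).
- exact: cint_cm (L2_prod hf (L2C (L2_zX k))).
- by apply: ae_all => z z1; rewrite zX_conj.
Qed.

Lemma fourierD f g k : L2 f -> L2 g ->
  fourier (fun z => f z + g z) k = fourier f k + fourier g k.
Proof.
move=> hf hg; rewrite !fourier_ip ?ipDl //; [exact: L2_zX|exact: L2D].
Qed.

Lemma fourierZ (c : C) f k : L2 f ->
  fourier (fun z => c * f z) k = c * fourier f k.
Proof. move=> hf; rewrite !fourier_ip ?ipZl //; [exact: L2_zX|exact: L2Z]. Qed.

Lemma fourierN f k : L2 f -> fourier (fun z => - f z) k = - fourier f k.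
Proof.
move=> hf; rewrite -[RHS]mulN1r -fourierZ //; apply: eq_fourier => z.
by rewrite mulN1r.
Qed.

Lemma fourierB f g k : L2 f -> L2 g ->
  fourier (fun z => f z - g z) k = fourier f k - fourier g k.
Proof. by move=> hf hg; rewrite fourierD ?fourierN //; exact: L2N. Qed.

Lemma fourier_ae f g k : L2 f -> L2 g -> ae_circle (fun z => f z = g z) ->
  fourier f k = fourier g k.
Proof.
by move=> hf hg h; rewrite !fourier_ip //; apply: ip_ae => //;
  [exact: L2_zX|exact: L2_zX|exact: ae_all].
Qed.

Lemma fourier_shift f (m k : int) : L2 f ->
  fourier (fun z => f z * z ^ m) k = fourier f (k - m).
Proof.
move=> hf; apply: ci_ae.
- exact: cmM (cmM (L2_cm hf) (cm_zX _)) (cm_zX _).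
- exact: cmM (L2_cm hf) (cm_zX _).
apply: ae_all => z z1; rewrite -mulrA -exprzDr ?unitfE ?z_neq0 //.
by rewrite opprB addrC.
Qed.

Lemma fourier_zX (m k : int) : fourier (fun z : C => z ^ m) k = (m == k)%:R.
Proof.
rewrite -[fourier _ k](_ : fourier (fun z => 1 * z ^ m) k = _); last first.
  by apply: eq_fourier => z; rewrite mul1r.
rewrite fourier_shift; last exact: L2_cst.
rewrite /fourier -[RHS](_ : (- (k - m) == 0 :> int)%:R = _).
  by rewrite -ci_zX; congr circle_int; apply/funext => z; rewrite mul1r.
by rewrite oppr_eq0 subr_eq0 eq_sym.
Qed.

Lemma fourier_cst (c : C) k : fourier (fun=> c) k = c * (k == 0)%:R.
Proof.
rewrite -[fourier _ _](_ : fourier (fun z => c * z ^ 0) k = _); last first.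
  by apply: eq_fourier => z; rewrite expr0z mulr1.
by rewrite fourierZ ?fourier_zX 1?eq_sym //; exact: L2_zX.
Qed.

Lemma norm2_zX (k : int) : norm2 (fun z : C => z ^ k) = 1.
Proof.
have := ipff (fun z : C => z ^ k).
rewrite -fourier_ip; last exact: L2_zX.
by rewrite fourier_zX eqxx => /(congr1 (@complex.Re R)).
Qed.

Lemma fourier_le f k : L2 f -> complex.Re `|fourier f k| ^+ 2 <= norm2 f.
Proof.
move=> hf; rewrite fourier_ip // -[norm2 f]mulr1 -(norm2_zX k).
exact: cauchy_schwarz (L2_zX k).
Qed.

Lemma fourier_conj f k : L2 f -> fourier (fun z => (f z)^*) k = (fourier f (- k))^*.
Proof.
move=> hf; rewrite /fourier -ciC; last exact: fourier_cint.
apply: ci_ae.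
- exact: cint_cm (fourier_cint _ (L2C hf)).
- exact: cmC (cint_cm (fourier_cint _ hf)).
by apply: ae_all => z z1; rewrite rmorphM /= opprK zX_conj.
Qed.

Definition fzero g := L2 g /\ forall k, fourier g k = 0.
(** A stand-in for trigonometric polynomials. Instead of an expression as a sum of powers of z it
    records the one property that uniqueness needs; being stable under sums and products, the class
    contains the polynomials [step n (stepX x z)]. *)
Definition trigp p := Linfty p /\ forall g, fzero g -> fzero (fun z => g z * p z).

Lemma trigpM p q : trigp p -> trigp q -> trigp (fun z => p z * q z).
Proof.
move=> [a b] [c d]; split; first exact: LinftyM.
by move=> g /b/d; congr fzero; apply/funext => z; rewrite mulrA.
Qed.

Lemma fzeroD f g : fzero f -> fzero g -> fzero (fun z => f z + g z).
Proof.
move=> [a b] [c d]; split; first exact: L2D.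
by move=> k; rewrite fourierD // b d addr0.
Qed.

Lemma trigpD p q : trigp p -> trigp q -> trigp (fun z => p z + q z).
Proof.
move=> [a b] [c d]; split; first exact: LinftyD.
move=> g hg; have := fzeroD (b g hg) (d g hg).
by congr fzero; apply/funext => z; rewrite mulrDr.
Qed.

Lemma trigp_cst (c : C) : trigp (fun=> c).
Proof.
split; first exact: Linfty_cst.
move=> g [hg h0].
have -> : (fun z => g z * c) = (fun z => c * g z) by apply/funext => z; rewrite mulrC.
by split; [exact: L2Z|move=> k; rewrite fourierZ // h0 mulr0].
Qed.

Lemma trigp_zX (m : int) : trigp (fun z => z ^ m).
Proof.
split; first exact: Linfty_zX.
move=> g [hg h0]; split; last by move=> k; rewrite fourier_shift.
have := Linfty_L2M (Linfty_zX m) hg; congr L2; apply/funext => z; exact: mulrC.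
Qed.

Lemma trigp_ae p q : trigp p -> circle_measurable q ->
  (forall z, `|z| = 1 -> p z = q z) -> trigp q.
Proof.
move=> [[cp [M hM]] hp] cq h; split.
  split => //; exists M; apply: ae_imp hM => z z1; by rewrite h.
move=> g hg; have [a b] := hp _ hg; have [c d] := hg.
have L : L2 (fun z => g z * q z).
  apply: (L2_ae a); first exact: cmM (L2_cm c) cq.
  by apply: ae_all => z z1; rewrite h.
split => // k; rewrite -(b k); apply: fourier_ae => //.
by apply: ae_all => z z1; rewrite h.
Qed.

Lemma trigpX p n : trigp p -> trigp (fun z => p z ^+ n).
Proof.
move=> hp; elim: n => [|n IH].
  by have := trigp_cst 1; congr trigp; apply/funext => z; rewrite expr0.
by have := trigpM hp IH; congr trigp; apply/funext => z; rewrite exprS.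
Qed.

Lemma trigp_re : trigp (fun z : C => (complex.Re z)%:C%C).
Proof.
have := trigpM (trigp_cst ((1 / 2)%:C%C)) (trigpD (trigp_zX 1) (trigp_zX (-1))).
move/trigp_ae; apply.
  by apply: cmI; [exact: cm_re (cm_id R)|exact: rmeas_cst].
move=> z z1; rewrite expr1z exprN1 -(z_conj z1) conjE; apply: complex_ext.
  by rewrite creM creD cimD /=; field.
by rewrite cimM creD cimD /=; field.
Qed.

Lemma trigp_im : trigp (fun z : C => (complex.Im z)%:C%C).
Proof.
have := trigpM (trigp_cst (Complex 0 (- (1 / 2)))) (trigpD (trigp_zX 1)
  (trigpM (trigp_cst (-1)) (trigp_zX (-1)))).
move/trigp_ae; apply.
  by apply: cmI; [exact: cm_im (cm_id R)|exact: rmeas_cst].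
move=> z z1; rewrite expr1z exprN1 -(z_conj z1) conjE mulN1r; apply: complex_ext.
  by rewrite creM creD cimD creN cimN /=; field.
by rewrite cimM creD cimD creN cimN /=; field.
Qed.

(* At z = e^{it} this is 1/2 - 1/2 sin((x - t)/2) cos(t/2), which is below 1/2 for
   -pi < t < x and above it for x < t < pi. *)
Definition stepX (x : R) (z : C) : R :=
  1 / 2 - 1 / 4 * (sin (x / 2) + sin (x / 2) * complex.Re z - cos (x / 2) * complex.Im z).

Lemma trigp_step (x : R) n : trigp (fun z => (step n (stepX x z))%:C%C).
Proof.
have tX : trigp (fun z => (stepX x z)%:C%C).
  have := trigpD (trigp_cst ((1/2)%:C%C)) (trigpM (trigp_cst ((- (1 / 4))%:C%C))
    (trigpD (trigp_cst ((sin (x / 2))%:C%C)) (trigpD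
      (trigpM (trigp_cst ((sin (x / 2))%:C%C)) trigp_re)
      (trigpM (trigp_cst ((- cos (x / 2))%:C%C)) trigp_im)))).
  congr trigp; apply/funext => z; rewrite -!rmorphM -!rmorphD -rmorphM -rmorphD /=.
  by congr (_%:C%C); rewrite /stepX; ring.
have := trigpX (2 ^ n) (trigpD (trigp_cst 1) (trigpM (trigp_cst (-1)) (trigpX n tX))).
congr trigp; apply/funext => z.
by rewrite mulN1r -rmorphXn -(rmorph1 (real_complex R)) -rmorphB -rmorphXn.
Qed.

Lemma stepXE (x t : R) : stepX x (expi t) = 1 / 2 - 1 / 2 * (sin ((x - t) / 2) * cos (t / 2)).
Proof.
rewrite /stepX /=.
have -> : cos t = cos (t / 2) ^+ 2 - sin (t / 2) ^+ 2.
  by rewrite {1}(splitr t) cosD !expr2.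
have -> : sin t = 2 * (sin (t / 2) * cos (t / 2)).
  by rewrite {1}(splitr t) sinD; ring.
rewrite mulrBl sinB.
have := cos2Dsin2 (t / 2).
set c := cos (t/2); set s := sin (t/2); set a := sin (x/2); set b := cos (x/2) => h.
rewrite (_ : a + _ = a * (c ^+ 2 + s ^+ 2) + a * (c ^+ 2 - s ^+ 2)); last by rewrite h mulr1.
by field.
Qed.

Lemma stepX01 (x : R) t : 0 <= stepX x (expi t) <= 1.
Proof.
rewrite stepXE; set s := sin _; set c := cos _.
have : `|s * c| <= 1.
  rewrite normrM mulr_ile1 // ler_norml ?sin_geN1 ?sin_le1 ?cos_geN1 ?cos_le1 //.
by rewrite ler_norml => /andP[? ?]; apply/andP; split; lra.
Qed.

Lemma RI_dct (w : nat -> measurableTypeR R -> R) (u v : measurableTypeR R -> R) :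
  (forall n, rmeas (w n)) -> rmeas u -> rint v ->
  (forall n t, D t -> `|w n t| <= v t) ->
  {ae mu, forall t, D t -> w ^~ t @ \oo --> u t} ->
  (forall n, RI (w n) = 0) -> RI u = 0.
Proof.
move=> hw hu hv hb hc h0.
have hwE n : measurable_fun D (EFin \o w n) by apply/measurable_EFinP; exact: hw.
have huE : measurable_fun D (EFin \o u) by exact/measurable_EFinP.
have [] := @dominated_convergence _ _ R mu D measD (fun n => EFin \o w n) (EFin \o u)
  (EFin \o v) hwE huE _ hv _.
- apply: (@filterS _ _ (ae_filter_ringOfSetsType mu)) hc => t h Dt.
  apply/cvg_EFin; first by apply: nearW.
  exact: h.
- apply: (@filterS _ _ (ae_filter_ringOfSetsType mu) setT); last exact: filterT.
  by move=> t _ n Dt /=; rewrite lee_fin hb.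
move=> iu _ hlim; rewrite /RI /Rintegral.
suff -> : (\int[mu]_(x in D) (u x)%:E = 0)%E by [].
apply: (cvg_unique _ hlim) => //.
apply: cvg_near_cst; apply: nearW => n.
have iw : rint (w n).
  exact: rint_le (hw n) (hb n) hv.
rewrite -[LHS]fineK; last exact: integrable_fin_num iw.
by have := h0 n; rewrite /RI /Rintegral => ->.
Qed.

Lemma ind_meas (x : R) : rmeas (fun t : measurableTypeR R => (t <= x)%R%:R).
Proof.
rewrite (_ : (fun _ => _) = \1_(`]-oo, x]%classic)); last first.
  by apply/funext => t; rewrite indicE mem_setE in_itv.
exact: measurable_indic.
Qed.

(* The trigonometric polynomials step n (stepX x) tend to the indicator of ]-pi, x], so
   all primitives of f vanish. *)
Lemma fzero_ae f : fzero f -> ae_circle (fun z => f z = 0).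
Proof.
move=> [hf h0].
have cf := cint_re (L2_prod hf (L2_cst 1)).
(* The test polynomials are real-valued, so the real and the imaginary part of [f] can be treated
   separately. *)
have key (u : measurableTypeR R -> R) : rint u ->
    (forall x n, RI (fun t => u t * step n (stepX x (expi t))) = 0) ->
    {ae mu, forall t, D t -> u t = 0}.
  move=> hu hz; apply: primitive0_ae => // x xpi.
  have mstep n : rmeas (fun t : measurableTypeR R => step n (stepX x (expi t))).
    by have [[/cm_re]] := trigp_step x n.
  apply: (RI_dct (w := fun n t => u t * step n (stepX x (expi t)))
    (v := fun t => `|u t|)).
  - by move=> n; apply: rmeasM (rint_meas hu) (mstep n).
  - exact: rmeasM (rint_meas hu) (ind_meas x).
  - exact: rint_abs.
  - move=> n t _; rewrite normrM ler_piMr //.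
    have /andP[a b] := stepX01 x t; have /andP[c d] := step_01 n a b.
    by rewrite ger0_norm.
  (* The three excluded points are those of the interval where [stepX] equals 1/2: the sine factor
     of [stepXE] vanishes at t = x, the cosine factor at t = -pi and t = pi. *)
  - apply: (@filterS3 _ _ (ae_filter_ringOfSetsType mu) _ _ _ _ _ (ae_neq x) (ae_neq (-pi)) (ae_neq pi)).
    move=> t n1 norm2 n3; rewrite /= in_itv /= => /andP[t1 t2].
    have p1 : - pi < t by rewrite lt_neqAle t1 andbT; apply/eqP => h; apply: norm2.
    have p2 : t < pi by rewrite lt_neqAle t2 andbT; apply/eqP.
    case/andP: xpi => x1 x2.
    have ct : 0 < cos (t / 2) by apply: cos_gt0_pihalf; rewrite -mulNr; lra.
    have /andP[a b] := stepX01 x t.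
    apply: cvgM; first exact: cvg_cst.
    case: (ltgtP t x) => [tx|xt|/n1//].
    + apply: step_lo => //; rewrite stepXE.
      have : 0 < sin ((x - t) / 2) by apply: sin_gt0_pi; apply/andP; split; lra.
      by move=> s0; have := mulr_gt0 s0 ct; lra.
    + apply: step_hi => //; rewrite stepXE.
      have : 0 < sin ((t - x) / 2) by apply: sin_gt0_pi; apply/andP; split; lra.
      move=> s0; have := mulr_gt0 s0 ct.
      have -> : (x - t) / 2 = - ((t - x) / 2) by ring.
      by rewrite sinN; lra.
  - exact: hz.
have hz x n : circle_int (fun z => f z * (step n (stepX x z))%:C%C) = 0.
  have [_ /(_ f (conj hf h0)) [_ /(_ 0)]] := trigp_step x n.
  by rewrite /fourier => H; rewrite -[RHS]H; congr circle_int; apply/funext => z;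
    rewrite oppr0 expr0z mulr1.
have hf1 : cint f.
  have := L2_prod hf (L2_cst 1); congr cint; apply/funext => z; exact: mulr1.
have pp := @twopi_gt0 R.
have kr : {ae mu, forall t, D t -> complex.Re (f (expi t)) = 0}.
  apply: key; first exact: cint_re hf1.
  move=> x n; have := congr1 (@complex.Re R) (hz x n).
  rewrite circle_intE creM /= mul0r subr0 => /eqP.
  rewrite mulf_eq0 gt_eqF //= => /eqP H; rewrite -[RHS]H.
  by apply: RI_eq => t; rewrite creM /= mulr0 subr0.
have ki : {ae mu, forall t, D t -> complex.Im (f (expi t)) = 0}.
  apply: key; first exact: cint_im hf1.
  move=> x n; have := congr1 (@complex.Im R) (hz x n).
  rewrite circle_intE cimM /= mul0r addr0 => /eqP.
  rewrite mulf_eq0 gt_eqF //= => /eqP H; rewrite -[RHS]H.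
  by apply: RI_eq => t; rewrite cimM /= mulr0 add0r.
apply/ae_circleP.
apply: (@filterS2 _ _ (ae_filter_ringOfSetsType mu) _ _ _ _ kr ki) => t a b Dt.
by apply: complex_ext; [exact: a|exact: b].
Qed.

End Fourier.

(** * Completeness and the Hardy space *)

Section Complete.
Variable R : realType.
Local Notation C := R[i].
Local Notation mu := (@lebesgue_measure R).
Local Notation D := (`[- pi, pi]%classic : set (measurableTypeR R)).
Implicit Types f g h : C -> C.

#[local] Hint Resolve measD : core.

Lemma sqf_RI f (c : R) : norm2 f <= c -> RI (sqf f) <= (2 * pi) * c.
Proof.
rewrite /norm2 => h; rewrite mulrC -ler_pdivrMr ?mulr_gt0 ?pi_pos //.
by rewrite mulrC.
Qed.

Lemma norm2_RI f (c : R) : RI (sqf f) <= (2 * pi) * c -> norm2 f <= c.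
Proof. by rewrite /norm2 => h; rewrite ler_pdivrMl // mulr_gt0 // pi_pos. Qed.

Lemma esup_lim_meas (u : nat -> measurableTypeR R -> R) : (forall k, rmeas (u k)) ->
  rmeas (fun t => fine (limn_esup (fun k => (u k t)%:E))).
Proof.
move=> hu; apply: measurableT_comp => //.
apply: measurable_fun_limn_esup => k.
by apply/measurable_EFinP; exact: hu.
Qed.

Lemma esup_limE (u : nat -> R) : cvgn u ->
  u @ \oo --> fine (limn_esup (fun k => (u k)%:E)).
Proof.
move=> hu; have h : (fun k => (u k)%:E) @ \oo --> (limn u)%:E.
  by apply/cvg_EFin; [apply: nearW|exact: hu].
by have [_ ->] := cvg_limn_einf_sup h.
Qed.

(* The limit is defined by limn_esup to make it measurable everywhere. *)
Lemma L2_complete (v : nat -> C -> C) : (forall n, L2 (v n)) ->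
  (forall e : R, 0 < e -> exists N, forall m n, (N <= m)%N -> (N <= n)%N ->
     norm2 (fun z => v m z - v n z) <= e) ->
  exists2 f, L2 f & forall e : R, 0 < e -> exists N, forall n, (N <= n)%N ->
     norm2 (fun z => f z - v n z) <= e.
Proof.
move=> hv hc.
have pp : 0 < 2 * pi :> R by rewrite mulr_gt0 // pi_pos.
(* The factor 1/(2 pi) undoes the normalization of [norm2], so that the integrals of the squared
   increments are at most 4^-k, as [ae_cvg_fast] demands. *)
have he k : 0 < (2 * pi)^-1 * (1 / 4 : R) ^+ k.
  by rewrite mulr_gt0 ?invr_gt0 ?exprn_gt0.
have [N hN] := choice (fun k => hc _ (he k)).
(* The partial sums make [p] nondecreasing and at least [N k]; the summand [k] makes it tend to
   infinity. *)
pose p k := (k + \sum_(i < k.+1) N i)%N.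
have pN k : (N k <= p k)%N by rewrite /p big_ord_recr /= addnA leq_addl.
have pk k : (k <= p k)%N by rewrite /p leq_addr.
have pS k : (p k <= p k.+1)%N.
  by rewrite /p [X in (_ <= _ + X)%N]big_ord_recr /= leq_add // leq_addr.
pose w k := v (p k).
have hw k : L2 (w k) by exact: hv.
have hww k m : L2 (fun z => w k z - v m z) by apply: L2B.
have fast k : RI (sqf (fun z => w k.+1 z - w k z)) <= (1 / 4) ^+ k.
  have /sqf_RI := hN k (p k.+1) (p k) (leq_trans (pN k) (pS k)) (pN k).
  rewrite mulrA divff ?mul1r; last by rewrite gt_eqF.
  exact.
have mre k : rmeas (fun t => complex.Re (w k (expi t))) by exact: cm_re (L2_cm (hw k)).
have mim k : rmeas (fun t => complex.Im (w k (expi t))) by exact: cm_im (L2_cm (hw k)).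
have rre k : rint (fun t => (complex.Re (w k.+1 (expi t)) - complex.Re (w k (expi t))) ^+ 2).
  apply: (rint_le _ _ (L2_sq (hww k.+1 (p k)))).
    apply: (eq_rmeas (u := fun t => (complex.Re (w k.+1 (expi t)) - complex.Re (w k (expi t))) *
      (complex.Re (w k.+1 (expi t)) - complex.Re (w k (expi t))))).
      by move=> t; rewrite expr2.
    by apply: rmeasM; apply: rmeasD => //; exact: rmeasN.
  move=> t _; rewrite ger0_norm ?sqr_ge0 // /sqf creD creN /w.
  by rewrite lerDl sqr_ge0.
have rim k : rint (fun t => (complex.Im (w k.+1 (expi t)) - complex.Im (w k (expi t))) ^+ 2).
  apply: (rint_le _ _ (L2_sq (hww k.+1 (p k)))).
    apply: (eq_rmeas (u := fun t => (complex.Im (w k.+1 (expi t)) - complex.Im (w k (expi t))) *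
      (complex.Im (w k.+1 (expi t)) - complex.Im (w k (expi t))))).
      by move=> t; rewrite expr2.
    by apply: rmeasM; apply: rmeasD => //; exact: rmeasN.
  move=> t _; rewrite ger0_norm ?sqr_ge0 // /sqf cimD cimN /w.
  by rewrite lerDr sqr_ge0.
have c1 := ae_cvg_fast mre rre _.
have {}c1 := c1 _.
have {}/c1 c1 : forall k, RI (fun t => (complex.Re (w k.+1 (expi t)) -
    complex.Re (w k (expi t))) ^+ 2) <= (1 / 4) ^+ k.
  move=> k; apply: le_trans (fast k); apply: le_RI; [exact: rre|exact: L2_sq (hww _ _)|].
  by move=> t _; rewrite /sqf creD creN lerDl sqr_ge0.
have c2 := ae_cvg_fast mim rim _.
have {}/c2 c2 : forall k, RI (fun t => (complex.Im (w k.+1 (expi t)) -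
    complex.Im (w k (expi t))) ^+ 2) <= (1 / 4) ^+ k.
  move=> k; apply: le_trans (fast k); apply: le_RI; [exact: rim|exact: L2_sq (hww _ _)|].
  by move=> t _; rewrite /sqf cimD cimN lerDr sqr_ge0.
pose f z := Complex (fine (limn_esup (fun k => (complex.Re (w k z))%:E)))
                    (fine (limn_esup (fun k => (complex.Im (w k z))%:E))).
have cf : circle_measurable f.
  by apply: cmI; [exact: esup_lim_meas mre|exact: esup_lim_meas mim].
(* Fatou's lemma along the subsequence, with [n] fixed: it controls f - v n for every large n, so
   the whole sequence converges and not only the subsequence. *)
have key n (c : R) N0 : (forall k, (N0 <= k)%N -> norm2 (fun z => w k z - v n z) <= c) ->
    L2 (fun z => f z - v n z) /\ norm2 (fun z => f z - v n z) <= c.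
  move=> hb.
  have cfv : circle_measurable (fun z => f z - v n z).
    by have := cmD cf (L2_cm (L2N (hv n))).
  have [] := @fatou_bound R (fun k => sqf (fun z => w k z - v n z))
    (sqf (fun z => f z - v n z)) (2 * pi * c) N0.
  - by move=> k; exact: L2_sq (hww k n).
  - by move=> k t; exact: sqf_ge0.
  - exact: sqf_meas.
  - by move=> t; exact: sqf_ge0.
  - apply: (@filterS2 _ _ (ae_filter_ringOfSetsType mu) _ _ _ _ c1 c2) => t a b Dt.
    have {}a := esup_limE (a Dt). have {}b := esup_limE (b Dt).
    rewrite /sqf; under eq_fun do rewrite !creD !cimD !creN !cimN.
    rewrite !creD !cimD !creN !cimN.
    by apply: cvgD; apply: (@cvg_comp _ _ _ _ (fun x : R => x ^+ 2) _ _ _ _ (@exprn_continuous _ 2 _));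
      apply: cvgB => //; exact: cvg_cst.
  - by move=> k hk; apply: sqf_RI; exact: hb.
  by move=> h1 /norm2_RI h2; split => //; apply/L2P.
have hf : L2 f.
  have [N0 hN0] := hc _ ltr01.
  have [h _] := key N0 1 N0 (fun k hk => hN0 (p k) N0 (leq_trans hk (pk k)) (leqnn _)).
  have := L2D h (hv N0); congr L2; apply/funext => z; exact: subrK.
exists f => // e e0; have [N0 hN0] := hc _ e0; exists N0 => n hn.
by have [] := key n e N0 (fun k hk => hN0 (p k) n (leq_trans hk (pk k)) hn).
Qed.

End Complete.

(** * H^2 as the closed span of the nonnegative powers of z, and its bounded multipliers *)

Section HardySpace.
Variable R : realType.
Local Notation C := R[i].
Implicit Types f g h : C -> C.

Definition psum f (N : nat) : C -> C :=
  fun z => \sum_(k < N) fourier f (k%:Z) * z ^ (k%:Z).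

Lemma psum_Linfty f N : Linfty (psum f N).
Proof.
by apply: Linfty_sum => i; apply: LinftyM; [exact: Linfty_cst|exact: Linfty_zX].
Qed.

Lemma psum_L2 f N : L2 (psum f N).
Proof. exact: Linfty_L2 (psum_Linfty f N). Qed.

Lemma psumS f N z : psum f N.+1 z = psum f N z + fourier f N%:Z * z ^ N%:Z.
Proof. by rewrite /psum big_ord_recr. Qed.

Lemma fourier_sum (I : Type) (s : seq I) (F : I -> C -> C) k :
  (forall i, L2 (F i)) ->
  fourier (fun z => \sum_(i <- s) F i z) k = \sum_(i <- s) fourier (F i) k.
Proof.
move=> hF; rewrite fourier_ip; last exact: L2_sum.
rewrite -[RHS](eq_bigr _ (fun i _ => esym (fourier_ip k (hF i)))) /ip.
rewrite -ci_sum; last by move=> i; exact: L2_prod (L2C (L2_zX _ _)).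
by congr circle_int; apply/funext => z; rewrite mulr_suml.
Qed.

Lemma fourier_psum f N (j : int) : fourier (psum f N) j =
  \sum_(k < N) fourier f k%:Z * (k%:Z == j)%:R.
Proof.
rewrite /psum fourier_sum; last by move=> i; apply: L2Z; exact: L2_zX.
by apply: eq_bigr => i _; rewrite fourierZ ?fourier_zX //; exact: L2_zX.
Qed.

Lemma fourier_psum_lt f N (k : nat) : (k < N)%N -> fourier (psum f N) k%:Z = fourier f k%:Z.
Proof.
move=> kN; rewrite fourier_psum (bigD1 (Ordinal kN)) //= eqxx mulr1 big1 ?addr0 //.
move=> i; rewrite -val_eqE /= => /negbTE ik.
by rewrite (_ : (i%:Z == k%:Z) = false) ?mulr0.
Qed.

Lemma fourier_psum_ge f N (k : nat) : (N <= k)%N -> fourier (psum f N) k%:Z = 0.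
Proof.
move=> kN; rewrite fourier_psum big1 // => i _.
rewrite (_ : (i%:Z == k%:Z) = false) ?mulr0 //.
by rewrite eqz_nat ltn_eqF // (leq_trans (ltn_ord i)).
Qed.

Lemma fourier_psum_neg f N (k : int) : k < 0 -> fourier (psum f N) k = 0.
Proof.
move=> kN; rewrite fourier_psum big1 // => i _.
rewrite (_ : (i%:Z == k) = false) ?mulr0 //.
by apply/negbTE; rewrite gt_eqF // (lt_le_trans kN).
Qed.

Lemma H2_L2 f : H2 f -> L2 f. Proof. by case. Qed.
Lemma H2_neg f k : H2 f -> k < 0 -> fourier f k = 0. Proof. by case=> _; apply. Qed.
Hint Resolve psum_L2 : core.

Lemma psum_H2 f N : H2 (psum f N).
Proof. by split => // k; exact: fourier_psum_neg. Qed.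

Lemma norm2D_orth f g : L2 f -> L2 g -> ip f g = 0 ->
  norm2 (fun z => f z + g z) = norm2 f + norm2 g.
Proof.
move=> hf hg h0.
have : ip (fun z => f z + g z) (fun z => f z + g z) = ip f f + ip g g.
  rewrite ipDl ?ipDr //; last exact: L2D.
  by rewrite [ip g f]ipC // h0 rmorph0 addr0 add0r.
by rewrite !ipff -rmorphD => /(congr1 (@complex.Re R)).
Qed.

Lemma norm2_zXZ (c : C) (k : int) : norm2 (fun z => c * z ^ k) = complex.Re `|c| ^+ 2.
Proof. by rewrite norm2Z ?norm2_zX ?mulr1 //; exact: L2_zX. Qed.

Lemma norm2D_zX g (c : C) (k : int) : L2 g -> fourier g k = 0 ->
  norm2 (fun z => g z + c * z ^ k) = norm2 g + complex.Re `|c| ^+ 2.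
Proof.
move=> hg h0; have hk := L2_zX R k.
rewrite norm2D_orth ?norm2_zXZ //; first exact: L2Z.
by rewrite ipZr // -fourier_ip // h0 mulr0.
Qed.

Definition csum f N : R := \sum_(k < N) complex.Re `|fourier f k%:Z| ^+ 2.

Lemma norm2_psum_tail f m n : (n <= m)%N ->
  norm2 (fun z => psum f m z - psum f n z) = csum f m - csum f n.
Proof.
elim: m => [|m IH].
  rewrite leqn0 => /eqP->; rewrite subrr.
  rewrite -[RHS](_ : norm2 (fun z => 0 * z ^ 0) = 0).
    by congr norm2; apply/funext => z; rewrite subrr mul0r.
  by rewrite norm2_zXZ normr0 /= expr0n.
rewrite leq_eqVlt => /orP[/eqP->|].
  rewrite subrr -[RHS](_ : norm2 (fun z => 0 * z ^ 0) = 0).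
    by congr norm2; apply/funext => z; rewrite subrr mul0r.
  by rewrite norm2_zXZ normr0 /= expr0n.
rewrite ltnS => nm; have {}IH := IH nm.
have -> : csum f m.+1 = csum f m + complex.Re `|fourier f m%:Z| ^+ 2.
  by rewrite /csum big_ord_recr.
rewrite addrAC -IH -(@norm2D_zX _ _ m%:Z).
- by congr norm2; apply/funext => z; rewrite psumS addrAC.
- exact: L2B.
- rewrite fourierB // !fourier_psum_ge ?subrr //.
Qed.

Lemma bessel f N : L2 f -> norm2 f = norm2 (fun z => f z - psum f N z) + csum f N.
Proof.
move=> hf; elim: N => [|N IH].
  rewrite /csum big_ord0 addr0; congr norm2; apply/funext => z.
  by rewrite /psum big_ord0 subr0.
have E : norm2 (fun z => f z - psum f N z) =
    norm2 (fun z => f z - psum f N.+1 z) + complex.Re `|fourier f N%:Z| ^+ 2.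
  rewrite -(@norm2D_zX _ _ N%:Z).
  - by congr norm2; apply/funext => z; rewrite psumS; ring.
  - exact: L2B.
  - by rewrite fourierB // fourier_psum_lt // subrr.
by rewrite IH E /csum big_ord_recr /= -addrA; congr (_ + _); exact: addrC.
Qed.

Lemma csum_cauchy f : L2 f -> forall e : R, 0 < e -> exists N, forall m n,
  (N <= m)%N -> (N <= n)%N -> `|csum f m - csum f n| <= e.
Proof.
move=> hf e e0.
have cv : cvgn (csum f).
  apply: nondecreasing_is_cvgn.
    move=> m n mn; rewrite -subr_ge0 -norm2_psum_tail //; exact: norm2_ge0.
  by exists (norm2 f) => _ [n _ <-]; rewrite (bessel n hf) lerDr norm2_ge0.
move/cvg_ex: cv => [l hl].
have e2 : 0 < e / 2 by rewrite divr_gt0.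
move/cvgrPdist_le: hl => /(_ _ e2) [N _ hN].
exists N => m n hm hn.
have := hN m hm; have := hN n hn => /=.
set a := csum f m; set b := csum f n => h1 h2.
rewrite (_ : a - b = (l - b) - (l - a)); last by ring.
apply: le_trans (ler_normB _ _) _; rewrite [e]splitr; exact: lerD.
Qed.

Lemma small_zero (x : C) (K : R) :
  (forall e : R, 0 < e -> complex.Re `|x| ^+ 2 <= K * e) -> x = 0.
Proof.
move=> h.
have K0 : 0 <= K by have := h 1 ltr01; rewrite mulr1; apply: le_trans; exact: sqr_ge0.
have : complex.Re `|x| ^+ 2 <= 0.
  apply/ler_addgt0Pr => e e0; rewrite add0r.
  have e1 : 0 < e / (K + 1) by rewrite divr_gt0 // ltr_wpDl.
  apply: le_trans (h _ e1) _; rewrite mulrCA; apply: ler_piMr; first exact: ltW.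
  by rewrite ler_pdivrMr ?mul1r ?lerDl // ltr_wpDl.
rewrite norm2E => h0.
have : complex.Re x ^+ 2 + complex.Im x ^+ 2 == 0.
  by rewrite eq_le h0 addr_ge0 ?sqr_ge0.
rewrite paddr_eq0 ?sqr_ge0 // !sqrf_eq0 => /andP[/eqP a /eqP b].
exact: complex_ext.
Qed.

(** G is the orthogonal projection of f onto H^2, obtained as the limit of the partial sums over
    nonnegative indices. Each coefficient passes to the limit by [fourier_le]. This existence
    statement is what gives the chosen representative [projH2] its meaning. *)
Lemma riesz_fischer f : L2 f -> exists G, [/\ L2 G,
  (forall e : R, 0 < e -> exists N, forall n, (N <= n)%N ->
     norm2 (fun z => G z - psum f n z) <= e),
  (forall k : nat, fourier G k%:Z = fourier f k%:Z) & H2 G].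
Proof.
move=> hf.
have [] := @L2_complete R (psum f) (psum_L2 f).
  move=> e e0; have [N hN] := csum_cauchy hf e0; exists N => m n hm hn.
  have [nm|mn] := leqP n m.
    by rewrite norm2_psum_tail // (le_trans (ler_norm _)) // hN.
  rewrite norm2_sym norm2_psum_tail ?(ltnW mn) // (le_trans (ler_norm _)) // hN //.
move=> G hG hlim; exists G.
have lim k (c : C) N0 : (forall n, (N0 <= n)%N -> fourier (psum f n) k = c) ->
    fourier G k = c.
  move=> hc; apply/eqP; rewrite -subr_eq0; apply/eqP.
  apply: (@small_zero _ 1) => e e0; rewrite mul1r.
  have [N hN] := hlim e e0.
  rewrite -(hc (maxn N0 N)) ?leq_maxl // -fourierB //.
  apply: le_trans (fourier_le _ _) (hN _ (leq_maxr _ _)); exact: L2B.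
split => //.
- by move=> k; apply: (lim _ _ k.+1) => n; exact: fourier_psum_lt.
- by split => // k k0; apply: (lim _ _ 0%N) => n _; exact: fourier_psum_neg.
Qed.

(** The partial sums converge to the G of [riesz_fischer], which has the same coefficients as f at
    all indices; by [fzero_ae] the two agree almost everywhere. *)
Lemma H2_psum f : H2 f -> forall e : R, 0 < e -> exists N, forall n, (N <= n)%N ->
  norm2 (fun z => f z - psum f n z) <= e.
Proof.
move=> hf; have lf := H2_L2 hf; have [G [lG hlim hk hG]] := riesz_fischer lf.
have ae : ae_circle (fun z => f z - G z = 0).
  apply: fzero_ae; split; first exact: L2B.
  move=> k; rewrite fourierB //; case: k => n; first by rewrite hk subrr.
  by rewrite !H2_neg ?subrr.
move=> e e0; have [N hN] := hlim e e0; exists N => n hn.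
rewrite (_ : norm2 _ = norm2 (fun z => G z - psum f n z)) ?hN //.
apply: norm2_ae; [exact: L2_cm (L2B _ _)|exact: L2_cm (L2B _ _)|].
by apply: ae_imp ae => z _ /eqP; rewrite subr_eq0 => /eqP ->.
Qed.

Lemma ipBr (x f g : C -> C) : L2 x -> L2 f -> L2 g ->
  ip x (fun z => f z - g z) = ip x f - ip x g.
Proof.
move=> hx hf hg; rewrite ipDr //; last exact: L2N.
congr (_ + _); rewrite -[RHS]mulN1r -[X in X * _](rmorphN1 (@Num.conj C)) -ipZr //.
by apply: eq_ipr => z; rewrite mulN1r.
Qed.

Lemma ip_sumr (I : Type) (s : seq I) (F : I -> C -> C) (x : C -> C) :
  L2 x -> (forall i, L2 (F i)) ->
  ip x (fun z => \sum_(i <- s) F i z) = \sum_(i <- s) ip x (F i).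
Proof.
move=> hx hF; rewrite /ip -ci_sum; last by move=> i; exact: L2_prod (L2C _).
by congr circle_int; apply/funext => z; rewrite rmorph_sum mulr_sumr.
Qed.

Lemma ip_psum0 (x f : C -> C) N : L2 x -> (forall k : nat, fourier x k%:Z = 0) ->
  ip x (psum f N) = 0.
Proof.
move=> hx h0; rewrite /psum ip_sumr //; last by move=> i; apply: L2Z; exact: L2_zX.
apply: big1 => i _; have lz := L2_zX R i%:Z.
by rewrite ipZr // -fourier_ip // h0 mulr0.
Qed.

Lemma H2_orth (x K : C -> C) : L2 x -> (forall k : nat, fourier x k%:Z = 0) -> H2 K -> ip x K = 0.
Proof.
move=> hx h0 hK; have lK := H2_L2 hK.
apply: (@small_zero _ (norm2 x)) => e e0; have [N hN] := H2_psum hK e0.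
have {}hN := hN N (leqnn _).
have -> : ip x K = ip x (fun z => K z - psum K N z).
  by rewrite ipBr // ip_psum0 // subr0.
apply: le_trans (cauchy_schwarz hx (L2B lK (psum_L2 K N))) _.
by apply: ler_wpM2l => //; exact: norm2_ge0.
Qed.

Lemma H2D f g : H2 f -> H2 g -> H2 (fun z => f z + g z).
Proof.
move=> [a b] [c d]; split; first exact: L2D.
by move=> k k0; rewrite fourierD // b // d // addr0.
Qed.

Lemma H2Z (c : C) f : H2 f -> H2 (fun z => c * f z).
Proof.
move=> [a b]; split; first exact: L2Z.
by move=> k k0; rewrite fourierZ // b // mulr0.
Qed.

Lemma H2B f g : H2 f -> H2 g -> H2 (fun z => f z - g z).
Proof.
move=> hf hg; have := H2D hf (H2Z (-1) hg); congr H2; apply/funext => z.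
by rewrite mulN1r.
Qed.

Lemma H2_cst (c : C) : H2 (fun=> c).
Proof.
split; first exact: L2_cst.
by move=> k k0; rewrite fourier_cst lt_eqF // mulr0.
Qed.

Lemma H2_sum (I : Type) (s : seq I) (F : I -> C -> C) :
  (forall i, H2 (F i)) -> H2 (fun z => \sum_(i <- s) F i z).
Proof.
move=> h; elim: s => [|a s IH].
  have := H2_cst 0; congr H2; by apply/funext => z; rewrite big_nil.
have := H2D (h a) IH; congr H2; by apply/funext => z; rewrite big_cons.
Qed.

Lemma H2_ae f g : H2 f -> circle_measurable g -> ae_circle (fun z => f z = g z) -> H2 g.
Proof.
move=> [a b] cg h; have lg := L2_ae a cg h; split => // k k0.
by rewrite -(fourier_ae k a lg h) b.
Qed.

Lemma H2_zX (n : nat) : H2 (fun z : C => z ^ n%:Z).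
Proof.
split; first exact: L2_zX.
move=> k k0; rewrite fourier_zX (_ : (n%:Z == k) = false) //.
by apply/negbTE; rewrite gt_eqF // (lt_le_trans k0).
Qed.

(** The negative coefficients of h times a polynomial vanish because those of h do. Since h is
    bounded, the error made by replacing f with a partial sum is small in L^2, hence in every
    coefficient. *)
Lemma Hinfty_H2M h f : Hinfty h -> H2 f -> H2 (fun z => h z * f z).
Proof.
move=> [lh h2h] hf; have lf := H2_L2 hf; have l2h := H2_L2 h2h.
split; first exact: Linfty_L2M.
move=> k k0; have [ch [M hM]] := lh.
apply: (@small_zero _ (M ^+ 2)) => e e0; have [N hN] := H2_psum hf e0.
have {}hN := hN N (leqnn _).
have -> : fourier (fun z => h z * f z) k = fourier (fun z => h z * (f z - psum f N z)) k.
  have E : fourier (fun z => h z * psum f N z) k = 0.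
    rewrite (_ : (fun z => _) = (fun z => \sum_(j < N) fourier f j%:Z * (h z * z ^ j%:Z))).
      have lz j : L2 (fun z => h z * z ^ j) by apply: Linfty_L2M => //; exact: L2_zX.
      rewrite fourier_sum; last by move=> i; apply: L2Z.
      apply: big1 => i _; rewrite fourierZ // fourier_shift // (H2_neg h2h) ?mulr0 //.
      by apply: le_lt_trans k0; rewrite gerBl.
    by apply/funext => z; rewrite mulr_sumr; apply: eq_bigr => i _; rewrite mulrCA.
  rewrite -[LHS]subr0 -E -fourierB; [|exact: Linfty_L2M|exact: Linfty_L2M].
  by apply: eq_fourier => z; rewrite mulrBr.
apply: le_trans (fourier_le _ _) _; first by apply: Linfty_L2M => //; exact: L2B.
apply: le_trans (norm2M_le ch hM (L2B lf (psum_L2 f N))) _.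
by apply: ler_wpM2l => //; exact: sqr_ge0.
Qed.

Lemma HinftyM f g : Hinfty f -> Hinfty g -> Hinfty (fun z => f z * g z).
Proof.
move=> hf [lg hg]; split; last exact: Hinfty_H2M.
by case: hf => lf _; exact: LinftyM.
Qed.

Lemma HinftyD f g : Hinfty f -> Hinfty g -> Hinfty (fun z => f z + g z).
Proof. by move=> [a b] [c d]; split; [exact: LinftyD|exact: H2D]. Qed.

Lemma Hinfty_cst (c : C) : Hinfty (fun=> c).
Proof. by split; [exact: Linfty_cst|exact: H2_cst]. Qed.

Lemma Hinfty_zX (n : nat) : Hinfty (fun z : C => z ^ n%:Z).
Proof. by split; [exact: Linfty_zX|exact: H2_zX]. Qed.

Lemma HinftyX f n : Hinfty f -> Hinfty (fun z => f z ^+ n).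
Proof.
move=> hf; elim: n => [|n IH].
  have := Hinfty_cst 1; congr Hinfty; by apply/funext => z; rewrite expr0.
have := HinftyM hf IH; congr Hinfty; by apply/funext => z; rewrite exprS.
Qed.

End HardySpace.

(** * Evaluation at a point of the disc and Blaschke factors *)

Section Decay.
Variable R : realType.
Local Notation C := R[i].

Lemma Re_normX (x : C) n : complex.Re `|x ^+ n| = complex.Re `|x| ^+ n.
Proof.
elim: n => [|n IH]; first by rewrite !expr0 normr1.
by rewrite !exprS Re_normM IH.
Qed.

Lemma norm_lt1 (x : C) : `|x| < 1 -> complex.Re `|x| < 1.
Proof. by rewrite ltcE => /andP[]. Qed.

Lemma pow_small (r e : R) : 0 <= r -> r < 1 -> 0 < e -> exists n : nat, r ^+ n <= e.
Proof.
move=> r0 r1 e0.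
have : (fun n => r ^+ n) @ \oo --> (0 : R) by apply: cvg_expr; rewrite ger0_norm.
move/cvgrPdist_le => /(_ e e0) [n _ /(_ n (leqnn _))] /=.
rewrite sub0r normrN ger0_norm ?exprn_ge0 // => h; by exists n.
Qed.

(** Meant for recurrences x_k = r x_(k+1): iteration gives x_0 = r^n x_n, and when the x_n are
    Fourier coefficients of one L^2 function they are bounded by its norm, which forces x_0 = 0. *)
Lemma decay0 (x r : C) (K : R) : `|r| < 1 ->
  (forall n, exists2 y, x = r ^+ n * y & complex.Re `|y| ^+ 2 <= K) -> x = 0.
Proof.
move=> r1 h; apply: (@small_zero _ _ K) => e e0.
have K0 : 0 <= K by have [y _] := h 0%N; apply: le_trans; exact: sqr_ge0.
have q0 : 0 <= complex.Re `|r| ^+ 2 by exact: sqr_ge0.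
have q1 : complex.Re `|r| ^+ 2 < 1.
  by rewrite expr_lt1 ?norm_lt1 // Re_norm_ge0.
have [n hn] := pow_small q0 q1 e0; have [y -> hy] := h n.
rewrite Re_normM exprMn Re_normX -exprM mulnC exprM mulrC.
by apply: ler_pM => //; [exact: sqr_ge0|exact: exprn_ge0].
Qed.

End Decay.

(** * The value at alpha and division by the Blaschke factor *)

Section Blaschke.
Variable R : realType.
Local Notation C := R[i].
Variable alpha : C.
Hypothesis a1 : `|alpha| < 1.
Implicit Types f g h : C -> C.

Lemma za_neq0 (z : C) : `|z| = 1 -> z - alpha != 0.
Proof.
move=> z1; rewrite subr_eq0; apply/eqP => h; move: a1.
by rewrite -h z1 ltxx.
Qed.

Lemma az_conj (z : C) : `|z| = 1 -> 1 - alpha^* * z = z * (z - alpha)^*.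
Proof.
move=> z1; rewrite rmorphB /= mulrBr [alpha^* * z]mulrC; congr (_ - _).
by rewrite -normCK z1 expr1n.
Qed.

Lemma az_neq0 (z : C) : `|z| = 1 -> 1 - alpha^* * z != 0.
Proof.
move=> z1; rewrite az_conj //; apply: mulf_neq0; first exact: z_neq0.
by rewrite conjC_eq0; exact: za_neq0.
Qed.

Definition wa (z : C) : C := (z - alpha)^-1.

Lemma cm_wa : circle_measurable wa.
Proof.
(* [u t] is |e^(it) - alpha|^2 written out, a continuous function without zeros; 1/(z - alpha) is
   the conjugate of z - alpha divided by it. *)
pose u (t : R) : R := 1 + complex.Re `|alpha| ^+ 2 - 2 * complex.Re alpha * cos t
   - 2 * complex.Im alpha * sin t.
have uE (t : R) : (expi t - alpha) * (expi t - alpha)^* = (u t)%:C%C.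
  rewrite mul_conj norm2E creD cimD creN cimN /u norm2E /=.
  by congr (_%:C%C); have := cos2Dsin2 t; rewrite !expr2; lra.
have un0 (t : R) : u t != 0.
  apply/eqP => h; have := uE t; rewrite h => /eqP.
  by rewrite mulf_eq0 conjC_eq0 orbb (negbTE (za_neq0 (expi_norm t))).
have mi : rmeas (fun t : measurableTypeR R => (u t)^-1).
  apply: measurable_funTS; apply: continuous_measurable_fun => t.
  apply: (@cvgV R R (nbhs t) _ u (u t)); first exact: un0.
  rewrite /u; apply: cvgB; first apply: cvgB.
  - exact: cvg_cst.
  - by apply: cvgM; [exact: cvg_cst|exact: continuous_cos].
  - by apply: cvgM; [exact: cvg_cst|exact: continuous_sin].
have wE (t : R) : wa (expi t) = (expi t - alpha)^* * ((u t)^-1)%:C%C.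
  have n0 := za_neq0 (expi_norm t).
  have c0 : (expi t - alpha)^* != 0 by rewrite conjC_eq0.
  have -> : ((u t)^-1)%:C%C = ((expi t - alpha) * (expi t - alpha)^*)^-1.
    by rewrite uE; exact: fmorphV.
  by rewrite /wa invfM mulrCA mulfV ?mulr1.
have [c1 c2] := cmD (cm_id R) (cm_cst (- alpha)).
apply: cmI.
- by apply: eq_rmeas (rmeasM c1 mi) => t; rewrite wE creM creC /= mulr0 subr0.
- by apply: eq_rmeas (rmeasN (rmeasM c2 mi)) => t; rewrite wE cimM cimC /= mulr0 add0r mulNr.
Qed.

Lemma Linfty_wa : Linfty wa.
Proof.
split; first exact: cm_wa.
exists (1 - complex.Re `|alpha|)^-1; apply: ae_all => z z1.
have n0 := za_neq0 z1.
have p0 : 0 < 1 - complex.Re `|alpha| by rewrite subr_gt0 norm_lt1.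
have h : 1 - complex.Re `|alpha| <= complex.Re `|z - alpha|.
  have := Re_normD (z - alpha) alpha; rewrite subrK z1 => H.
  by rewrite lerBlDr.
have e : complex.Re `|wa z| * complex.Re `|z - alpha| = 1.
  by rewrite -Re_normM /wa mulVf // normr1.
have q0 := lt_le_trans p0 h.
have n1 : complex.Re `|z - alpha| != 0 by rewrite gt_eqF.
by rewrite -[X in X <= _](mulfK n1) e mul1r lef_pV2 ?posrE.
Qed.

Lemma fourier_mulB f (c : C) k : L2 f ->
  fourier (fun z => (z - c) * f z) k = fourier f (k - 1) - c * fourier f k.
Proof.
move=> hf; rewrite -fourierZ // -(fourier_shift 1 k hf) -fourierB.
- by apply: eq_fourier => z; rewrite expr1z mulrBl [z * _]mulrC.
- have := Linfty_L2M (Linfty_zX R 1) hf; congr L2; apply/funext => z; exact: mulrC.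
- exact: L2Z.
Qed.

(* For f in H^2 this is the value of f at alpha. *)
Definition ev f : C := fourier (fun z => f z * wa z) (-1).

Lemma L2_wa f : L2 f -> L2 (fun z => f z * wa z).
Proof.
move=> hf; have := Linfty_L2M Linfty_wa hf; congr L2; apply/funext => z; exact: mulrC.
Qed.

Lemma evD f g : L2 f -> L2 g -> ev (fun z => f z + g z) = ev f + ev g.
Proof.
move=> hf hg; rewrite /ev -fourierD; [|exact: L2_wa|exact: L2_wa].
by apply: eq_fourier => z; rewrite mulrDl.
Qed.

Lemma evZ (c : C) f : L2 f -> ev (fun z => c * f z) = c * ev f.
Proof.
move=> hf; rewrite /ev -fourierZ; last exact: L2_wa.
by apply: eq_fourier => z; rewrite mulrA.
Qed.

Lemma ev_ae f g : L2 f -> L2 g -> ae_circle (fun z => f z = g z) -> ev f = ev g.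
Proof.
move=> hf hg h; apply: fourier_ae; [exact: L2_wa|exact: L2_wa|].
by apply: ae_imp h => z _ ->.
Qed.

(** The coefficients of 1/(z - alpha) satisfy y_(k-1) - alpha y_k = 0 except at k = 0, where the
    value is 1. The recurrence and boundedness give y_0 = 0, so y_(-1) = 1. *)
Lemma ev_cst (c : C) : ev (fun=> c) = c.
Proof.
rewrite -[LHS](_ : ev (fun z => c * 1) = _); last by rewrite mulr1.
rewrite evZ; last exact: L2_cst.
rewrite -[RHS]mulr1; congr (_ * _).
have l1 := L2_wa (L2_cst (1 : C)); set y := (fun z => 1 * wa z) in l1.
have E k : fourier y (k - 1) - alpha * fourier y k = (k == 0)%:R.
  rewrite -fourier_mulB // -[RHS]mul1r -fourier_cst; apply: fourier_ae.
  - have := Linfty_L2M (LinftyD (Linfty_id R) (Linfty_cst (- alpha))) l1; exact.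
  - exact: L2_cst.
  - by apply: ae_all => z z1; rewrite /y mul1r /wa mulfV // za_neq0.
have y0 : fourier y 0 = 0.
  apply: (@decay0 _ _ alpha (norm2 y) a1) => n; exists (fourier y n%:Z); last exact: fourier_le.
  elim: n => [|n IH]; first by rewrite expr0 mul1r.
  rewrite IH exprSr -mulrA; congr (_ * _).
  have := E n.+1%:Z; rewrite (_ : (n.+1%:Z == 0) = false) // (_ : n.+1%:Z - 1 = n%:Z).
    by move/eqP; rewrite subr_eq0 => /eqP.
  by rewrite -addn1 PoszD addrK.
by have := E 0; rewrite y0 mulr0 subr0 sub0r eqxx.
Qed.

Lemma ev_mulB g : H2 g -> ev (fun z => (z - alpha) * g z) = 0.
Proof.
move=> hg; have lg := H2_L2 hg; rewrite -(H2_neg (k := -1) hg) //; apply: fourier_ae => //.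
- apply: L2_wa; have := Linfty_L2M (LinftyD (Linfty_id R) (Linfty_cst (- alpha))) lg; exact.
- by apply: ae_all => z z1; rewrite /wa mulrAC divff ?mul1r // za_neq0.
Qed.

(** The coefficients y_j of f / (z - alpha) satisfy y_(j-1) = alpha y_j for negative j, as those of
    f vanish there. The hypothesis is y_(-1) = 0, and the zero propagates downwards. *)
Lemma ev0_H2 f : H2 f -> ev f = 0 -> H2 (fun z => f z * wa z).
Proof.
move=> hf e0; have lf := H2_L2 hf; have ly := L2_wa lf; split => // k k0.
set y := (fun z => _) in ly *.
have E j : fourier y (j - 1) - alpha * fourier y j = fourier f j.
  rewrite -fourier_mulB //; apply: fourier_ae => //.
  - have := Linfty_L2M (LinftyD (Linfty_id R) (Linfty_cst (- alpha))) ly; exact.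
  - by apply: ae_all => z z1; rewrite /y /wa mulrC mulfVK // za_neq0.
have P n : fourier y (Negz n) = 0.
  elim: n => [|n IH]; first exact: e0.
  have := E (Negz n); rewrite IH mulr0 subr0 (H2_neg hf) //.
  by rewrite (_ : Negz n - 1 = Negz n.+1) // !NegzE -opprD -PoszD addn1.
by case: k k0 => // n _; exact: P.
Qed.

Definition wb (z : C) : C := (1 - alpha^* * z)^-1.

Lemma cm_circle f g : circle_measurable f -> (forall z, `|z| = 1 -> f z = g z) ->
  circle_measurable g.
Proof.
move=> [a b] h; apply: cmI.
- by apply: eq_rmeas a => t; rewrite h ?expi_norm.
- by apply: eq_rmeas b => t; rewrite h ?expi_norm.
Qed.

Lemma Linfty_circle f g : Linfty f -> (forall z, `|z| = 1 -> f z = g z) -> Linfty g.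
Proof.
move=> [cf [M hM]] h; split; first exact: cm_circle cf h.
by exists M; apply: ae_imp hM => z z1; rewrite h.
Qed.

Lemma H2_circle f g : H2 f -> (forall z, `|z| = 1 -> f z = g z) -> H2 g.
Proof.
move=> hf h; apply: (H2_ae hf); last exact: ae_all.
by apply: cm_circle h; case: hf => -[].
Qed.

Lemma Hinfty_circle f g : Hinfty f -> (forall z, `|z| = 1 -> f z = g z) -> Hinfty g.
Proof. by move=> [a b] h; split; [exact: Linfty_circle a h|exact: H2_circle b h]. Qed.

Lemma Linfty_wb : Linfty wb.
Proof.
apply: (@Linfty_circle (fun z => (z * wa z)^*)).
  by apply: LinftyC; apply: LinftyM; [exact: Linfty_id|exact: Linfty_wa].
move=> z z1; have zc : z * z^* = 1 by rewrite -normCK z1 expr1n.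
rewrite /wb az_conj // /wa rmorphM invfM; congr (_ * _); last exact: fmorphV.
by rewrite -[RHS](mulfK (z_neq0 z1)) mulVf ?z_neq0 // -zc mulrAC mulfV ?z_neq0 // mul1r.
Qed.

Lemma fourier_mul1B f (c : C) k : L2 f ->
  fourier (fun z => (1 - c * z) * f z) k = fourier f k - c * fourier f (k - 1).
Proof.
move=> hf; rewrite -(fourier_shift 1 k hf) -fourierZ.
  rewrite -fourierB //.
  - by apply: eq_fourier => z; rewrite expr1z; ring.
  - apply: L2Z; have := Linfty_L2M (Linfty_zX R 1) hf; congr L2; apply/funext => z; exact: mulrC.
by have := Linfty_L2M (Linfty_zX R 1) hf; congr L2; apply/funext => z; exact: mulrC.
Qed.

Lemma Hinfty_1az : Hinfty (fun z => 1 - alpha^* * z).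
Proof.
have := HinftyD (Hinfty_cst (1 : C)) (HinftyM (Hinfty_cst (- alpha^*)) (Hinfty_zX R 1)).
by move/Hinfty_circle; apply => z _; rewrite expr1z mulNr.
Qed.

Lemma Hinfty_za : Hinfty (fun z => z - alpha).
Proof.
have := HinftyD (Hinfty_zX R 1) (Hinfty_cst (- alpha)).
by move/Hinfty_circle; apply => z _; rewrite expr1z.
Qed.

(** At negative k the coefficients satisfy w_k = alpha^* w_(k-1); they are bounded, so [decay0]
    makes them vanish. *)
Lemma Hinfty_wb : Hinfty wb.
Proof.
have Lw := Linfty_wb; have lw := Linfty_L2 Lw.
split => //; split => // k k0.
have E j : fourier wb j - alpha^* * fourier wb (j - 1) = (j == 0)%:R.
  rewrite -fourier_mul1B // -[RHS]mul1r -fourier_cst; apply: fourier_ae.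
  - by case: Hinfty_1az => L _; exact: Linfty_L2M L lw.
  - exact: L2_cst.
  - by apply: ae_all => z z1; rewrite /wb mulfV // az_neq0.
have r1 : `|alpha^*| < 1 by rewrite norm_conjC.
apply: (@decay0 _ _ (alpha^*) (norm2 wb) r1) => n.
exists (fourier wb (k - n%:Z)); last exact: fourier_le.
elim: n => [|n IH]; first by rewrite expr0 mul1r subr0.
rewrite IH exprSr -mulrA; congr (_ * _).
have := E (k - n%:Z); rewrite (_ : (k - n%:Z == 0) = false); last first.
  by apply/negbTE; rewrite lt_eqF // subr_lt0 (lt_le_trans k0).
move/eqP; rewrite subr_eq0 => /eqP ->.
by congr (_ * fourier _ _); rewrite -addn1 PoszD opprD addrA.
Qed.

Local Notation b := (blaschke alpha).

Lemma Hinfty_b : Hinfty b.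
Proof. exact: HinftyM Hinfty_za Hinfty_wb. Qed.

Lemma b_norm z : `|z| = 1 -> `|b z| = 1.
Proof.
move=> z1; rewrite /blaschke normrM normfV az_conj // normrM z1 mul1r norm_conjC.
by rewrite divff // normr_eq0 za_neq0.
Qed.

Lemma b_neq0 z : `|z| = 1 -> b z != 0.
Proof. by move=> /b_norm h; rewrite -normr_eq0 h oner_eq0. Qed.

Lemma Hinfty_bX p : Hinfty (fun z => b z ^+ p).
Proof. exact: HinftyX Hinfty_b. Qed.

Lemma bX_norm p z : `|z| = 1 -> `|b z ^+ p| = 1.
Proof. by move=> z1; rewrite normrX b_norm // expr1n. Qed.

Lemma bX_neq0 p z : `|z| = 1 -> b z ^+ p != 0.
Proof. by move=> z1; rewrite expf_neq0 // b_neq0. Qed.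

Lemma ev_b g : H2 g -> ev (fun z => b z * g z) = 0.
Proof.
move=> hg; rewrite -(ev_mulB (Hinfty_H2M Hinfty_wb hg)); congr ev.
by apply/funext => z; rewrite /blaschke mulrA.
Qed.

Definition bquot f : C -> C := fun z => (1 - alpha^* * z) * ((f z - ev f) * wa z).

Lemma bquotE f z : `|z| = 1 -> f z = ev f + b z * bquot f z.
Proof.
move=> z1; rewrite /bquot /blaschke /wa.
by field; rewrite az_neq0 // za_neq0.
Qed.

Lemma ev_sub f : H2 f -> ev (fun z => f z - ev f) = 0.
Proof.
move=> hf; rewrite evD ?ev_cst ?subrr //; [exact: H2_L2|exact: L2_cst].
Qed.

Lemma bquot_H2 f : H2 f -> H2 (bquot f).
Proof.
move=> hf; apply: Hinfty_H2M Hinfty_1az _; apply: ev0_H2; last exact: ev_sub.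
by apply: H2B => //; exact: H2_cst.
Qed.

Lemma bquot_Hinfty f : Hinfty f -> Hinfty (bquot f).
Proof.
move=> [lf hf]; split; last exact: bquot_H2.
apply: LinftyM; first by case: Hinfty_1az.
by apply: LinftyM; [apply: LinftyD => //; exact: Linfty_cst|exact: Linfty_wa].
Qed.

Lemma evM h f : Hinfty h -> H2 f -> ev (fun z => h z * f z) = ev h * ev f.
Proof.
move=> hh hf; have h2h : H2 h by case: hh.
have H1 : H2 (fun z => bquot h z * f z + ev h * bquot f z).
  apply: H2D; first exact: Hinfty_H2M (bquot_Hinfty hh) hf.
  exact: H2Z (bquot_H2 hf).
have H3 := Hinfty_H2M Hinfty_b H1.
transitivity (ev (fun z => ev h * ev f + b z * (bquot h z * f z + ev h * bquot f z))).
  apply: ev_ae; first exact: H2_L2 (Hinfty_H2M hh hf).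
    by apply: L2D; [exact: L2_cst|exact: H2_L2 H3].
  apply: ae_all => z z1; rewrite {1}(bquotE h z1) mulrDl mulrDr addrA.
  rewrite {1}(bquotE f z1); ring.
rewrite evD; [|exact: L2_cst|exact: H2_L2].
by rewrite ev_cst ev_b // addr0.
Qed.

End Blaschke.

(** * Finiteness of the order of vanishing at alpha *)

Section Order.
Variable R : realType.
Local Notation C := R[i].
Variable alpha : C.
Hypothesis a1 : `|alpha| < 1.
Implicit Types f g h : C -> C.
Local Notation b := (blaschke alpha).

Lemma norm0_lt1 : `|0 : C| < 1. Proof. by rewrite normr0 ltr01. Qed.

Lemma ev00 f : L2 f -> ev 0 f = fourier f 0.
Proof.
move=> hf; rewrite -[RHS](fourier_shift (-1) (-1)) //.
apply: fourier_ae; first exact: (L2_wa norm0_lt1).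
  by have := Linfty_L2M (Linfty_zX R (-1)) hf; congr L2; apply/funext => z; exact: mulrC.
by apply: ae_all => z z1; rewrite /wa subr0 exprN1.
Qed.

Lemma fourier0_b : fourier b 0 = - alpha.
Proof.
have [Lb Hb] := Hinfty_b a1; have lb := H2_L2 Hb.
have [La _] := Hinfty_za alpha; have la := Linfty_L2 La.
have : fourier (fun z => (1 - alpha^* * z) * b z) 0 = fourier (fun z => z - alpha) 0.
  apply: fourier_ae => //.
    by case: (Hinfty_1az alpha) => L _; exact: Linfty_L2M.
  by apply: ae_all => z z1; rewrite /blaschke mulrCA mulfV ?mulr1 // az_neq0.
rewrite fourier_mul1B // sub0r (@H2_neg _ _ (-1) Hb) // mulr0 subr0 => ->.
rewrite fourierB; [|exact: Linfty_L2 (Linfty_id R)|exact: L2_cst].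
rewrite fourier_cst eqxx mulr1 -[X in X - _](_ : fourier (fun z : C => z ^ 1) 0 = _).
  by rewrite fourier_zX sub0r.
by apply: eq_fourier => z; rewrite expr1z.
Qed.

Lemma fourier0M h f : Hinfty h -> H2 f ->
  fourier (fun z => h z * f z) 0 = fourier h 0 * fourier f 0.
Proof.
move=> hh hf; have h2h : H2 h by case: hh.
rewrite -!ev00 ?evM //; first exact: norm0_lt1.
- exact: H2_L2.
- exact: H2_L2.
- exact: H2_L2 (Hinfty_H2M hh hf).
Qed.

Lemma fourier0_bX p : fourier (fun z => b z ^+ p) 0 = (- alpha) ^+ p.
Proof.
elim: p => [|p IH].
  rewrite (_ : (fun z => _) = fun=> 1); last by apply/funext => z; rewrite expr0.
  by rewrite fourier_cst eqxx mulr1.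
rewrite (_ : (fun z => _) = fun z => b z * b z ^+ p); last by apply/funext => z; rewrite exprS.
rewrite fourier0M ?IH ?fourier0_b ?exprS //; first exact: Hinfty_b.
by case: (Hinfty_bX a1 p).
Qed.

Definition binf_div f := H2 f /\ forall p : nat, exists2 g, H2 g &
  ae_circle (fun z => f z = b z ^+ p * g z).

Lemma norm2_unim u g : circle_measurable u -> (forall z, `|z| = 1 -> `|u z| = 1) -> L2 g ->
  norm2 (fun z => u z * g z) <= norm2 g.
Proof.
move=> cu hu hg; rewrite -[X in _ <= X]mul1r -(expr1n _ 2).
by apply: norm2M_le => //; apply: ae_all => z z1; rewrite hu.
Qed.

(** With f = b^p g the constant coefficient of f is (- alpha)^p times that of g. Since b is
    unimodular, g has the norm of f, so that coefficient is bounded uniformly in p. *)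
Lemma binf_fourier0 f : binf_div f -> fourier f 0 = 0.
Proof.
move=> [hf hp]; have lf := H2_L2 hf.
have r1 : `|- alpha| < 1 by rewrite normrN.
apply: (@decay0 _ _ (- alpha) (norm2 f) r1) => p; have [g hg fg] := hp p.
have lg := H2_L2 hg; exists (fourier g 0).
  rewrite -fourier0_bX -fourier0M //; last exact: Hinfty_bX.
  by apply: fourier_ae => //; exact: H2_L2 (Hinfty_H2M (Hinfty_bX a1 p) hg).
apply: le_trans (fourier_le 0 lg) _.
have cb : circle_measurable (fun z => (b z ^+ p)^*).
  by apply: cmC; case: (Hinfty_bX a1 p) => -[].
rewrite (_ : norm2 g = norm2 (fun z => (b z ^+ p)^* * f z)).
  apply: norm2_unim => // z z1; by rewrite norm_conjC bX_norm.
apply: norm2_ae; [exact: L2_cm|exact: cmM cb (L2_cm lf)|].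
apply: ae_imp fg => z z1 ->; rewrite mulrA [_^* * _]mulrC -normCK bX_norm //.
by rewrite expr1n mul1r.
Qed.

Lemma H2_divz g : H2 g -> fourier g 0 = 0 -> H2 (fun z => g z * z ^ (-1)).
Proof.
move=> hg g0; have lg := H2_L2 hg; split.
  by have := Linfty_L2M (Linfty_zX R (-1)) lg; congr L2; apply/funext => z; exact: mulrC.
move=> k k0; rewrite fourier_shift // opprK.
have [e|k1] := eqVneq (k + 1) 0; first by rewrite e.
by rewrite (H2_neg hg) // lt_neqAle k1 /= addrC lez1D.
Qed.

(** Lets all coefficients be reached by repeated division by z. If alpha = 0 then b = z and the
    quotient for p + 1 serves for p; otherwise b(0) = - alpha is nonzero, so g inherits a zero at 0
    from f and g itself is divided by z. *)
Lemma binf_divz f : binf_div f -> binf_div (fun z => f z * z ^ (-1)).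
Proof.
move=> hb; have f0 := binf_fourier0 hb; case: hb => hf hp; split; first exact: H2_divz.
move=> p; have [a0|an0] := eqVneq alpha 0.
  have [g hg fg] := hp p.+1; exists g => //.
  apply: ae_imp fg => z z1 ->; have nz := z_neq0 z1.
  have bz : b z = z by rewrite /blaschke a0 subr0 rmorph0 mul0r subr0 divr1.
  by rewrite exprN1 exprS bz; field.
have [g hg fg] := hp p; have lg := H2_L2 hg.
have g0 : fourier g 0 = 0.
  have : fourier f 0 = fourier (fun z => b z ^+ p) 0 * fourier g 0.
    rewrite -fourier0M //; last exact: Hinfty_bX.
    apply: fourier_ae => //; first exact: H2_L2 hf.
    exact: H2_L2 (Hinfty_H2M (Hinfty_bX a1 p) hg).
  rewrite f0 fourier0_bX => /esym/eqP; rewrite mulf_eq0 expf_eq0 oppr_eq0 (negbTE an0) andbF /=.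
  by move/eqP.
exists (fun z => g z * z ^ (-1)); first exact: H2_divz.
by apply: ae_imp fg => z _ ->; rewrite mulrA.
Qed.

Lemma binf_ae0 f : binf_div f -> ae_circle (fun z => f z = 0).
Proof.
move=> hf.
have P (n : nat) : forall f, binf_div f -> fourier f n%:Z = 0.
  elim: n => [|n IH] {}f {}hf; first exact: binf_fourier0.
  have lf : L2 f by case: hf => -[].
  rewrite -(IH _ (binf_divz hf)) fourier_shift // opprK.
  by rewrite -addn1 PoszD.
apply: fzero_ae; case: (hf) => -[lf hn] _; split => // -[n|n]; first exact: P.
exact: hn.
Qed.

(** If dividing by b never ended, h would be divisible by every power of b and therefore vanish
    almost everywhere. *)
Lemma b_order h : Hinfty h -> ~ ae_circle (fun z => h z = 0) ->
  exists j u, [/\ Hinfty u, ev alpha u != 0 & forall z, `|z| = 1 -> h z = b z ^+ j * u z].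
Proof.
move=> hh hn; apply: contrapT => hno; apply: hn; apply: binf_ae0.
have P (p : nat) : exists2 u, Hinfty u & forall z, `|z| = 1 -> h z = b z ^+ p * u z.
  elim: p => [|p [u hu hE]].
    by exists h => // z _; rewrite expr0 mul1r.
  have [e0|e0] := eqVneq (ev alpha u) 0; last first.
    by exfalso; apply: hno; exists p, u.
  exists (bquot alpha u); first exact: bquot_Hinfty.
  move=> z z1; rewrite hE // {1}(bquotE a1 u z1) e0 add0r exprS; ring.
split; first by case: hh.
move=> p; have [u [_ hu] hE] := P p; exists u => //; exact: ae_all.
Qed.

End Order.

(** * Matrix functions and Hankel operators *)

Section MatrixSpaces.
Variable R : realType.
Local Notation C := R[i].
Implicit Types f g h : C -> C.

Definition ent m n (F : C -> 'M[C]_(m, n)) i j : C -> C := fun z => F z i j.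

Lemma L2_mulmx m n p (M : C -> 'M[C]_(m, n)) (F : C -> 'M[C]_(n, p)) :
  entrywise (@Linfty R) M -> entrywise (@L2 R) F -> entrywise (@L2 R) (fun z => M z *m F z).
Proof.
move=> hM hF i j; rewrite (_ : (fun z => _) = fun z => \sum_k M z i k * F z k j).
  by apply: L2_sum => k; apply: Linfty_L2M; [exact: hM|exact: hF].
by apply/funext => z; rewrite mxE.
Qed.

Lemma L2_mulmxr m n p (M : C -> 'M[C]_(m, n)) (F : C -> 'M[C]_(n, p)) :
  entrywise (@L2 R) M -> entrywise (@Linfty R) F -> entrywise (@L2 R) (fun z => M z *m F z).
Proof.
move=> hM hF i j; rewrite (_ : (fun z => _) = fun z => \sum_k F z k j * M z i k).
  by apply: L2_sum => k; apply: Linfty_L2M; [exact: hF|exact: hM].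
by apply/funext => z; rewrite mxE; apply: eq_bigr => k _; rewrite mulrC.
Qed.

Lemma H2_mulmx m n p (M : C -> 'M[C]_(m, n)) (F : C -> 'M[C]_(n, p)) :
  entrywise (@Hinfty R) M -> entrywise (@H2 R) F -> entrywise (@H2 R) (fun z => M z *m F z).
Proof.
move=> hM hF i j; rewrite (_ : (fun z => _) = fun z => \sum_k M z i k * F z k j).
  by apply: H2_sum => k; apply: Hinfty_H2M; [exact: hM|exact: hF].
by apply/funext => z; rewrite mxE.
Qed.

Lemma H2_mulmxr m n p (M : C -> 'M[C]_(m, n)) (F : C -> 'M[C]_(n, p)) :
  entrywise (@H2 R) M -> entrywise (@Hinfty R) F -> entrywise (@H2 R) (fun z => M z *m F z).
Proof.
move=> hM hF i j; rewrite (_ : (fun z => _) = fun z => \sum_k F z k j * M z i k).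
  by apply: H2_sum => k; apply: Hinfty_H2M; [exact: hF|exact: hM].
by apply/funext => z; rewrite mxE; apply: eq_bigr => k _; rewrite mulrC.
Qed.

Lemma entD (S : (C -> C) -> Prop) m n (F G : C -> 'M[C]_(m, n)) :
  (forall f g, S f -> S g -> S (fun z => f z + g z)) ->
  entrywise S F -> entrywise S G -> entrywise S (fun z => F z + G z).
Proof.
move=> hS hF hG i j; have := hS _ _ (hF i j) (hG i j).
by congr S; apply/funext => z; rewrite mxE.
Qed.

Lemma entZ (S : (C -> C) -> Prop) m n (k : C -> C) (F : C -> 'M[C]_(m, n)) :
  (forall f, S f -> S (fun z => k z * f z)) ->
  entrywise S F -> entrywise S (fun z => k z *: F z).
Proof.
move=> hS hF i j; have := hS _ (hF i j).
by congr S; apply/funext => z; rewrite mxE.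
Qed.

Lemma entB (S : (C -> C) -> Prop) m n (F G : C -> 'M[C]_(m, n)) :
  (forall f g, S f -> S g -> S (fun z => f z - g z)) ->
  entrywise S F -> entrywise S G -> entrywise S (fun z => F z - G z).
Proof.
move=> hS hF hG i j; have := hS _ _ (hF i j) (hG i j).
by congr S; apply/funext => z; rewrite !mxE.
Qed.

Lemma ent_adj (S : (C -> C) -> Prop) m n (F : C -> 'M[C]_(m, n)) :
  (forall f, S f -> S (fun z => (f z)^*)) -> entrywise S F -> entrywise S (adjf F).
Proof.
move=> hS hF i j; have := hS _ (hF j i).
by congr S; apply/funext => z; rewrite /adjf /ctmx !mxE.
Qed.

Definition mxnorm2 m n (F : C -> 'M[C]_(m, n)) : R := \sum_i \sum_j norm2 (ent F i j).

Lemma mxnorm2_ge0 m n (F : C -> 'M[C]_(m, n)) : 0 <= mxnorm2 F.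
Proof. by apply: sumr_ge0 => i _; apply: sumr_ge0 => j _; exact: norm2_ge0. Qed.

Lemma norm2_le_mxnorm2 m n (F : C -> 'M[C]_(m, n)) i j : norm2 (ent F i j) <= mxnorm2 F.
Proof.
rewrite /mxnorm2 (bigD1 i) //= (bigD1 j) //= -addrA lerDl addr_ge0 //.
  by apply: sumr_ge0 => k _; exact: norm2_ge0.
by apply: sumr_ge0 => k _; apply: sumr_ge0 => l _; exact: norm2_ge0.
Qed.

Lemma inner_L2E m n (F G : C -> 'M[C]_(m, n)) :
  entrywise (@L2 R) F -> entrywise (@L2 R) G ->
  inner_L2 F G = \sum_i \sum_j ip (ent F i j) (ent G i j).
Proof.
move=> hF hG; rewrite /inner_L2.
have hp i j : cint (fun z => ent F i j z * (ent G i j z)^*).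
  exact: L2_prod (hF i j) (L2C (hG i j)).
rewrite -[RHS](eq_bigr _ (fun i _ => @ci_sum R _ _ _ (hp i))).
rewrite -(@ci_sum R _ _ (fun i z => \sum_j ent F i j z * (ent G i j z)^*)); last first.
  by move=> i; exact: cint_sum (hp i).
congr circle_int; apply/funext => z; apply: eq_bigr => i _; rewrite mxE.
by apply: eq_bigr => j _; rewrite !mxE.
Qed.

Lemma inner_mxnorm2 m n (F : C -> 'M[C]_(m, n)) : entrywise (@L2 R) F ->
  inner_L2 F F = (mxnorm2 F)%:C%C.
Proof.
move=> hF; rewrite inner_L2E // /mxnorm2 rmorph_sum; apply: eq_bigr => i _.
by rewrite rmorph_sum; apply: eq_bigr => j _; rewrite ipff.
Qed.

(** The factor comes from iterating [norm2D_le]. It is crude, but only a bound independent of the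
    functions matters: it serves the continuity of multiplication by a bounded matrix function. *)
Lemma norm2_sum_le (I : Type) (s : seq I) (F : I -> C -> C) : (forall i, L2 (F i)) ->
  norm2 (fun z => \sum_(i <- s) F i z) <= 2 ^+ size s * \sum_(i <- s) norm2 (F i).
Proof.
move=> hF; elim: s => [|a s IH].
  rewrite big_nil mulr0 (_ : norm2 _ = norm2 (fun z => 0 * z ^ 0)).
    by rewrite norm2_zXZ normr0 /= expr0n.
  by congr norm2; apply/funext => z; rewrite big_nil mul0r.
rewrite (_ : norm2 _ = norm2 (fun z => F a z + \sum_(i <- s) F i z)); last first.
  by congr norm2; apply/funext => z; rewrite big_cons.
apply: le_trans (norm2D_le (hF a) (L2_sum s hF)) _.
rewrite big_cons /= exprS -mulrA ler_pM2l // mulrDr lerD //.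
by rewrite ler_peMl ?norm2_ge0 // exprn_ege1 // ler1n.
Qed.

Lemma mxnorm2_mulmx m n p (M : C -> 'M[C]_(m, n)) : entrywise (@Linfty R) M ->
  exists2 K, 0 <= K & forall F : C -> 'M[C]_(n, p), entrywise (@L2 R) F ->
    mxnorm2 (fun z => M z *m F z) <= K * mxnorm2 F.
Proof.
move=> hM.
have hB i : exists B : 'I_n -> R, forall k, ae_circle (fun z => complex.Re `|M z i k| <= B k).
  have h k : exists b, ae_circle (fun z => complex.Re `|M z i k| <= b).
    by case: (hM i k) => _.
  by have [B hB] := choice h; exists B.
have {hB}[B hB] := choice hB.
pose c i : R := 2 ^+ size (index_enum 'I_n) * \sum_k B i k ^+ 2.
have c0 i : 0 <= c i.
  by rewrite mulr_ge0 ?exprn_ge0 // sumr_ge0 // => k _; exact: sqr_ge0.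
exists (\sum_i (\sum_(j < p) c i)).
  by apply: sumr_ge0 => i _; apply: sumr_ge0 => j _.
move=> F hF; rewrite mulr_suml; apply: ler_sum => i _.
rewrite mulr_suml; apply: ler_sum => j _.
have -> : ent (fun z => M z *m F z) i j = (fun z => \sum_k M z i k * F z k j).
  by apply/funext => z; rewrite /ent mxE.
have lk k : L2 (fun z => M z i k * F z k j) by apply: Linfty_L2M; [exact: hM|exact: hF].
apply: le_trans (norm2_sum_le _ lk) _.
rewrite /c -mulrA; apply: ler_wpM2l; first exact: exprn_ge0.
rewrite mulr_suml; apply: ler_sum => k _.
apply: (@le_trans _ _ (B i k ^+ 2 * norm2 (ent F k j))).
  by apply: norm2M_le; [exact: Linfty_cm (hM i k)|exact: hB|exact: hF].
by apply: ler_wpM2l; [exact: sqr_ge0|exact: norm2_le_mxnorm2].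
Qed.

Lemma mxnorm2D_le m n (F G : C -> 'M[C]_(m, n)) : entrywise (@L2 R) F -> entrywise (@L2 R) G ->
  mxnorm2 (fun z => F z + G z) <= 2 * (mxnorm2 F + mxnorm2 G).
Proof.
move=> hF hG; rewrite /mxnorm2 -big_split mulr_sumr; apply: ler_sum => i _.
rewrite -big_split mulr_sumr; apply: ler_sum => j _.
rewrite (_ : ent _ i j = fun z => ent F i j z + ent G i j z).
  exact: norm2D_le (hF i j) (hG i j).
by apply/funext => z; rewrite /ent mxE.
Qed.

Definition perp f := L2 f /\ forall k : nat, fourier f k%:Z = 0.

(** The hypotheses say that x is the component of y orthogonal to H^2; the inequality is Pythagoras
    for y = x + (y - x). *)
Lemma perp_H2_norm2 (x y : C -> C) : perp x -> L2 y -> H2 (fun z => y z - x z) -> norm2 x <= norm2 y.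
Proof.
move=> [lx hx] ly hyx.
rewrite (_ : y = fun z => x z + (y z - x z)); last first.
  by apply/funext => z; rewrite addrC subrK.
rewrite norm2D_orth //; [by rewrite lerDl norm2_ge0|exact: H2_L2|exact: H2_orth].
Qed.

Lemma perp_H2_mxnorm2 m n (x y : C -> 'M[C]_(m, n)) :
  entrywise perp x -> entrywise (@L2 R) y ->
  entrywise (@H2 R) (fun z => y z - x z) -> mxnorm2 x <= mxnorm2 y.
Proof.
move=> hx hy hyx; apply: ler_sum => i _; apply: ler_sum => j _.
apply: perp_H2_norm2; [exact: hx|exact: hy|].
by have := hyx i j; congr H2; apply/funext => z; rewrite !mxE.
Qed.

Lemma perpD f g : perp f -> perp g -> perp (fun z => f z + g z).
Proof.
move=> [a b] [c d]; split; first exact: L2D.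
by move=> k; rewrite fourierD // b d addr0.
Qed.

(** Entrywise, [riesz_fischer] shows that the set from which [projH2] chooses is not empty.
    Orthogonality to H^2 is then turned into the vanishing of Fourier coefficients, the form used
    everywhere below. *)
Lemma projH2P m n (F : C -> 'M[C]_(m, n)) : entrywise (@L2 R) F ->
  entrywise (@H2 R) (projH2 F) /\ entrywise perp (projH2perp F).
Proof.
move=> hF.
have hG i j : exists G, H2 G /\ forall k : nat, fourier G k%:Z = fourier (ent F i j) k%:Z.
  by have [G [_ _ a b]] := riesz_fischer (hF i j); exists G.
pose G i j := projT1 (cid (hG i j)).
have hG' i j : H2 (G i j) /\ forall k : nat, fourier (G i j) k%:Z = fourier (ent F i j) k%:Z.
  exact: projT2 (cid (hG i j)).
pose GG : C -> 'M[C]_(m, n) := fun z => \matrix_(i, j) G i j z.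
have GGE i j : (fun z => GG z i j) = G i j by apply/funext => z; rewrite mxE.
have hGG : entrywise (@H2 R) GG by move=> i j; rewrite GGE; case: (hG' i j).
have lGG : entrywise (@L2 R) GG by move=> i j; exact: H2_L2 (hGG i j).
set P := [set G : C -> 'M[C]_(m, n) | entrywise (@H2 R) G /\
    forall K, entrywise (@H2 R) K -> inner_L2 (fun z => F z - G z) K = 0].
have PG : P GG.
  split => // K hK; rewrite inner_L2E.
  - apply: big1 => i _; apply: big1 => j _.
    apply: H2_orth; last exact: hK.
      by have := entB (@L2B R) hF lGG i j.
    move=> k; rewrite (_ : ent _ i j = fun z => ent F i j z - G i j z).
      have [h e] := hG' i j.
      rewrite fourierB; [|exact: hF|exact: H2_L2].
      by rewrite e subrr.
    by apply/funext => z; rewrite /ent !mxE.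
  - exact: entB (@L2B R) hF lGG.
  - by move=> i j; exact: H2_L2 (hK i j).
have [h1 h2] : P (projH2 F) by apply: xgetPex; exists GG.
have l1 : entrywise (@L2 R) (projH2 F) by move=> i j; exact: H2_L2 (h1 i j).
have l2 : entrywise (@L2 R) (projH2perp F) by exact: entB (@L2B R) hF l1.
split => // i j; split; first exact: l2.
(* The test function is z^k in the entry (i, j) and 0 elsewhere, so that pairing with it reads off
   one coefficient of one entry. *)
move=> k; pose K : C -> 'M[C]_(m, n) :=
  fun z => \matrix_(a, c) (((a == i) && (c == j))%:R * z ^ k%:Z).
have hK : entrywise (@H2 R) K.
  move=> a c; rewrite (_ : (fun z => _) = fun z => ((a == i) && (c == j))%:R * z ^ k%:Z).
    by apply: H2Z; exact: H2_zX.
  by apply/funext => z; rewrite mxE.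
have lK : entrywise (@L2 R) K by move=> a c; exact: H2_L2 (hK a c).
have := h2 K hK; rewrite inner_L2E //.
have KE a c : ip (ent (fun z => F z - projH2 F z) a c) (ent K a c) =
    ((a == i) && (c == j))%:R * fourier (ent (projH2perp F) a c) k%:Z.
  rewrite (_ : ent K a c = fun z => ((a == i) && (c == j))%:R * z ^ k%:Z).
    rewrite ipZr; [|exact: L2_zX|exact: (l2 a c)].
    rewrite rmorph_nat; congr (_ * _); rewrite fourier_ip //; exact: (l2 a c).
  by apply/funext => z; rewrite /ent mxE.
rewrite (bigD1 i) //= (bigD1 j) //= KE !eqxx mul1r.
rewrite big1 => [|c cj]; last by rewrite KE (negbTE cj) andbF mul0r.
rewrite big1 => [|a ai]; first by rewrite !addr0.
by apply: big1 => c _; rewrite KE (negbTE ai) mul0r.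
Qed.

Lemma projH2perp_sub m n (F : C -> 'M[C]_(m, n)) z :
  F z - projH2perp F z = projH2 F z.
Proof. by rewrite /projH2perp opprB addrC subrK. Qed.

Lemma perp_conj_H2 f : perp f -> H2 (fun z => (f z)^*).
Proof.
move=> [lf hf]; split; first exact: L2C.
move=> [//|k] _; rewrite fourier_conj // NegzE opprK.
by rewrite hf conjC0.
Qed.

End MatrixSpaces.

(** * Hankel operators on vector-valued functions *)

Section Hankel.
Variable R : realType.
Local Notation C := R[i].
Variable n : nat.
Implicit Types (Phi Psi : C -> 'M[C]_n) (f g x y : C -> 'cV[C]_n).

Lemma L2_flipJ x : entrywise (@L2 R) x -> entrywise (@L2 R) (flipJ x).
Proof.
move=> hx i j; have := Linfty_L2M (LinftyC (Linfty_id R)) (L2_flip (hx i j)).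
by congr L2; apply/funext => z; rewrite mxE.
Qed.

Lemma inner_flipJ x y : entrywise (@L2 R) x -> entrywise (@L2 R) y ->
  inner_L2 (flipJ x) (flipJ y) = inner_L2 x y.
Proof.
move=> hx hy; have hx' := L2_flipJ hx; have hy' := L2_flipJ hy.
rewrite !inner_L2E //; apply: eq_bigr => i _; apply: eq_bigr => j _.
have hc := L2_prod (hx i j) (L2C (hy i j)).
rewrite /ip -(ci_flip hc); apply: ci_ae.
- exact: cint_cm (L2_prod (hx' i j) (L2C (hy' i j))).
- exact: cint_cm (cint_flip hc).
apply: ae_all => z z1; rewrite /ent /flipJ !mxE rmorphM /= mulrACA.
by rewrite [z^* * _]mulrC conjCK -normCK z1 expr1n mul1r.
Qed.

Lemma mxnorm2_flipJ x : entrywise (@L2 R) x -> mxnorm2 (flipJ x) = mxnorm2 x.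
Proof.
move=> hx; have := inner_flipJ hx hx.
by rewrite !inner_mxnorm2 //; [move=> [] |exact: L2_flipJ].
Qed.

Lemma mxnorm2_eq0 m (F : C -> 'M[C]_(m, 1)) : entrywise (@L2 R) F ->
  ae_circle (fun z => F z = 0) <-> mxnorm2 F = 0.
Proof.
move=> hF; split=> h.
  apply: big1 => i _; apply: big1 => j _.
  rewrite (_ : norm2 _ = norm2 (fun z => 0 * z ^ 0)).
    by rewrite norm2_zXZ normr0 /= expr0n.
  apply: norm2_ae; first exact: L2_cm (hF i j).
    exact: L2_cm (L2Z _ (L2_zX R 0)).
  by apply: ae_imp h => z _ h; rewrite /ent h mxE mul0r.
have : ae_circle (fun z => forall i, ent F i ord0 z = 0).
  apply: ae_fin => i; apply: norm2_eq0; first exact: hF.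
  by apply/eqP; rewrite eq_le norm2_ge0 andbT -h norm2_le_mxnorm2.
by apply: ae_imp => z _ H; apply/matrixP => i j; rewrite mxE ord1; exact: H.
Qed.

(** J preserves norms, so the image of f vanishes exactly when the component of Phi f orthogonal to
    H^2 does. Kernels are handled in this form from here on, free of chosen representatives. *)
Lemma ker_hankelP Phi f : entrywise (@Linfty R) Phi -> entrywise (@H2 R) f ->
  ker_hankel Phi f <-> entrywise (@H2 R) (fun z => Phi z *m f z).
Proof.
move=> hP hf; have lf : entrywise (@L2 R) f by move=> i j; exact: H2_L2 (hf i j).
have lPf := L2_mulmx hP lf; have [h1 h2] := projH2P lPf.
set x := projH2perp _ in h2; have lx : entrywise (@L2 R) x by move=> i j; case: (h2 i j).
have lJ := L2_flipJ lx.
have E : ae_circle (fun z => hankel Phi f z = 0) <-> ae_circle (fun z => x z = 0).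
  by rewrite (mxnorm2_eq0 lJ) (mxnorm2_eq0 lx) mxnorm2_flipJ.
split.
  move=> [_ /E h] i j; apply: (H2_ae (h1 i j)); first exact: L2_cm (lPf i j).
  apply: ae_imp h => z _ h.
  by rewrite -projH2perp_sub -/x h subr0.
move=> h; split => //; apply/E; apply/(mxnorm2_eq0 lx)/eqP; rewrite eq_le mxnorm2_ge0 andbT.
rewrite [X in _ <= X](_ : 0 = mxnorm2 (fun z => 0 : 'cV[C]_n)); last first.
  apply/esym/(mxnorm2_eq0 _); last exact: ae_all.
  by move=> i j; have := L2_cst (0 : C); congr L2; apply/funext => z; rewrite mxE.
apply: perp_H2_mxnorm2 => //.
  by move=> i j; have := L2_cst (0 : C); congr L2; apply/funext => z; rewrite mxE.
move=> i j; have := H2B (h1 i j) (h i j); congr H2; apply/funext => z.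
by rewrite /x /projH2perp !mxE; ring.
Qed.

Definition vpsum f N : C -> 'cV[C]_n := fun z => \col_i psum (ent f i ord0) N z.

Lemma vpsum_ent f N i j : (fun z => vpsum f N z i j) = psum (ent f i ord0) N.
Proof. by apply/funext => z; rewrite mxE. Qed.

Lemma vpsum_Hinfty f N : entrywise (@Hinfty R) (vpsum f N).
Proof.
move=> i j; rewrite vpsum_ent; split; first exact: psum_Linfty.
exact: psum_H2.
Qed.

Lemma mxnorm2_vpsum f : entrywise (@H2 R) f -> forall e : R, 0 < e ->
  exists N, forall k, (N <= k)%N -> mxnorm2 (fun z => f z - vpsum f k z) <= e.
Proof.
move=> hf e e0.
have e1 : 0 < e / n.+1%:R by rewrite divr_gt0.
have hN i := H2_psum (hf i ord0) e1.
pose N i := projT1 (cid (hN i)).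
have hN' i k : (N i <= k)%N -> norm2 (fun z => f z i ord0 - psum (ent f i ord0) k z) <= e / n.+1%:R.
  exact: (projT2 (cid (hN i)) k).
exists (\sum_i N i)%N => k hk; rewrite /mxnorm2.
apply: (@le_trans _ _ (\sum_(i < n) e / n.+1%:R)).
  apply: ler_sum => i _; rewrite big_ord1.
  have -> : ent (fun z => f z - vpsum f k z) i ord0 =
      (fun z => f z i ord0 - psum (ent f i ord0) k z).
    by apply/funext => z; rewrite /ent !mxE.
  by apply: hN'; apply: leq_trans hk; rewrite (bigD1 i) //= leq_addr.
rewrite sumr_const card_ord -[X in X <= _]mulr_natr mulrAC -mulrA; apply: ler_piMr; first exact: ltW.
by rewrite ler_pdivrMr // mul1r ler_nat.
Qed.

Lemma inner_L2D_expand (a c : C -> 'cV[C]_n) : entrywise (@L2 R) a -> entrywise (@L2 R) c ->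
  inner_L2 (fun z => a z + c z) (fun z => a z + c z) =
  inner_L2 a a + inner_L2 c a + inner_L2 a c + inner_L2 c c.
Proof.
move=> ha hc; have hs := entD (@L2D R) ha hc.
rewrite !inner_L2E // -!big_split; apply: eq_bigr => i _.
rewrite -!big_split; apply: eq_bigr => j _.
rewrite (_ : ent (fun z => a z + c z) i j = fun z => ent a i j z + ent c i j z); last first.
  by apply/funext => z; rewrite /ent mxE.
have la := ha i j; have lc := hc i j.
rewrite ipDl ?ipDr //; last exact: L2D.
by rewrite /=; ring.
Qed.

Lemma complex_quad (P X Y s : R) (p q : C) :
  P%:C%C = s%:C%C * (s%:C%C * X%:C%C) + s%:C%C * q + s%:C%C * p + Y%:C%C ->
  P = s * (s * X) + s * complex.Re q + s * complex.Re p + Y.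
Proof.
case: p q => [p1 p2] [q1 q2] /(congr1 (@complex.Re R)) /= ->.
by rewrite !(mul0r, mulr0, subr0, addr0).
Qed.

Lemma quad_arith (X Y s p q : R) : 0 < s ->
  0 <= s * (s * X) + s * q + s * p + Y -> - (p + q) <= s * X + s^-1 * Y.
Proof.
move=> s0 h; rewrite -(ler_pM2l s0) mulrDr (mulrA s s^-1) divff ?gt_eqF // mul1r.
by lra.
Qed.

(** Expand |s x + y|^2 >= 0 and divide by s. The free weight lets a small x compensate a y that is
    merely bounded, which is the situation of the cross terms of the quadratic form. *)
Lemma re_inner_le (x y : C -> 'cV[C]_n) (s : R) : entrywise (@L2 R) x -> entrywise (@L2 R) y ->
  0 < s -> - (complex.Re (inner_L2 x y + inner_L2 y x)) <= s * mxnorm2 x + s^-1 * mxnorm2 y.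
Proof.
move=> hx hy s0.
have lsx : entrywise (@L2 R) (fun z => (s%:C)%C *: x z) by exact: (@entZ _ _ _ _ (fun=> (s%:C)%C) x (@L2Z R _) hx).
have : 0 <= mxnorm2 (fun z => (s%:C)%C *: x z + y z) by exact: mxnorm2_ge0.
have E := inner_L2D_expand lsx hy.
have rs : ((s%:C)%C : C)^* = (s%:C)%C by rewrite conjE /= oppr0.
have e1 (w : C -> 'cV[C]_n) : entrywise (@L2 R) w ->
    inner_L2 (fun z => (s%:C)%C *: x z) w = (s%:C)%C * inner_L2 x w.
  move=> hw; rewrite !inner_L2E // mulr_sumr; apply: eq_bigr => i _.
  rewrite mulr_sumr; apply: eq_bigr => j _; rewrite -ipZl; [|exact: hx|exact: hw].
  by apply: eq_ipl => z; rewrite /ent mxE.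
have e2 (w : C -> 'cV[C]_n) : entrywise (@L2 R) w ->
    inner_L2 w (fun z => (s%:C)%C *: x z) = (s%:C)%C * inner_L2 w x.
  move=> hw; rewrite !inner_L2E // mulr_sumr; apply: eq_bigr => i _.
  rewrite mulr_sumr; apply: eq_bigr => j _; rewrite -[X in X * _]rs -ipZr; [|exact: hx|exact: hw].
  by apply: eq_ipr => z; rewrite /ent mxE.
move: E; rewrite e1 // e2 // [inner_L2 y (fun _ => _)]e2 // e1 // !inner_mxnorm2 //; last first.
  exact: entD (@L2D R) lsx hy.
move/complex_quad => -> h; rewrite creD; exact: quad_arith h.
Qed.

End Hankel.

(** * Consequences of the positivity of the quadratic form *)

Section Hyponormal.
Variable R : realType.
Local Notation C := R[i].
Variable n : nat.
Implicit Types (Phi Psi : C -> 'M[C]_n) (f g x y : C -> 'cV[C]_n).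

Lemma ctmxK m p (A : 'M[C]_(m, p)) : ctmx (ctmx A) = A.
Proof. by apply/matrixP => i j; rewrite !mxE conjCK. Qed.

(** Modulo H^2, y equals functions of arbitrarily small norm, so its negative coefficients are
    arbitrarily small. *)
Lemma H2_approx y (K : R) : entrywise (@L2 R) y ->
  (forall e : R, 0 < e -> exists x, [/\ entrywise (@L2 R) x,
     entrywise (@H2 R) (fun z => y z - x z) & mxnorm2 x <= K * e]) ->
  entrywise (@H2 R) y.
Proof.
move=> ly h i j; split; first exact: ly.
move=> k k0; apply: (@small_zero _ _ K) => e e0.
have [x [lx hx nx]] := h e e0.
have -> : fourier (fun z => y z i j) k = fourier (ent x i j) k.
  have E : (fun z => (y z - x z) i j) = (fun z => y z i j - ent x i j z).
    by apply/funext => z; rewrite !mxE.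
  have := H2_neg (hx i j) k0; rewrite E fourierB; [|exact: ly|exact: lx].
  by move/eqP; rewrite subr_eq0 => /eqP.
apply: le_trans (fourier_le k (lx i j)) _.
by apply: le_trans nx; exact: norm2_le_mxnorm2.
Qed.

Lemma Hinfty_ent_H2 m p (F : C -> 'M[C]_(m, p)) : entrywise (@Hinfty R) F -> entrywise (@H2 R) F.
Proof. by move=> h i j; case: (h i j). Qed.

Lemma Hinfty_ent_Linfty m p (F : C -> 'M[C]_(m, p)) : entrywise (@Hinfty R) F -> entrywise (@Linfty R) F.
Proof. by move=> h i j; case: (h i j). Qed.

Lemma H2_ent_L2 m p (F : C -> 'M[C]_(m, p)) : entrywise (@H2 R) F -> entrywise (@L2 R) F.
Proof. by move=> h i j; exact: H2_L2 (h i j). Qed.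

Lemma Linfty_ent_L2 m p (F : C -> 'M[C]_(m, p)) : entrywise (@Linfty R) F -> entrywise (@L2 R) F.
Proof. by move=> h i j; exact: Linfty_L2 (h i j). Qed.

Lemma perp_ent_L2 m p (F : C -> 'M[C]_(m, p)) : entrywise (@perp R) F -> entrywise (@L2 R) F.
Proof. by move=> h i j; case: (h i j). Qed.

Lemma ent_eq (S : (C -> C) -> Prop) m p (F G : C -> 'M[C]_(m, p)) :
  entrywise S F -> F =1 G -> entrywise S G.
Proof. by move=> h /funext <-. Qed.

(** The Hankel operator before the flip J, which does not affect inner products; its values are
    orthogonal to H^2 and can be compared with Phi f modulo H^2. *)
Definition hankel_proj Phi f : C -> 'cV[C]_n := projH2perp (fun z => Phi z *m f z).

Lemma inner_hankel Phi Psi f g : entrywise (@perp R) (hankel_proj Phi f) ->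
  entrywise (@perp R) (hankel_proj Psi g) ->
  inner_L2 (hankel Phi f) (hankel Psi g) = inner_L2 (hankel_proj Phi f) (hankel_proj Psi g).
Proof.
move=> /perp_ent_L2 a /perp_ent_L2 b.
exact (@inner_flipJ R n (hankel_proj Phi f) (hankel_proj Psi g) a b).
Qed.

Section Symbols.
Variable Phi : C -> 'M[C]_n.
Hypothesis hPhi : entrywise (@Linfty R) Phi.
Let lPhi := Linfty_ent_L2 hPhi.
Let SA := adjf (plus_part Phi).
Let SB := adjf (minus_part Phi).

(** Phi^* differs from the adjoint of Phi_+ by the adjoint of the part of Phi orthogonal to H^2,
    which is analytic. Hence on bounded f the Hankel operator of that adjoint is the Hankel operator
    of Phi^*. *)
Lemma hankel_plus f : entrywise (@Hinfty R) f ->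
  [/\ hankel_dom SA f, entrywise (@perp R) (hankel_proj SA f) &
   entrywise (@H2 R) (fun z => adjf Phi z *m f z - hankel_proj SA f z)].
Proof.
move=> hf; have [p1 p2] := projH2P lPhi.
have lA : entrywise (@L2 R) SA by apply: ent_adj (H2_ent_L2 p1); exact: L2C.
have lAf := L2_mulmxr lA (Hinfty_ent_Linfty hf).
have [q1 q2] := projH2P lAf.
split => //; first by split => //; exact: Hinfty_ent_H2.
have h1 : entrywise (@H2 R) (fun z => adjf (projH2perp Phi) z *m f z).
  apply: H2_mulmxr hf; move=> i j.
  have := perp_conj_H2 (p2 j i); congr H2; apply/funext => z; by rewrite !mxE.
apply: ent_eq (entD (@H2D R) h1 q1) _ => z.
rewrite -[projH2 (fun z => SA z *m f z) z]projH2perp_sub addrA; congr (_ - _).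
rewrite -mulmxDl; congr (_ *m _); apply/matrixP => i j.
by rewrite /SA /plus_part /adjf /ctmx /projH2perp !mxE -rmorphD subrK.
Qed.

(** The adjoint of Phi_- is the part of Phi orthogonal to H^2, and the rest of Phi is analytic; so
    this is the Hankel operator of Phi. *)
Lemma hankel_minus f : entrywise (@Hinfty R) f ->
  [/\ hankel_dom SB f, entrywise (@perp R) (hankel_proj SB f) &
   entrywise (@H2 R) (fun z => Phi z *m f z - hankel_proj SB f z)].
Proof.
move=> hf; have [p1 p2] := projH2P lPhi.
have SBE : SB = projH2perp Phi.
  by apply/funext => z; rewrite /SB /minus_part /adjf ctmxK.
have lB : entrywise (@L2 R) SB by rewrite SBE; exact: perp_ent_L2.
have lBf := L2_mulmxr lB (Hinfty_ent_Linfty hf).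
have [q1 q2] := projH2P lBf.
split => //; first by split => //; exact: Hinfty_ent_H2.
have h1 : entrywise (@H2 R) (fun z => projH2 Phi z *m f z) by exact: H2_mulmxr hf.
apply: ent_eq (entD (@H2D R) h1 q1) _ => z.
rewrite -[projH2 (fun z => SB z *m f z) z]projH2perp_sub addrA; congr (_ - _).
by rewrite -mulmxDl SBE /projH2perp addrC subrK.
Qed.

End Symbols.

Lemma re_sub3 (ra rb rd : R) (w : C) :
  complex.Re (ra%:C%C - rb%:C%C - rd%:C%C - w) = ra - rb - rd - complex.Re w.
Proof. by case: w. Qed.

Lemma re_arith0 (rb rd ra p : R) : 0 <= ra - rb - rd - p -> rb + rd <= ra - p.
Proof. by move=> h; lra. Qed.

Lemma re_arith (aa bb ca bgdf ac dfbg cc dd aa' bb' ca' bgdf' ac' dfbg' cc' dd' : C) (rb rd ra : R) :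
  0 <= (aa - bb) + (ca - bgdf) + (ac - dfbg) + (cc - dd) ->
  aa = aa' -> bb = bb' -> ca = ca' -> bgdf = bgdf' -> ac = ac' -> dfbg = dfbg' ->
  cc = cc' -> dd = dd' ->
  bb' = rb%:C%C -> dd' = rd%:C%C -> ra%:C%C = aa' + ca' + ac' + cc' ->
  rb + rd <= ra - complex.Re (bgdf' + dfbg').
Proof.
move=> + e1 e2 e3 e4 e5 e6 e7 e8; rewrite e1 e2 e3 e4 e5 e6 e7 e8 => h eb ed ea.
have : 0 <= ra%:C%C - bb' - dd' - (bgdf' + dfbg').
  by rewrite ea (_ : _ - _ = (aa' - bb') + (ca' - bgdf') + (ac' - dfbg') + (cc' - dd')) //; ring.
rewrite eb ed lecE => /andP[_]; rewrite re_sub3; exact: re_arith0.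
Qed.

Lemma addrBDB (V : zmodType) (a b c d : V) : (a - b) + (c - d) = a + c - (b + d).
Proof. by rewrite opprD addrACA. Qed.

(** Regrouped, the quadratic form is |A f + C g|^2 - |B f|^2 - |D g|^2 - 2 Re <B g, D f>. The five
    functions stand for A f + C g, B f, B g, D f and D g before the flip; each is pinned down as the
    component orthogonal to H^2 of a product with a bounded symbol. Bounded f and g lie in the
    common domain. *)
Lemma pseudo_hyponormal_ineq Phi Psi f g : entrywise (@Linfty R) Phi -> entrywise (@Linfty R) Psi ->
  pseudo_hyponormal Phi Psi -> entrywise (@Hinfty R) f -> entrywise (@Hinfty R) g ->
  exists ac bf bg df dg : C -> 'cV[C]_n,
  [/\ [/\ entrywise (@perp R) ac, entrywise (@perp R) bf, entrywise (@perp R) bg,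
      entrywise (@perp R) df & entrywise (@perp R) dg],
    entrywise (@H2 R) (fun z => adjf Phi z *m f z + adjf Psi z *m g z - ac z),
    entrywise (@H2 R) (fun z => Phi z *m f z - bf z) /\ entrywise (@H2 R) (fun z => Psi z *m g z - dg z),
    entrywise (@H2 R) (fun z => Phi z *m g z - bg z) /\ entrywise (@H2 R) (fun z => Psi z *m f z - df z) &
    mxnorm2 bf + mxnorm2 dg <= mxnorm2 ac - complex.Re (inner_L2 bg df + inner_L2 df bg)].
Proof.
move=> hP hQ hT hf hg.
have [A1 A2 A3] := hankel_plus hP hf.
have [A1g _ _] := hankel_plus hP hg.
have [B1 B2 B3] := hankel_minus hP hf.
have [B1g B2g B3g] := hankel_minus hP hg.
have [C1 C2 C3] := hankel_plus hQ hg.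
have [C1f _ _] := hankel_plus hQ hf.
have [D1 D2 D3] := hankel_minus hQ hg.
have [D1f D2f D3f] := hankel_minus hQ hf.
have := hT f g (And4 A1 B1 C1f D1f) (And4 A1g B1g C1 D1).
move=> H; have la := perp_ent_L2 A2; have lc := perp_ent_L2 C2.
have lbf := perp_ent_L2 B2; have ldg := perp_ent_L2 D2.
exists (fun z => hankel_proj (adjf (plus_part Phi)) f z + hankel_proj (adjf (plus_part Psi)) g z),
  (hankel_proj (adjf (minus_part Phi)) f), (hankel_proj (adjf (minus_part Phi)) g),
  (hankel_proj (adjf (minus_part Psi)) f), (hankel_proj (adjf (minus_part Psi)) g).
split.
- exact (And5 (entD (@perpD R) A2 C2) B2 B2g D2f D2).
- apply: ent_eq (entD (@H2D R) A3 C3) _ => z; exact (addrBDB _ _ _ _).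
- exact (conj B3 D3).
- exact (conj B3g D3f).
have E : (mxnorm2 (fun z => hankel_proj (adjf (plus_part Phi)) f z + hankel_proj (adjf (plus_part Psi)) g z))%:C%C =
   inner_L2 (hankel_proj (adjf (plus_part Phi)) f) (hankel_proj (adjf (plus_part Phi)) f)
   + inner_L2 (hankel_proj (adjf (plus_part Psi)) g) (hankel_proj (adjf (plus_part Phi)) f)
   + inner_L2 (hankel_proj (adjf (plus_part Phi)) f) (hankel_proj (adjf (plus_part Psi)) g)
   + inner_L2 (hankel_proj (adjf (plus_part Psi)) g) (hankel_proj (adjf (plus_part Psi)) g).
  by rewrite -(inner_mxnorm2 (entD (@L2D R) la lc)); exact (inner_L2D_expand la lc).
exact (re_arith H (inner_hankel A2 A2) (inner_hankel B2 B2) (inner_hankel C2 A2)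
  (inner_hankel B2g D2f) (inner_hankel A2 C2) (inner_hankel D2f B2g) (inner_hankel C2 C2)
  (inner_hankel D2 D2) (inner_mxnorm2 lbf) (inner_mxnorm2 ldg) E).
Qed.

Lemma mxnorm2_sym m p (F G : C -> 'M[C]_(m, p)) : mxnorm2 (fun z => F z - G z) = mxnorm2 (fun z => G z - F z).
Proof.
apply: eq_bigr => i _; apply: eq_bigr => j _.
rewrite (_ : ent _ i j = fun z => F z i j - G z i j); last by apply/funext => z; rewrite /ent !mxE.
by rewrite norm2_sym; congr norm2; apply/funext => z; rewrite /ent !mxE.
Qed.

(** The weight s, of order M / e, is chosen first to make M / s at most e / 2; then d is small
    enough for (4 + s) K d <= e / 2. The added 1s keep s and the denominators positive when M or K
    is 0. *)
Lemma eps_choice (K M e : R) : 0 <= K -> 0 <= M -> 0 < e ->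
  exists s d : R, [/\ 0 < s, 0 < d, d <= 1, d <= e &
     4 * (K * d) + (s * (K * d) + s^-1 * M) <= e].
Proof.
move=> K0 M0 e0; pose s := 2 * (M + 1) / e.
have s0 : 0 < s by rewrite divr_gt0 // mulr_gt0 // ltr_wpDl.
have q0 : 0 < 2 * ((4 + s) * K + 1).
  by rewrite mulr_gt0 // ltr_wpDl // mulr_ge0 // addr_ge0 // ltW.
pose d := Num.min (Num.min 1 e) (e / (2 * ((4 + s) * K + 1))).
have d0 : 0 < d by rewrite !lt_min ltr01 e0 divr_gt0.
exists s, d; split => //; first by rewrite /d !ge_min lexx.
  by rewrite /d !ge_min lexx orbT.
have h1 : s^-1 * M <= e / 2.
  rewrite /s invf_div mulrAC ler_pdivrMr; last by rewrite mulr_gt0 // ltr_wpDl.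
  rewrite (_ : e / 2 * (2 * (M + 1)) = e * (M + 1)); last by field.
  by apply: ler_wpM2l; [exact: ltW|rewrite lerDl].
have : d <= e / (2 * ((4 + s) * K + 1)) by rewrite /d !ge_min lexx !orbT.
rewrite ler_pdivlMr // => h2.
have : 4 * (K * d) + s * (K * d) <= e / 2.
  by rewrite -(ler_pM2l (_ : 0 < 2)) //; have := ltW d0; lra.
by move=> h3; lra.
Qed.

Lemma double_le (x y k : R) : x <= k -> y <= k -> 2 * (x + y) <= 4 * k.
Proof. by move=> h1 h2; lra. Qed.

Lemma mxnorm2_approx Phi f f' (K d : R) : 0 <= K ->
  (forall F : C -> 'cV[C]_n, entrywise (@L2 R) F -> mxnorm2 (fun z => Phi z *m F z) <= K * mxnorm2 F) ->
  entrywise (@L2 R) f -> entrywise (@L2 R) f' ->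
  mxnorm2 (fun z => f z - f' z) <= d ->
  mxnorm2 (fun z => Phi z *m f z - Phi z *m f' z) <= K * d.
Proof.
move=> K0 hK lf lf' hd.
rewrite (_ : (fun z => Phi z *m f z - _) = fun z => Phi z *m (f z - f' z)); last first.
  by apply/funext => z; rewrite mulmxBr.
apply: le_trans (hK _ (entB (@L2B R) lf lf')) _; exact: ler_wpM2l.
Qed.

(** Partial sums f', g' within d of f, g are bounded, so the inequality holds for them. There |A f'
    + C g'|^2 is at most 4 K d, and in the cross term one factor has squared norm at most K d by the
    alternative assumed, while the other is at most M. So B f' and D g' tend to 0 as d does, and
    [H2_approx] passes to f and g. *)
Theorem pseudo_hyponormal_step Phi Psi f g : entrywise (@Linfty R) Phi -> entrywise (@Linfty R) Psi ->
  pseudo_hyponormal Phi Psi -> entrywise (@H2 R) f -> entrywise (@H2 R) g ->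
  entrywise (@H2 R) (fun z => adjf Phi z *m f z + adjf Psi z *m g z) ->
  entrywise (@H2 R) (fun z => Phi z *m g z) \/ entrywise (@H2 R) (fun z => Psi z *m f z) ->
  entrywise (@H2 R) (fun z => Phi z *m f z) /\ entrywise (@H2 R) (fun z => Psi z *m g z).
Proof.
move=> hP hQ hT hf hg hfg hor.
have lf := H2_ent_L2 hf; have lg := H2_ent_L2 hg.
have hPa : entrywise (@Linfty R) (adjf Phi) by apply: ent_adj hP; exact: LinftyC.
have hQa : entrywise (@Linfty R) (adjf Psi) by apply: ent_adj hQ; exact: LinftyC.
have [K1 K10 hK1] := mxnorm2_mulmx 1 hP; have [K2 K20 hK2] := mxnorm2_mulmx 1 hQ.
have [K3 K30 hK3] := mxnorm2_mulmx 1 hPa; have [K4 K40 hK4] := mxnorm2_mulmx 1 hQa.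
pose K := K1 + K2 + K3 + K4; have K0 : 0 <= K by rewrite !addr_ge0.
have hK (M : C -> 'M[C]_n) Ki : Ki <= K ->
    (forall F : C -> 'cV[C]_n, entrywise (@L2 R) F -> mxnorm2 (fun z => M z *m F z) <= Ki * mxnorm2 F) ->
    (forall F : C -> 'cV[C]_n, entrywise (@L2 R) F -> mxnorm2 (fun z => M z *m F z) <= K * mxnorm2 F).
  move=> le h F lF; apply: le_trans (h F lF) _; apply: ler_wpM2r => //; exact: mxnorm2_ge0.
have {hK1}hK1 := hK Phi K1 (_ : K1 <= K) hK1.
have {hK2}hK2 := hK Psi K2 (_ : K2 <= K) hK2.
have {hK3}hK3 := hK (adjf Phi) K3 (_ : K3 <= K) hK3.
have {hK4}hK4 := hK (adjf Psi) K4 (_ : K4 <= K) hK4.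
have {}hK1 := hK1 (ltac:(rewrite /K; lra)).
have {}hK2 := hK2 (ltac:(rewrite /K; lra)).
have {}hK3 := hK3 (ltac:(rewrite /K; lra)).
have {}hK4 := hK4 (ltac:(rewrite /K; lra)).
(* A common bound for the cross-term factor that is not small, in either case of the alternative; it
   uses |f'|^2 <= 2 (1 + |f|^2), valid since d <= 1. *)
pose M := K * (2 * (1 + mxnorm2 f)) + K * (2 * (1 + mxnorm2 g)).
have M0 : 0 <= M by rewrite addr_ge0 // mulr_ge0 // mulr_ge0 // addr_ge0 // mxnorm2_ge0.
have key (e : R) : 0 < e -> exists f' g' bf dg : C -> 'cV[C]_n,
  [/\ [/\ entrywise (@L2 R) f', entrywise (@L2 R) g', entrywise (@perp R) bf & entrywise (@perp R) dg],
     mxnorm2 (fun z => f z - f' z) <= e /\ mxnorm2 (fun z => g z - g' z) <= e,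
     entrywise (@H2 R) (fun z => Phi z *m f' z - bf z),
     entrywise (@H2 R) (fun z => Psi z *m g' z - dg z) &
     mxnorm2 bf <= e /\ mxnorm2 dg <= e].
  move=> e0; have [s [d [s0 d0 d1 de hsd]]] := eps_choice K0 M0 e0.
  have [N1 hN1] := mxnorm2_vpsum hf d0; have [N2 hN2] := mxnorm2_vpsum hg d0.
  have {hN1} := hN1 N1 (leqnn _); have {hN2} := hN2 N2 (leqnn _).
  have := vpsum_Hinfty f N1; have := vpsum_Hinfty g N2.
  set f' := vpsum f N1; set g' := vpsum g N2 => hg' hf' eg ef.
  have lf' := H2_ent_L2 (Hinfty_ent_H2 hf'); have lg' := H2_ent_L2 (Hinfty_ent_H2 hg').
  have [ac [bf [bg [df [dg [[pac pbf pbg pdf pdg] hac [hbf hdg] [hbg hdf] hineq]]]]]] :=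
    pseudo_hyponormal_ineq hP hQ hT hf' hg'.
  exists f', g', bf, dg; split => //.
    by split; [exact: le_trans ef de|exact: le_trans eg de].
  (* As Phi^* f + Psi^* g is in H^2, subtracting it does not change the component orthogonal to H^2;
     so [ac] is also that component of the image of (f' - f, g' - g). *)
  have eac : mxnorm2 ac <= 4 * (K * d).
    apply: (@le_trans _ _ (mxnorm2 (fun z => (adjf Phi z *m f' z - adjf Phi z *m f z) +
       (adjf Psi z *m g' z - adjf Psi z *m g z)))).
      apply: perp_H2_mxnorm2; first exact pac.
        by apply: entD (@L2D R) _ _; apply: entB (@L2B R) _ _; exact: L2_mulmx.
      apply: ent_eq (entB (@H2B R) hac hfg) _ => z.
      by rewrite [LHS]addrAC; congr (_ - _); rewrite addrACA opprD.
    apply: le_trans (mxnorm2D_le _ _) _.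
    - by apply: entB (@L2B R) _ _; exact: L2_mulmx.
    - by apply: entB (@L2B R) _ _; exact: L2_mulmx.
    have e1 := mxnorm2_approx K0 hK3 lf' lf (_ : mxnorm2 (fun z => f' z - f z) <= d).
    have e2 := mxnorm2_approx K0 hK4 lg' lg (_ : mxnorm2 (fun z => g' z - g z) <= d).
    have {}e1 := e1 (ltac:(by rewrite mxnorm2_sym)). have {}e2 := e2 (ltac:(by rewrite mxnorm2_sym)).
    exact (double_le e1 e2).
  (* For the factor about which nothing is assumed: its norm stays bounded. *)
  have bnd (S : C -> 'M[C]_n) (w w' b : C -> 'cV[C]_n) : entrywise (@Linfty R) S ->
     (forall F : C -> 'cV[C]_n, entrywise (@L2 R) F -> mxnorm2 (fun z => S z *m F z) <= K * mxnorm2 F) ->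
     entrywise (@L2 R) w -> entrywise (@L2 R) w' -> entrywise (@perp R) b ->
     entrywise (@H2 R) (fun z => S z *m w' z - b z) ->
     mxnorm2 (fun z => w z - w' z) <= d -> mxnorm2 b <= K * (2 * (1 + mxnorm2 w)).
    move=> hS hKS lw lw' pb hb hd.
    apply: le_trans (perp_H2_mxnorm2 pb (L2_mulmx hS lw') hb) _.
    apply: le_trans (hKS _ lw') _; apply: ler_wpM2l => //.
    have -> : w' = fun z => (w' z - w z) + w z by apply/funext => z; rewrite subrK.
    apply: le_trans (mxnorm2D_le (entB (@L2B R) lw' lw) lw) _.
    by rewrite ler_pM2l // lerD2r mxnorm2_sym (le_trans hd).
  (* For the factor assumed to vanish in the limit: with S w in H^2, [b] is the component orthogonal
     to H^2 of S (w' - w), hence small. *)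
  have sml (S : C -> 'M[C]_n) (w w' b : C -> 'cV[C]_n) : entrywise (@Linfty R) S ->
     (forall F : C -> 'cV[C]_n, entrywise (@L2 R) F -> mxnorm2 (fun z => S z *m F z) <= K * mxnorm2 F) ->
     entrywise (@L2 R) w -> entrywise (@L2 R) w' -> entrywise (@perp R) b ->
     entrywise (@H2 R) (fun z => S z *m w' z - b z) -> entrywise (@H2 R) (fun z => S z *m w z) ->
     mxnorm2 (fun z => w z - w' z) <= d -> mxnorm2 b <= K * d.
    move=> hS hKS lw lw' pb hb hw hd.
    apply: le_trans (perp_H2_mxnorm2 (y := fun z => S z *m w' z - S z *m w z) pb _ _) _.
    - by apply: entB (@L2B R) _ _; exact: L2_mulmx.
    - apply: ent_eq (entB (@H2B R) hb hw) _ => z; by rewrite addrAC.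
    - by apply: mxnorm2_approx; rewrite // mxnorm2_sym.
  have lbg := perp_ent_L2 pbg; have ldf := perp_ent_L2 pdf.
  have tot : mxnorm2 bf + mxnorm2 dg <= e.
    apply: le_trans hineq _; apply: le_trans hsd; apply: lerD => //.
    case: hor => [hPg|hQf].
    - have b1 := sml Phi g g' bg hP hK1 lg lg' pbg hbg hPg eg.
      have b2 := bnd Psi f f' df hQ hK2 lf lf' pdf hdf ef.
      apply: le_trans (re_inner_le lbg ldf s0) _; apply: lerD.
        by rewrite ler_pM2l.
      rewrite ler_pM2l ?invr_gt0 //; apply: le_trans b2 _.
      by rewrite /M lerDl mulr_ge0 // mulr_ge0 // addr_ge0 // mxnorm2_ge0.
    - have b1 := sml Psi f f' df hQ hK2 lf lf' pdf hdf hQf ef.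
      have b2 := bnd Phi g g' bg hP hK1 lg lg' pbg hbg eg.
      rewrite addrC; apply: le_trans (re_inner_le ldf lbg s0) _; apply: lerD.
        by rewrite ler_pM2l.
      rewrite ler_pM2l ?invr_gt0 //; apply: le_trans b2 _.
      by rewrite /M lerDr mulr_ge0 // mulr_ge0 // addr_ge0 // mxnorm2_ge0.
  split; apply: le_trans tot.
    by rewrite lerDl mxnorm2_ge0.
  by rewrite lerDr mxnorm2_ge0.
have fin (S : C -> 'M[C]_n) (w w' b : C -> 'cV[C]_n) (e : R) : entrywise (@Linfty R) S ->
     (forall F : C -> 'cV[C]_n, entrywise (@L2 R) F -> mxnorm2 (fun z => S z *m F z) <= K * mxnorm2 F) ->
     entrywise (@L2 R) w -> entrywise (@L2 R) w' -> entrywise (@perp R) b ->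
     entrywise (@H2 R) (fun z => S z *m w' z - b z) ->
     mxnorm2 (fun z => w z - w' z) <= e -> mxnorm2 b <= e ->
   exists x, [/\ entrywise (@L2 R) x,
     entrywise (@H2 R) (fun z => S z *m w z - x z) & mxnorm2 x <= (2 * (K + 1)) * e].
  move=> hS hKS lw lw' pb hb hd hbe; have lb := perp_ent_L2 pb.
  have lx : entrywise (@L2 R) (fun z => S z *m w z - S z *m w' z).
    by apply: entB (@L2B R) _ _; exact: L2_mulmx.
  exists (fun z => (S z *m w z - S z *m w' z) + b z); split.
  - exact: entD (@L2D R) lx lb.
  - apply: ent_eq hb _ => z; by rewrite opprD opprB addrA [S z *m w z + _]addrC subrK.
  - apply: le_trans (mxnorm2D_le lx lb) _.
    rewrite -mulrA ler_pM2l // mulrDl mul1r lerD //; exact: mxnorm2_approx.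
split.
- apply: (@H2_approx _ (2 * (K + 1))); first exact: L2_mulmx.
  move=> e e0; have [f' [g' [bf [dg [[lf' lg' pbf pdg] [ef eg] hbf hdg [eb ed]]]]]] := key e e0.
  exact: fin hP hK1 lf lf' pbf hbf ef eb.
- apply: (@H2_approx _ (2 * (K + 1))); first exact: L2_mulmx.
  move=> e e0; have [f' [g' [bf [dg [[lf' lg' pbf pdg] [ef eg] hbf hdg [eb ed]]]]]] := key e e0.
  exact: fin hQ hK2 lg lg' pdg hdg eg ed.
Qed.

End Hyponormal.

(** * Jets and the range of a Hankel operator *)

Section PolyDet.
Variable F : fieldType.

Definition setrow n (P : 'M[{poly F}]_n) i0 (r : 'rV[{poly F}]_n) : 'M[{poly F}]_n :=
  \matrix_(i, j) if i == i0 then r 0 j else P i j.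

Lemma det_setrow n (P : 'M[{poly F}]_n) i0 (r : 'rV[{poly F}]_n) :
  \det (setrow P i0 r) = (r *m \adj P) 0 i0.
Proof.
rewrite (expand_det_row _ i0) mxE; apply: eq_bigr => j _; rewrite !mxE eqxx; congr (_ * _).
rewrite /cofactor; congr (_ * \det _); apply/matrixP => a c; rewrite !mxE.
by rewrite eq_sym (negbTE (neq_lift _ _)).
Qed.

(** Multiplying a P = X r - X^N s by the adjugate gives, in the entry i0, a_(i0) det P = X det(P
    with row i0 replaced by r) - X^N (...). The last term comes from truncated expansions and is
    harmless as d < N. *)
Lemma det_row_replace n (P : 'M[{poly F}]_n) (a : 'rV[F]_n) i0 (r s : 'rV[{poly F}]_n) N d :
  a 0 i0 != 0 -> map_mx polyC a *m P = 'X *: r - 'X^N *: s -> (d < N)%N ->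
  'X^d %| \det (setrow P i0 r) -> 'X^(d.+1) %| \det P.
Proof.
move=> ai e dN hd.
have : (map_mx polyC a *m P *m \adj P) 0 i0 = (a 0 i0)%:P * \det P.
  rewrite -mulmxA mul_mx_adj mul_mx_scalar !mxE mulrC //.
rewrite e mulmxBl -!scalemxAl.
have -> (A B : 'rV[{poly F}]_n) : ('X *: A - 'X^N *: B) 0 i0 = 'X * A 0 i0 - 'X^N * B 0 i0.
  by rewrite !mxE.
rewrite -det_setrow => E.
have : 'X^(d.+1) %| (a 0 i0)%:P * \det P.
  rewrite -E dvdp_sub //; first by rewrite exprS dvdp_mul.
  by apply: dvdp_mulr; rewrite dvdp_exp2l.
by rewrite mul_polyC dvdpZr.
Qed.

(** p has order exactly j at 0, so p^n has order exactly j n. *)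
Lemma X_ndvd (p : {poly F}) j n : (forall k, (k < j)%N -> p`_k = 0) -> p`_j != 0 ->
  ~~ ('X^((j * n).+1) %| p ^+ n).
Proof.
move=> h0 hj; set q := drop_poly j p.
have pE : p = 'X^j * q.
  rewrite -{1}(poly_take_drop j p) mulrC [take_poly j p](_ : _ = 0) ?add0r //.
  by apply/polyP => k; rewrite coef_take_poly coef0; case: ifP => // /h0.
apply/negP; rewrite pE exprMn -exprM exprSr dvdp_mul2l ?expf_neq0 ?polyX_eq0 // => H.
have : root (q ^+ n) 0 by rewrite -dvdp_XsubCl subr0.
rewrite /root hornerE expf_eq0 => /andP[_].
by rewrite horner_coef0 coef_drop_poly add0n (negbTE hj).
Qed.

End PolyDet.

(** * Expansions in powers of the Blaschke factor *)

Section Jets.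
Variable R : realType.
Local Notation C := R[i].
Variable alpha : C.
Hypothesis a1 : `|alpha| < 1.
Local Notation b := (blaschke alpha).
Local Notation ev := (ev alpha).
Local Notation bq := (bquot alpha).
Implicit Types f g h : C -> C.

(** The coefficient of b^k in the expansion of f in powers of b, by repeated division with
    remainder. Using b as local coordinate at alpha, rather than z - alpha, makes multiplication by
    b a plain shift. *)
Definition jet k f : C := ev (iter k bq f).

Lemma bq_lin (a : C) f g : H2 f -> H2 g ->
  bq (fun z => a * f z + g z) = fun z => a * bq f z + bq g z.
Proof.
move=> hf hg; apply/funext => z; rewrite /bquot.
rewrite evD ?evZ //; [ring|exact: H2_L2|exact: L2Z (H2_L2 hf)|exact: H2_L2].
Qed.

Lemma jet_lin k (a : C) f g : H2 f -> H2 g ->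
  jet k (fun z => a * f z + g z) = a * jet k f + jet k g.
Proof.
rewrite /jet; elim: k f g => [|k IH] f g hf hg /=.
  by rewrite evD ?evZ //; [exact: H2_L2|exact: L2Z (H2_L2 hf)|exact: H2_L2].
by rewrite -!iterS !iterSr bq_lin // IH //; exact: bquot_H2.
Qed.

Lemma jet0 k : jet k (fun=> 0) = 0.
Proof.
have h := H2_cst (0 : C); have := jet_lin k (-1) h h.
rewrite (_ : (fun z : C => -1 * 0 + 0) = fun=> 0); last by apply/funext => z; rewrite mulr0 addr0.
by rewrite mulN1r addNr.
Qed.

Lemma jet_sum k (I : Type) (s : seq I) (c : I -> C) (f : I -> C -> C) :
  (forall i, H2 (f i)) ->
  jet k (fun z => \sum_(i <- s) c i * f i z) = \sum_(i <- s) c i * jet k (f i).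
Proof.
move=> hf; elim: s => [|i s IH].
  rewrite big_nil -[RHS](jet0 k); congr jet; by apply/funext => z; rewrite big_nil.
rewrite big_cons -IH -jet_lin //.
  by congr jet; apply/funext => z; rewrite big_cons.
by apply: H2_sum => k'; exact: H2Z.
Qed.

Lemma jet_ae k f g : H2 f -> H2 g -> ae_circle (fun z => f z = g z) -> jet k f = jet k g.
Proof.
rewrite /jet; elim: k f g => [|k IH] f g hf hg h.
  by apply: ev_ae => //; exact: H2_L2.
rewrite !iterSr; apply: IH; [exact: bquot_H2|exact: bquot_H2|].
have e : ev f = ev g by apply: ev_ae => //; exact: H2_L2.
by apply: ae_imp h => z _ hz; rewrite /bquot hz e.
Qed.

Lemma bq_b f z : H2 f -> `|z| = 1 -> bq (fun w => b w * f w) z = f z.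
Proof.
move=> hf z1; rewrite /bquot ev_b // subr0 /blaschke /wa.
by field; rewrite az_neq0 // za_neq0.
Qed.

Lemma jet_b0 f : H2 f -> jet 0 (fun z => b z * f z) = 0.
Proof. exact: ev_b. Qed.

Lemma jet_bS k f : H2 f -> jet k.+1 (fun z => b z * f z) = jet k f.
Proof.
move=> hf; rewrite /jet iterSr; apply: jet_ae => //.
  apply: bquot_H2 => //; exact: Hinfty_H2M (Hinfty_b a1) hf.
by apply: ae_all => z z1; exact: bq_b.
Qed.

Lemma jet_bX j f : H2 f -> (forall k, (k < j)%N -> jet k (fun z => b z ^+ j * f z) = 0) /\
  jet j (fun z => b z ^+ j * f z) = ev f.
Proof.
move=> hf; elim: j => [|j [IH1 IH2]].
  by split => //; rewrite /jet /=; congr ev; apply/funext => z; rewrite expr0 mul1r.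
have hj : H2 (fun z => b z ^+ j * f z) by exact: Hinfty_H2M (Hinfty_bX a1 j) hf.
have -> : (fun z => b z ^+ j.+1 * f z) = (fun z => b z * (b z ^+ j * f z)).
  by apply/funext => z; rewrite exprS mulrA.
split; last by rewrite jet_bS.
by case=> [|k] kj; [exact: jet_b0|rewrite jet_bS // IH1].
Qed.

Definition jetp N f : {poly C} := \poly_(k < N) jet k f.

(** Multiplication by b shifts the expansion; the subtracted term removes the coefficient pushed
    beyond the truncation. *)
Lemma jetp_b N f : H2 f -> (0 < N)%N ->
  jetp N (fun z => b z * f z) = 'X * jetp N f - 'X^N * (jet N.-1 f)%:P.
Proof.
move=> hf N0; apply/polyP => k.
rewrite coefB coef_poly coefXM coefXnM coef_poly coefC.
case: k => [|k]; first by rewrite N0 jet_b0 // eqxx subrr.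
rewrite /= jet_bS //; case: (ltngtP k.+1 N) => kN /=.
- by rewrite subr0.
- by rewrite subn_eq0 leqNgt kN /= subr0.
- by rewrite -kN subnn eqxx /= subrr.
Qed.

End Jets.

(** * Every simple pole part at alpha is attained by the image of M *)

Section Transfer.
Variable R : realType.
Local Notation C := R[i].
Variable alpha : C.
Hypothesis a1 : `|alpha| < 1.
Local Notation b := (blaschke alpha).
Variable n : nat.
Implicit Types (f g v w x y : C -> 'cV[C]_n) (M : C -> 'M[C]_n).

Definition evv x : 'cV[C]_n := \col_i ev alpha (ent x i ord0).
Definition bqv x : C -> 'cV[C]_n := fun z => \col_i bquot alpha (ent x i ord0) z.

Lemma H2v_scale (k : C -> C) x : Hinfty k -> entrywise (@H2 R) x ->
  entrywise (@H2 R) (fun z => k z *: x z).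
Proof. by move=> hk; apply: entZ => f; exact: Hinfty_H2M. Qed.

Lemma H2v_ae x y : entrywise (@H2 R) x -> entrywise (@L2 R) y ->
  ae_circle (fun z => x z = y z) -> entrywise (@H2 R) y.
Proof.
move=> hx ly h i j; apply: H2_ae (hx i j) (L2_cm (ly i j)) _.
by apply: ae_imp h => z _ ->.
Qed.

Lemma evvB x y : entrywise (@L2 R) x -> entrywise (@L2 R) y ->
  evv (fun z => x z - y z) = evv x - evv y.
Proof.
move=> lx ly; apply/matrixP => i j; rewrite !mxE.
rewrite (_ : ent (fun z => x z - y z) i 0 = fun z => ent x i 0 z + (-1) * ent y i 0 z).
  have l1 := L2Z (-1) (ly i 0).
  by rewrite (evD a1 (lx i 0) l1) (evZ a1 (-1) (ly i 0)) mulN1r.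
by apply/funext => z; rewrite /ent !mxE mulN1r.
Qed.

Lemma evv_sum (I : finType) (c : I -> C) (F : I -> C -> 'cV[C]_n) :
  (forall i, entrywise (@L2 R) (F i)) ->
  evv (fun z => \sum_i c i *: F i z) = \sum_i c i *: evv (F i).
Proof.
move=> lF; apply/matrixP => i j; rewrite mxE summxE.
under [RHS]eq_bigr do rewrite !mxE.
have -> : ent (fun z => \sum_k c k *: F k z) i 0 =
    fun z => \sum_k c k * ent (F k) i 0 z.
  by apply/funext => z; rewrite /ent summxE; apply: eq_bigr => k _; rewrite mxE.
elim: (index_enum I) => [|k s IH].
  rewrite big_nil -[RHS](ev_cst a1 0); congr ev; by apply/funext => z; rewrite big_nil.
have lc k' : L2 (fun z => c k' * ent (F k') i 0 z) by apply: L2Z; exact: lF.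
rewrite big_cons -IH -evZ //; last exact: lF.
rewrite -evD //; last exact: L2_sum.
by congr ev; apply/funext => z; rewrite big_cons.
Qed.

Lemma bqv_H2 x : entrywise (@H2 R) x -> entrywise (@H2 R) (bqv x).
Proof.
move=> hx i j; have := bquot_H2 a1 (hx i ord0); congr H2; by apply/funext => z; rewrite mxE.
Qed.

Lemma bqvE x z : `|z| = 1 -> x z = evv x + b z *: bqv x z.
Proof.
move=> z1; apply/matrixP => i j; rewrite !mxE ord1.
exact: (bquotE a1 (ent x i ord0) z1).
Qed.

Lemma H2_of_b x : entrywise (@L2 R) x -> entrywise (@H2 R) (fun z => b z *: x z) ->
  evv (fun z => b z *: x z) = 0 -> entrywise (@H2 R) x.
Proof.
move=> lx hbx e0; apply: (H2v_ae (bqv_H2 hbx) lx); apply: ae_all => z z1.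
have := bqvE (fun z => b z *: x z) z1; rewrite e0 add0r => /(scalerI (b_neq0 a1 z1)).
by move=> <-.
Qed.

Variable M : C -> 'M[C]_n.
Hypothesis hM : entrywise (@Linfty R) M.
Hypothesis hker : forall f, entrywise (@H2 R) f -> entrywise (@H2 R) (fun z => M z *m f z) ->
  scalar_mulH2 b f.
Variables (h u : C -> C) (j : nat).
Hypotheses (hu : Hinfty u) (eu : ev alpha u != 0)
  (hE : forall z, `|z| = 1 -> h z = b z ^+ j * u z) (hh : Hinfty h).
Hypothesis hhM : forall i k, Hinfty (fun z => h z * M z i k).

(* eps f is the b-torsion part of M f modulo H^2: it vanishes iff M f is in H^2. *)
Definition inV f := entrywise (@H2 R) f /\ entrywise (@H2 R) (fun z => b z *: (M z *m f z)).
Definition eps f := evv (fun z => b z *: (M z *m f z)).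

Lemma L2_M f : entrywise (@H2 R) f -> entrywise (@L2 R) (fun z => M z *m f z).
Proof. by move=> hf; apply: L2_mulmx hM (H2_ent_L2 hf). Qed.

(** The only use of the kernel hypothesis: with [eps f = 0] the function M f is analytic, so f = b
    w, and b M w = M f shows that w stays in V. *)
Lemma inV_ker f : inV f -> eps f = 0 ->
  exists2 w, inV w & ae_circle (fun z => f z = b z *: w z).
Proof.
move=> [hf hbf] e0; have hMf := H2_of_b (L2_M hf) hbf e0.
have [w hw fw] := hker hf hMf; exists w; last exact fw.
split; first exact hw.
have lbw : entrywise (@L2 R) (fun z => b z *: (M z *m w z)).
  by apply: entZ (L2_M hw) => k; apply: Linfty_L2M; case: (Hinfty_b a1).
apply: (H2v_ae hMf lbw); apply: ae_imp fw => z _ ->; exact: linearZ.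
Qed.

Lemma inV_sum (I : finType) (c : I -> C) (F : I -> C -> 'cV[C]_n) :
  (forall i, inV (F i)) -> inV (fun z => \sum_i c i *: F i z) /\
  eps (fun z => \sum_i c i *: F i z) = \sum_i c i *: eps (F i).
Proof.
move=> hF.
have H (G : I -> C -> 'cV[C]_n) : (forall i, entrywise (@H2 R) (G i)) ->
    entrywise (@H2 R) (fun z => \sum_i c i *: G i z).
  move=> hG i k; have := H2_sum (index_enum I) (fun l => H2Z (c l) (hG l i k)).
  congr H2; apply/funext => z; rewrite summxE; apply: eq_bigr => l _; by rewrite mxE.
have E : (fun z => b z *: (M z *m \sum_i c i *: F i z)) =
   (fun z => \sum_i c i *: (b z *: (M z *m F i z))).
  apply/funext => z; rewrite mulmx_sumr scaler_sumr; apply: eq_bigr => i _.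
  by rewrite -scalemxAr !scalerA mulrC.
split; last first.
  rewrite /eps E evv_sum // => i; apply: H2_ent_L2; by case: (hF i).
split; first by apply: H => i; case: (hF i).
by rewrite E; apply: H => i; case: (hF i).
Qed.

(** Row i is the truncated expansion at alpha of v i. The order of X in the determinant measures how
    far the v i are from being independent at alpha. *)
Definition Pmx N (v : 'I_n -> C -> 'cV[C]_n) : 'M[{poly C}]_n :=
  \matrix_(i, k) jetp alpha N (ent (v i) k ord0).

Lemma row_neq0 (a : 'rV[C]_n) : a != 0 -> exists i, a 0 i != 0.
Proof.
move=> an0; apply: contrapT => hno; move/eqP: an0; apply; apply/rowP => i; rewrite mxE.
by apply/eqP/negPn/negP => hi; apply: hno; exists i.
Qed.

Definition epsmx (v : 'I_n -> C -> 'cV[C]_n) : 'M[C]_n := \matrix_(i, k) eps (v i) k ord0.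

Lemma eps_sum (v : 'I_n -> C -> 'cV[C]_n) (a : 'rV[C]_n) : (forall i, inV (v i)) ->
  eps (fun z => \sum_i a 0 i *: v i z) = (a *m epsmx v)^T.
Proof.
move=> hv; rewrite (inV_sum (fun i => a 0 i) hv).2.
apply/matrixP => i k; rewrite ord1 summxE !mxE; apply: eq_bigr => l _.
by rewrite !mxE.
Qed.

Lemma eps_unit (v : 'I_n -> C -> 'cV[C]_n) : (forall i, inV (v i)) -> epsmx v \in unitmx ->
  forall c, exists2 f, inV f & eps f = c.
Proof.
move=> hv Eu c; pose a : 'rV[C]_n := c^T *m invmx (epsmx v).
exists (fun z => \sum_i a 0 i *: v i z); first exact (inV_sum (fun i => a 0 i) hv).1.
by rewrite eps_sum // /a mulmxKV // trmxK.
Qed.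

(** The relation sum a_i v_i = b w, expanded by [jetp_b], in the shape that [det_row_replace]
    expects. *)
Lemma Pmx_sum N (v : 'I_n -> C -> 'cV[C]_n) w (a : 'rV[C]_n) : (0 < N)%N ->
  (forall i, inV (v i)) -> inV w ->
  ae_circle (fun z => \sum_i a 0 i *: v i z = b z *: w z) ->
  map_mx polyC a *m Pmx N v =
    'X *: (\row_k jetp alpha N (ent w k ord0))
    - 'X^N *: (\row_k (jet alpha N.-1 (ent w k ord0))%:P).
Proof.
move=> N0 hv hw fw; apply/rowP => k; rewrite !mxE.
have hwk : H2 (ent w k ord0) by case: hw => hw _; exact (hw k ord0).
have hvk i : H2 (ent (v i) k ord0) by case: (hv i) => hvi _; exact (hvi k ord0).
rewrite -(jetp_b a1 hwk N0); apply/polyP => m; rewrite coef_sum coef_poly.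
under eq_bigr do rewrite !mxE coefCM coef_poly.
case: ifP => mN; last by rewrite big1 // => i _; rewrite mulr0.
rewrite -(jet_sum a1 m (index_enum 'I_n) (fun i => a 0 i) hvk); apply: (jet_ae a1).
- exact (H2_sum (index_enum 'I_n) (fun i => H2Z (a 0 i) (hvk i))).
- exact (Hinfty_H2M (Hinfty_b a1) hwk).
apply: ae_imp fw => z _ /matrixP /(_ k ord0); rewrite summxE !mxE => <-.
by apply: eq_bigr => i _; rewrite mxE.
Qed.

(* If the values eps (v i) are dependent, a combination of the v i is b w with w in V;
   substituting w for one of the v i lowers the order of the determinant. *)
Lemma eps_step N (v : 'I_n -> C -> 'cV[C]_n) : (0 < N)%N -> (forall i, inV (v i)) ->
  epsmx v \notin unitmx -> exists2 v', forall i, inV (v' i) &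
  forall d, (d < N)%N -> 'X^d %| \det (Pmx N v') -> 'X^(d.+1) %| \det (Pmx N v).
Proof.
move=> N0 hv; rewrite unitmxE unitfE negbK => /det0P [a an0 aE].
have h1 := (inV_sum (fun i => a 0 i) hv).1.
have e0 : eps (fun z => \sum_i a 0 i *: v i z) = 0 by rewrite eps_sum // aE trmx0.
have [w hw fw] := inV_ker h1 e0.
have [i0 ai0] := row_neq0 an0.
exists (fun i => if i == i0 then w else v i).
  by move=> i; case: ifP => _; [exact hw|exact (hv i)].
move=> d dN; have -> : Pmx N (fun i => if i == i0 then w else v i) =
    setrow (Pmx N v) i0 (\row_k jetp alpha N (ent w k ord0)).
  by apply/matrixP => i k; rewrite !mxE; case: ifP.
exact (det_row_replace ai0 (Pmx_sum N0 hv hw fw) dN).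
Qed.

(** While the values are dependent, [eps_step] supplies a new family whose determinant has lower
    order. At order 0 this is impossible, since X^0 divides everything, so the values must be
    independent and span C^n. *)
Lemma eps_onto_ind N d (v : 'I_n -> C -> 'cV[C]_n) : (d < N)%N ->
  (forall i, inV (v i)) -> ~~ ('X^(d.+1) %| \det (Pmx N v)) ->
  forall c, exists2 f, inV f & eps f = c.
Proof.
elim: d v => [|d IH] v dN hv hd.
all: have [Eu|nEu] := boolP (epsmx v \in unitmx); first exact: eps_unit hv Eu.
all: have [v' hv' hd'] := eps_step (leq_ltn_trans (leq0n _) dN) hv nEu.
  by move/negP: hd; case; apply: hd' => //; rewrite expr0 dvd1p.
apply: (IH v' (ltnW dN) hv'); apply/negP => H; move/negP: hd; apply.
exact: hd' dN H.
Qed.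

Lemma transfer c : exists2 f, inV f & eps f = c.
Proof.
have [n0|np] := posnP n.
  have hv0 : entrywise (@H2 R) (fun _ : C => 0 : 'cV[C]_n).
    by move=> i k; have := H2_cst (0 : C); congr H2; apply/funext => z; rewrite mxE.
  exists (fun=> 0).
    by split => // i; exfalso; move: (ltn_ord i); rewrite {2}n0.
  by apply/matrixP => i; exfalso; move: (ltn_ord i); rewrite {2}n0.
(* The starting family h e_i lies in V because h M is analytic. *)
pose v (i : 'I_n) : C -> 'cV[C]_n := fun z => h z *: delta_mx i 0.
have h2h : H2 h by case: hh.
have hv i : inV (v i).
  split.
    move=> k l; have := H2Z ((k == i) && (l == 0))%:R h2h; congr H2.
    by apply/funext => z; rewrite !mxE mulrC.
  apply: H2v_scale; first exact: Hinfty_b.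
  move=> k l; case: (hhM k i) => _; congr H2; apply/funext => z.
  by rewrite -scalemxAr -colE !mxE.
(* The matrix of this family is scalar with entry the expansion of h, of order j, so its determinant
   has order exactly j n; truncating at j n + 1 keeps the coefficient that shows it. *)
apply: (@eps_onto_ind (j * n).+1 (j * n) v (ltnSn _) hv).
pose p := jetp alpha (j * n).+1 h.
have -> : Pmx (j * n).+1 v = p%:M.
  apply/matrixP => i k; rewrite !mxE; case: eqVneq => [->|ik].
    congr jetp; apply/funext => z; by rewrite /ent !mxE !eqxx mulr1.
  rewrite mulr0n; apply/polyP => m; rewrite coef_poly coef0; case: ifP => // _.
  rewrite -[RHS](jet0 a1 m); congr jet; apply/funext => z.
  by rewrite /ent !mxE eq_sym (negbTE ik) mulr0.
rewrite det_scalar.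
have h2u : H2 u by case: hu.
have [j1 j2] := jet_bX a1 j h2u.
have jE k : jet alpha k h = jet alpha k (fun z => b z ^+ j * u z).
  apply: jet_ae => //; first exact: Hinfty_H2M (Hinfty_bX a1 j) h2u.
  exact: ae_all.
apply: X_ndvd => [k kj|].
  by rewrite coef_poly; case: ifP => // _; rewrite jE j1.
rewrite coef_poly ifT ?jE ?j2 //.
by rewrite ltnS leq_pmulr.
Qed.

End Transfer.

(** * Orders of poles *)

Section BoundedType.
Variable R : realType.
Local Notation C := R[i].
Implicit Types f g h : C -> C.

Lemma ae_False : ~ ae_circle (fun _ : C => False).
Proof.
move=> h; have : circle_int (fun _ : C => 1) = circle_int (fun _ : C => 0).
  by apply: ci_ae; [exact: cm_cst|exact: cm_cst|apply: ae_imp h].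
by rewrite !ci_cst => /eqP; rewrite oner_eq0.
Qed.

Lemma Hinfty_ae f g : Hinfty f -> Linfty g -> ae_circle (fun z => f z = g z) -> Hinfty g.
Proof.
move=> [lf hf] lg h; split => //; apply: H2_ae hf _ h; exact: Linfty_cm.
Qed.

Lemma Hinfty_prod (I : Type) (s : seq I) (P : pred I) (F : I -> C -> C) :
  (forall i, Hinfty (F i)) -> Hinfty (fun z => \prod_(i <- s | P i) F i z).
Proof.
move=> hF; elim: s => [|i s IH].
  have := Hinfty_cst (1 : C); congr Hinfty; by apply/funext => z; rewrite big_nil.
have [Pi|Pi] := boolP (P i).
  have := HinftyM (hF i) IH; congr Hinfty; by apply/funext => z; rewrite big_cons Pi.
by move: IH; congr Hinfty; apply/funext => z; rewrite big_cons (negbTE Pi).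
Qed.

(** h is the product of all denominators; h F_i is the numerator of F_i times the other
    denominators. *)
Lemma common_denom (I : finType) (F : I -> C -> C) :
  (forall i, Linfty (F i)) -> (forall i, bounded_type (F i)) ->
  exists h, [/\ Hinfty h, ae_circle (fun z => h z != 0) &
    forall i, Hinfty (fun z => h z * F i z)].
Proof.
move=> lF bF.
pose g i := projT1 (cid (bF i)).
pose d i := projT1 (cid (projT2 (cid (bF i)))).
have H i : [/\ Hinfty (g i), Hinfty (d i) & ae_circle (fun z => d i z != 0 /\ F i z = g i z / d i z)].
  exact: projT2 (cid (projT2 (cid (bF i)))).
have hd i : Hinfty (d i) by case: (H i).
have hg i : Hinfty (g i) by case: (H i).
have ha : ae_circle (fun z => forall i, d i z != 0 /\ F i z = g i z / d i z).
  by apply: ae_fin => i; case: (H i).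
have hp := Hinfty_prod (index_enum I) predT hd.
exists (fun z => \prod_i d i z); split => //.
  by apply: ae_imp ha => z _ h; apply/prodf_neq0 => i _; case: (h i).
move=> i; apply: (Hinfty_ae (HinftyM (hg i) (Hinfty_prod (index_enum I) (fun k => k != i) hd))).
  by case: hp => lp _; exact: LinftyM.
apply: ae_imp ha => z _ /(_ i) [di Fi]; rewrite Fi [in RHS](bigD1 i) //=.
by field.
Qed.

End BoundedType.

(** * Comparison of the kernels of the two Hankel operators *)

Section Main.
Variable R : realType.
Local Notation C := R[i].
Variable alpha : C.
Hypothesis a1 : `|alpha| < 1.
Local Notation b := (blaschke alpha).
Variable n : nat.
Implicit Types (f g : C -> 'cV[C]_n) (Phi Psi M : C -> 'M[C]_n).

Definition in_kerH Phi f :=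
  entrywise (@H2 R) f /\ entrywise (@H2 R) (fun z => Phi z *m f z).

Definition bdvd q f := scalar_mulH2 (fun z => b z ^+ q) f.

(** Evaluate u g = b^(q+1) x at alpha: u(alpha) g(alpha) = 0 gives g(alpha) = 0, so g is b times its
    quotient, and cancelling one b leaves the same relation with q. *)
Lemma div_coprime q (u g : C -> C) : Hinfty u -> ev alpha u != 0 -> H2 g ->
  (exists2 x, H2 x & ae_circle (fun z => u z * g z = b z ^+ q * x z)) ->
  exists2 y, H2 y & ae_circle (fun z => g z = b z ^+ q * y z).
Proof.
move=> hu eu; elim: q g => [|q IH] g hg [x hx hux].
  by exists g => //; apply: ae_all => z _; rewrite expr0 mul1r.
have hbx := Hinfty_H2M (Hinfty_bX a1 q) hx.
have hug := Hinfty_H2M hu hg.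
have e0 : ev alpha g = 0.
  apply: (mulfI eu); rewrite mulr0 -(evM a1 hu hg) -(ev_b a1 hbx).
  apply: (ev_ae a1); [exact: H2_L2|exact: H2_L2 (Hinfty_H2M (Hinfty_b a1) hbx)|].
  by apply: ae_imp hux => z _ ->; rewrite exprS mulrA.
have gE z : `|z| = 1 -> g z = b z * bquot alpha g z.
  by move=> z1; rewrite {1}(bquotE a1 g z1) e0 add0r.
(* The proof term cancels one factor b from both sides, pointwise on the circle. *)
have [y hy gy] := IH (bquot alpha g) (bquot_H2 a1 hg) (ex_intro2 _ _ x hx
  (ae_imp (P := fun z => u z * g z = b z ^+ q.+1 * x z) (fun z z1 e =>
    mulfI (b_neq0 a1 z1) (etrans (etrans (mulrCA _ _ _) (congr1 (fun w => u z * w) (esym (gE z z1))))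
     (etrans e (etrans (congr1 (fun w => w * x z) (exprS _ _)) (esym (mulrA _ _ _)))))) hux)).
exists y => //; apply: ae_imp gy => z z1 e.
by rewrite gE // e exprS mulrA.
Qed.

Lemma in_kerH_scale Phi k f : Hinfty k -> in_kerH Phi f -> in_kerH Phi (fun z => k z *: f z).
Proof.
move=> hk [hf hPf]; split; first exact: H2v_scale.
apply: ent_eq (H2v_scale hk hPf) _ => z; exact: scalemxAr.
Qed.

Lemma bdvd1P f : scalar_mulH2 b f <-> bdvd 1 f.
Proof.
by split => -[g hg e]; exists g => //; apply: ae_imp e => z _; rewrite expr1.
Qed.

Lemma bdvd_coprime q (u : C -> C) f : Hinfty u -> ev alpha u != 0 -> entrywise (@H2 R) f ->
  bdvd q (fun z => u z *: f z) -> bdvd q f.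
Proof.
move=> hu eu hf [x hx hux].
have P i : exists y, H2 y /\ ae_circle (fun z => f z i ord0 = b z ^+ q * y z).
  have [|y hy hfy] := @div_coprime q u (ent f i ord0) hu eu (hf i ord0).
    exists (ent x i ord0); first exact: hx.
    by apply: ae_imp hux => z _ /matrixP /(_ i ord0); rewrite !mxE.
  by exists y.
pose y i := projT1 (cid (P i)).
have hy i : H2 (y i) /\ ae_circle (fun z => f z i ord0 = b z ^+ q * y i z) := projT2 (cid (P i)).
exists (fun z => \col_i y i z).
  by move=> i k; case: (hy i) => H _; move: H; congr H2; apply/funext => z; rewrite mxE.
have : ae_circle (fun z => forall i, f z i ord0 = b z ^+ q * y i z).
  by apply: ae_fin => i; case: (hy i).
by apply: ae_imp => z _ H; apply/matrixP => i k; rewrite !mxE ord1.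
Qed.

Lemma ker_incl Phi Psi (h u : C -> C) j q :
  entrywise (@Linfty R) Phi -> entrywise (@Linfty R) Psi -> pseudo_hyponormal Phi Psi ->
  Hinfty h -> Hinfty u -> ev alpha u != 0 -> (forall z, `|z| = 1 -> h z = b z ^+ j * u z) ->
  (forall i k, Hinfty (fun z => h z * adjf Phi z i k)) ->
  (forall i k, Hinfty (fun z => h z * adjf Psi z i k)) ->
  (forall f, in_kerH Phi f -> bdvd 1 f) -> (forall f, in_kerH Psi f -> bdvd q f) ->
  forall f, in_kerH Phi f -> bdvd q f.
Proof.
move=> hP hQ hT hh hu eu hE hhP hhQ pP pQ g kg; have [hg hPg] := kg.
have hPa : entrywise (@Linfty R) (adjf Phi) by apply: ent_adj hP; exact: LinftyC.
have hQa : entrywise (@Linfty R) (adjf Psi) by apply: ent_adj hQ; exact: LinftyC.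
have h0 : entrywise (@H2 R) (fun _ : C => 0 : 'cV[C]_n).
  by move=> i k; have := H2_cst (0 : C); congr H2; apply/funext => z; rewrite mxE.
have kerA f : entrywise (@H2 R) f -> entrywise (@H2 R) (fun z => adjf Phi z *m f z) ->
    scalar_mulH2 b f.
  move=> hf hAf; apply/bdvd1P; apply: pP; split; first exact hf.
  have h1 : entrywise (@H2 R) (fun z => adjf Phi z *m f z + adjf Psi z *m (0 : 'cV[C]_n)).
    by apply: ent_eq hAf _ => z; rewrite mulmx0 addr0.
  have h2 : entrywise (@H2 R) (fun z => Phi z *m (0 : 'cV[C]_n)).
    by apply: ent_eq h0 _ => z; rewrite mulmx0.
  exact (pseudo_hyponormal_step hP hQ hT hf h0 h1 (or_introl h2)).1.
(* The function f is existential because it is replaced each time a power of b is removed. *)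
have key i : (exists2 f, entrywise (@H2 R) f &
      entrywise (@H2 R) (fun z => adjf Phi z *m f z + adjf Psi z *m ((b z ^+ i * u z) *: g z))) ->
    in_kerH Psi (fun z => u z *: g z).
  elim: i => [|i IH] [f hf hfg].
    have [hug hPug] := in_kerH_scale hu kg.
    have hfg' : entrywise (@H2 R) (fun z => adjf Phi z *m f z + adjf Psi z *m (u z *: g z)).
      by apply: ent_eq hfg _ => z; rewrite expr0 mul1r.
    split; first exact hug.
    exact (pseudo_hyponormal_step hP hQ hT hf hug hfg' (or_introl hPug)).2.
  have hk := HinftyM (Hinfty_bX a1 i.+1) hu.
  have [hkg hPkg] := in_kerH_scale hk kg.
  have [hPf _] := pseudo_hyponormal_step hP hQ hT hf hkg hfg (or_introl hPkg).
  have [f' hf' ff'] := pP f (conj hf hPf).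
  have hki := HinftyM (Hinfty_bX a1 i) hu.
  have [hgi _] := in_kerH_scale hki kg.
  pose gi z := (b z ^+ i * u z) *: g z.
  have lAf' := L2_mulmx hPa (H2_ent_L2 hf').
  have lDg := L2_mulmx hQa (H2_ent_L2 hgi).
  pose y z := adjf Phi z *m f' z + adjf Psi z *m gi z.
  have ly : entrywise (@L2 R) y := entD (@L2D R) lAf' lDg.
  have lb (x : C -> 'cV[C]_n) : entrywise (@L2 R) x -> entrywise (@L2 R) (fun z => b z *: x z).
    by move=> lx; apply: entZ lx => k; apply: Linfty_L2M; case: (Hinfty_b a1).
  have hby : entrywise (@H2 R) (fun z => b z *: y z).
    apply: (H2v_ae hfg (lb y ly)); apply: ae_imp ff' => z _ ->.
    by rewrite /y /gi scalerDr !scalemxAr scalerA expr1 exprS mulrA.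
  (* Since b y and b Phi^* f'' take the same value at alpha, their difference is divisible by b, and
     y - Phi^* f'' is analytic. *)
  have [f'' [hf'' hbf''] ef''] := transfer a1 hPa kerA hu eu hE hh hhP (evv alpha (fun z => b z *: y z)).
  have hd := entB (@H2B R) hf' hf''.
  apply: IH; exists (fun z => f' z - f'' z); first exact hd.
  have lAf'' := L2_mulmx hPa (H2_ent_L2 hf'').
  have ld : entrywise (@L2 R) (fun z => y z - adjf Phi z *m f'' z) := entB (@L2B R) ly lAf''.
  have bE z : b z *: y z - b z *: (adjf Phi z *m f'' z) = b z *: (y z - adjf Phi z *m f'' z).
    by rewrite scalerBr.
  have hbd : entrywise (@H2 R) (fun z => b z *: (y z - adjf Phi z *m f'' z)).
    by apply: ent_eq (entB (@H2B R) hby hbf'') _ => z; exact: bE.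
  have ed : evv alpha (fun z => b z *: (y z - adjf Phi z *m f'' z)) = 0.
    have <- : (fun z => b z *: y z - b z *: (adjf Phi z *m f'' z)) =
        (fun z => b z *: (y z - adjf Phi z *m f'' z)) by apply/funext => z; exact: bE.
    rewrite (evvB a1 (lb y ly) (lb _ lAf'')).
    by rewrite -ef'' /eps subrr.
  apply: ent_eq (H2_of_b a1 ld hbd ed) _ => z.
  by rewrite /y /gi mulmxBr addrAC.
apply: (bdvd_coprime hu eu hg); apply: pQ; apply: (key j).
exists (fun=> 0); first exact h0.
have hDg : entrywise (@H2 R) (fun z => (\matrix_(i, k) (h z * adjf Psi z i k)) *m g z).
  apply: (H2_mulmx (M := fun z => \matrix_(i, k) (h z * adjf Psi z i k))) hg.
  move=> i k; have := hhQ i k; congr Hinfty; by apply/funext => z; rewrite [RHS]mxE.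
have hbu := HinftyM (Hinfty_bX a1 j) hu.
have ll : entrywise (@L2 R) (fun z => adjf Phi z *m (0 : 'cV[C]_n) + adjf Psi z *m ((b z ^+ j * u z) *: g z)).
  apply: entD (@L2D R) _ _.
    exact: L2_mulmx hPa (H2_ent_L2 h0).
  exact: L2_mulmx hQa (H2_ent_L2 (H2v_scale hbu hg)).
apply: (H2v_ae hDg ll); apply: ae_all => z z1.
rewrite mulmx0 add0r -hE // -scalemxAr scalemxAl; congr (_ *m _).
by apply/matrixP => i k; rewrite !mxE.
Qed.

(** The vector h e_i0 is in the kernel. If q > j, then b^j u would be divisible by b^(j+1), and u
    would vanish at alpha. *)
Lemma ker_order_bound Phi (h u : C -> C) j q : (0 < n)%N ->
  Hinfty h -> Hinfty u -> ev alpha u != 0 -> (forall z, `|z| = 1 -> h z = b z ^+ j * u z) ->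
  (forall i k, Hinfty (fun z => h z * Phi z i k)) ->
  (forall f, in_kerH Phi f -> bdvd q f) -> (q <= j)%N.
Proof.
move=> n0 hh hu eu hE hhP pq; rewrite leqNgt; apply/negP => jq.
pose i0 := Ordinal n0.
have h2h : H2 h by case: hh.
have k0 : in_kerH Phi (fun z => h z *: delta_mx i0 0).
  split.
    move=> k l; have := H2Z ((k == i0) && (l == 0))%:R h2h; congr H2.
    by apply/funext => z; rewrite !mxE mulrC.
  move=> k l; case: (hhP k i0) => _; congr H2; apply/funext => z.
  by rewrite -scalemxAr -colE !mxE.
have [g hg e] := pq _ k0.
have hgi := hg i0 ord0.
have hx := Hinfty_H2M (Hinfty_bX a1 (q - j.+1)) hgi.
move/negP: eu; apply; apply/eqP; rewrite -(ev_b a1 hx); apply: (ev_ae a1).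
- by case: hu => lu _; exact: Linfty_L2.
- exact: H2_L2 (Hinfty_H2M (Hinfty_b a1) hx).
apply: ae_imp e => z z1 /matrixP /(_ i0 ord0); rewrite !mxE !eqxx mulr1 hE // => e.
apply: (mulfI (bX_neq0 a1 j z1)); rewrite e -{1}(subnKC jq) exprD exprS.
by ring.
Qed.

End Main.

Lemma ex_nat_max (P : nat -> Prop) B : P 1%N -> (forall q, P q -> (q <= B)%N) ->
  exists2 p, P p & forall q, P q -> (q <= p)%N.
Proof.
move=> P1 hB.
have ex : exists q, `[< P q >] by exists 1%N; apply/asboolP.
have ub q : `[< P q >] -> (q <= B)%N by move=> /asboolP; exact: hB.
case: (ex_maxnP ex ub) => p /asboolP Pp hp; exists p => // q Pq.
by apply: hp; apply/asboolP.
Qed.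

Lemma ge0_addrev (R : realType) (a b c d : R[i]) : 0 <= a + b + c + d -> 0 <= d + c + b + a.
Proof. by rewrite [d + c + b + a](_ : _ = a + b + c + d) //; ring. Qed.

(** Exchanging the symbols together with f and g permutes the four summands of the form, reversing
    their order. *)
Lemma pseudo_hyponormalC (R : realType) n (Phi Psi : R[i] -> 'M[R[i]]_n) :
  pseudo_hyponormal Phi Psi -> pseudo_hyponormal Psi Phi.
Proof.
move=> H; rewrite /pseudo_hyponormal; cbv zeta => f g [h1 h2 h3 h4] [h5 h6 h7 h8].
exact (ge0_addrev (H g f (And4 h7 h8 h5 h6) (And4 h3 h4 h1 h2))).
Qed.

Lemma singularityP (R : realType) n (Phi : R[i] -> 'M[R[i]]_n) (theta : R[i] -> R[i]) :
  entrywise (@Linfty R) Phi -> tensored_scalar_singularity Phi theta <->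
  forall f, in_kerH Phi f -> scalar_mulH2 theta f.
Proof.
move=> hPhi; split=> H f.
  by move=> [hf hPf]; apply: H; apply/(ker_hankelP hPhi hf).
by move=> hk; have hf := hk.1; apply: H; split => //; apply/(ker_hankelP hPhi hf).
Qed.

Theorem lemma9p16 (R : realType) (n : nat) (hn : (0 < n)%N)
    (Phi Psi : R[i] -> 'M[R[i]]_n)
    (hPhi : entrywise (@Linfty R) Phi) (hPsi : entrywise (@Linfty R) Psi)
    (btPhi : bounded_type_symbol Phi) (btPsi : bounded_type_symbol Psi)
    (hT : pseudo_hyponormal Phi Psi)
    (Theta1 A1 Theta2 A2 : R[i] -> 'M[R[i]]_n)
    (fPhi : right_coprime_factorization (plus_part Phi) Theta1 A1)
    (fPsi : right_coprime_factorization (plus_part Psi) Theta2 A2)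
    (hcomm : ae_circle (fun z => Theta1 z *m Theta2 z = Theta2 z *m Theta1 z))
    (alpha : R[i]) (halpha : `|alpha| < 1)
    (pPhi : tensored_scalar_pole Phi alpha)
    (pPsi : tensored_scalar_pole Psi alpha) :
  exists p : nat, tensored_scalar_pole_order Phi alpha p /\
                  tensored_scalar_pole_order Psi alpha p.
Proof.
have hPa : entrywise (@Linfty R) (adjf Phi) by apply: ent_adj hPhi; exact: LinftyC.
have hQa : entrywise (@Linfty R) (adjf Psi) by apply: ent_adj hPsi; exact: LinftyC.
(* The symbols and their adjoints are gathered in one family to get a single denominator h, hence a
   single j and u, for all of them; the default of [nth] is never reached for indices below 4. *)
pose G (k : nat) : R[i] -> 'M[R[i]]_n := nth Phi [:: Phi; adjf Phi; Psi; adjf Psi] k.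
have [h [hh h0 hG]] : exists h, [/\ Hinfty h, ae_circle (fun z => h z != 0) &
    forall t : 'I_4 * 'I_n * 'I_n, Hinfty (fun z => h z * G t.1.1 z t.1.2 t.2)].
  apply: common_denom => -[[[k kn] i] l]; rewrite /G /=.
    by case: k kn => [|[|[|[|//]]]] kn /=;
      [exact: hPhi|exact: hPa|exact: hPsi|exact: hQa].
  by case: k kn => [|[|[|[|//]]]] kn /=;
    [exact: btPhi.1|exact: btPhi.2|exact: btPsi.1|exact: btPsi.2].
have d0 i k : Hinfty (fun z => h z * Phi z i k) := hG (Ordinal (isT : (0 < 4)%N), i, k).
have d1 i k : Hinfty (fun z => h z * adjf Phi z i k) := hG (Ordinal (isT : (1 < 4)%N), i, k).
have d3 i k : Hinfty (fun z => h z * adjf Psi z i k) := hG (Ordinal (isT : (3 < 4)%N), i, k).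
have hne : ~ ae_circle (fun z => h z = 0).
  by move=> e; apply: (@ae_False R); apply: ae_imp2 h0 e => z _ /eqP.
have [j [u [hu eu hE]]] := b_order halpha hh hne.
have kP q : tensored_scalar_singularity Phi (fun z => blaschke alpha z ^+ q) <->
    forall f, in_kerH Phi f -> bdvd alpha q f := singularityP _ hPhi.
have kQ q : tensored_scalar_singularity Psi (fun z => blaschke alpha z ^+ q) <->
    forall f, in_kerH Psi f -> bdvd alpha q f := singularityP _ hPsi.
have P1 : forall f, in_kerH Phi f -> bdvd alpha 1 f.
  by move=> f kf; apply/bdvd1P; exact: (singularityP _ hPhi).1 pPhi f kf.
have Q1 : forall f, in_kerH Psi f -> bdvd alpha 1 f.
  by move=> f kf; apply/bdvd1P; exact: (singularityP _ hPsi).1 pPsi f kf.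
(* The same powers of b are admissible for both symbols, so the two maxima coincide. *)
have eqv q : (forall f, in_kerH Phi f -> bdvd alpha q f) <-> (forall f, in_kerH Psi f -> bdvd alpha q f).
  split => H.
    exact: (ker_incl halpha hPsi hPhi (pseudo_hyponormalC hT) hh hu eu hE d3 d1 Q1 H).
  exact: (ker_incl halpha hPhi hPsi hT hh hu eu hE d1 d3 P1 H).
(* The maximum exists: q = 1 is admissible by the common pole, and every admissible q is at most
   j. *)
have [p Pp hp] := ex_nat_max P1 (fun q => ker_order_bound halpha hn hh hu eu hE d0).
exists p; split; split.
- exact ((kP p).2 Pp).
- exact (fun q H => hp q ((kP q).1 H)).
- exact ((kQ p).2 ((eqv p).1 Pp)).
- exact (fun q H => hp q ((eqv q).2 ((kQ q).1 H))).
Qed.
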